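(* Let $D$ be a divisor in $\mathbb{C}$ and let $\rho>1$, $\sigma\ge 0$. Then $D$ is the zero divisor of some entire function $f\in[\rho,\sigma]^*$ if and only if there exist $\epsilon\in(0,\rho)$, $C>0$ and a real-valued function $\sigma(\cdot)$ on $(0,\infty)$ with $\sigma(t)\to\sigma$ as $t\to\infty$, such that $$\log n_D(x;r,h)\le C+r+\sigma(h)\,h^\rho+C|x|^{\frac{\rho-\epsilon}{1+\rho-\epsilon}}\qquad\text{for all } x\in\mathbb{R},\ r>0,\ h>0 .$$
   Context: A divisor in $\mathbb{C}$ is a locally finite set of points with positive integer multiplicities. The zero divisor of an entire function $f\not\equiv0$ is its zero set counted with multiplicities. For $x\in\mathbb{R}$ and $r,h>0$, $n_D(x;r,h)$ is the number of points of $D$, counted with multiplicities, in the box $\{z\in\mathbb{C}: |\mathrm{Re}\,z-x|\le r,\ |\mathrm{Im}\,z|\le h\}$. For an entire function $f$ of one variable put $M_f(h)=\sup\{|f(z)|: |\mathrm{Im}\,z|\le h\}$. $[\rho,\sigma]$ is the class of entire functions $f$ of one variable, with $M_f(h)<\infty$ for all $h>0$, such that $$\limsup_{h\to\infty}\frac{\log\log M_f(h)}{h^\rho}\le\sigma .$$ $[\rho,\sigma]^*$ is the class of those $f\in[\rho,\sigma]$ for which there exist $\epsilon\in(0,\rho)$ and $a,b>0$ such that for all $x\in\mathbb{R}$ $$\sup_{t\in\mathbb{R},\ |x-t|\le a}\log|f(t)|\ge-\exp\Bigl(b|x|^{\frac{\rho-\epsilon}{1+\rho-\epsilon}}\Bigr).$$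 Conventions: $\log 0=-\infty$, and $\log\log M=-\infty$ if $M\le1$. *)

(* Defs.v *)
From HB Require Import structures.
From mathcomp Require Import all_boot all_order all_algebra complex.
From mathcomp Require Import all_classical all_reals all_analysis.

Set Implicit Arguments.
Unset Strict Implicit.
Unset Printing Implicit Defensive.

Import Order.TTheory GRing.Theory Num.Theory.
Import numFieldNormedType.Exports.

Local Open Scope classical_set_scope.
Local Open Scope ring_scope.
Local Open Scope complex_scope.

(* MathComp's norm on R[i] takes its values in R[i]; [cmod] is the modulus as
   an element of R. *)
Notation cmod := (Normc.normc).

(* Derivability along the vector 1 over the field of scalars R[i], i.e.
   complex differentiability. *)
Definition entire (R : realType) (f : R[i] -> R[i]) : Prop :=
  forall z, derivable (f : R[i]^o -> R[i]^o) z 1.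

(* [mult z] is the multiplicity of the point z, with value 0 when z does not
   belong to the divisor. *)
Record divisor (R : realType) := Divisor {
  mult :> R[i] -> nat ;
  divisor_locally_finite : forall z : R[i],
    exists2 U : set R[i], nbhs (z : R[i]^o) U &
      finite_set (U `&` [set w | mult w != 0%N])
}.

(* With m = 0 this says f z <> 0. *)
Definition zero_of_order (R : realType) (f : R[i] -> R[i]) (z : R[i])
    (m : nat) : Prop :=
  exists g : R[i] -> R[i],
    [/\ entire g, g z != 0 & forall w, f w = (w - z) ^+ m * g w].

Definition zero_divisor (R : realType) (f : R[i] -> R[i]) (D : divisor R)
    : Prop :=
  (exists z, f z != 0) /\ forall z, zero_of_order f z (D z).

(* An extended real only because [\esum] is: local finiteness of D makes it
   a finite nonnegative integer. *)
Definition n_ (R : realType) (D : divisor R) (x r h : R) : \bar R :=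
  \esum_(z in [set z : R[i] | `|complex.Re z - x| <= r /\ `|complex.Im z| <= h])
    (D z)%:R%:E.

Definition M_ (R : realType) (f : R[i] -> R[i]) (h : R) : \bar R :=
  ereal_sup [set (cmod (f z))%:E | z in [set z : R[i] | `|complex.Im z| <= h]].

(* [lne y] is -oo for every y <= 0, so [lne 0] is -oo and [lne (lne M)] is -oo
   as soon as M <= 1. *)
Definition growth_class (R : realType) (rho sigma : R) (f : R[i] -> R[i])
    : Prop :=
  [/\ entire f,
      forall h : R, 0 < h -> (M_ f h < +oo)%E &
      (limf_esup (fun h : R => lne (lne (M_ f h)) * ((h `^ rho)^-1)%R%:E)
                 (pinfty_nbhs R) <= sigma%:E)%E].

Definition growth_class_star (R : realType) (rho sigma : R)
    (f : R[i] -> R[i]) : Prop :=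
  growth_class rho sigma f /\
  exists eps a b : R,
    [/\ 0 < eps < rho, 0 < a, 0 < b &
      forall x : R,
        ((- expR (b * `|x| `^ ((rho - eps) / (1 + rho - eps))))%R%:E <=
         ereal_sup [set lne (cmod (f t%:C))%:E |
                     t in [set t : R | (`|x - t| <= a)%R]])%E].

(* Main.v *)
(** Necessity: Jensen's formula on a disc of radius h + O(1) centred at a real
    point where f is not too small bounds the number of zeros in a box of
    half-width 1 by O(h) times log M_f(h + O(1)) plus the lower bound, and wide
    boxes are covered by such boxes.

    Sufficiency: f = c P exp(-G).  P is a product over the points a of D, grouped
    in unit cells.  The factor of a is (z - a) exp(-H(z - a)) with
    H'(s) = (1 - Q(s))/s, where Q is exp(-T s) times a power of a rescaled
    (1 - exp(-s))/s, so that the logarithmic derivative Q(s)/s of the factor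
    decays exponentially on one side of the horizontal line through a and rapidly
    along that line.  The rate T is the slope of h^rho at the height of a, so that
    the bounds of all factors stay below one convex function Phi of |Im z|, with
    Phi(h) <= (sigma + o(1)) h^rho, and log |P| <= exp(Phi(|Im z|) + ... +
    A |Re z|^p).  G is a product with zeros +-2^k i of multiplicity about 2^(k p'),
    p < p' < p''; its real part exceeds exp(kap |Re z|^p') where |Re z| is large
    compared with a power of |Im z|, hence removes the growth of P in |Re z|,
    while log |G| = O(|z|^p'') keeps f not too small on the real line.  *)
Require Import Defs.
From mathcomp Require Import all_boot all_order all_algebra complex.
From mathcomp Require Import all_classical all_reals all_analysis.
From mathcomp Require Import ring lra zify.
Import Order.TTheory GRing.Theory Num.Theory.
Import numFieldNormedType.Exports.
Local Open Scope classical_set_scope.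
Local Open Scope ring_scope.
Local Open Scope complex_scope.

Set Implicit Arguments.
Unset Strict Implicit.
Unset Printing Implicit Defensive.

(** * Complex differentiation *)

(** The shape of the exponent (rho - eps) / (1 + rho - eps) is what makes the damping work. P may
    grow doubly exponentially in |Re z|, whereas f must be bounded on every strip, so exp(-G) has to
    compensate. At x + iy the argument of G is O(|y| |x|^(p'' - 1)), and Re G is large and positive
    only while that argument stays small, that is for K |y| <= |x|^(1 - p''). Take p'' of the same
    shape with a smaller eps, and m = 1 + rho - eps for this new eps: then (1 - p'') m = 1 and m p''
    < rho. Outside the damped region |x| < 1 or |x| < (K |y|)^m, hence |x|^p'' is O(1 + |y|^(m
    p'')), negligible against h^rho. There both the growth of P in |x| and the size of G disappear
    in the error term of (sigma + o(1)) h^rho. The passage from eps to a smaller value leaves room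
    for p < p' < p''.

    The number sigma has to survive unchanged in the outer exponent. Therefore constants, shifts of
    h and terms linear in h are collected freely, since rho > 1 makes them o(h^rho), but no factor
    may appear in front of h^rho. *)

Section Modulus.
Variable R : realType.
Implicit Types z w : R[i].

Lemma normrc z : `|z| = (cmod z)%:C. Proof. by []. Qed.

Lemma cmod_ge0 z : 0 <= cmod z.
Proof. by case: z => a b; exact: sqrtr_ge0. Qed.
Hint Resolve cmod_ge0 : core.

Lemma cmodM z w : cmod (z * w) = cmod z * cmod w.
Proof. exact: Normc.normcM. Qed.

Lemma cmodV z : cmod z^-1 = (cmod z)^-1.
Proof. exact: Normc.normcV. Qed.

Lemma cmodD z w : cmod (z + w) <= cmod z + cmod w.
Proof. exact: le_normcD. Qed.

Lemma cmodN z : cmod (- z) = cmod z.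
Proof. exact: normcN. Qed.

Lemma cmodB z w : cmod (z - w) <= cmod z + cmod w.
Proof. by rewrite -(cmodN w) cmodD. Qed.

Lemma cmodBC z w : cmod (z - w) = cmod (w - z).
Proof. by rewrite -cmodN opprB. Qed.

Lemma cmod0 : cmod (0 : R[i]) = 0. Proof. exact: Normc.normc0. Qed.
Lemma cmod1 : cmod (1 : R[i]) = 1. Proof. exact: Normc.normc1. Qed.

Lemma cmod_eq0 z : (cmod z == 0) = (z == 0).
Proof.
by apply/eqP/eqP => [/Normc.eq0_normc //|->]; rewrite cmod0.
Qed.

Lemma cmod_gt0 z : (0 < cmod z) = (z != 0).
Proof. by rewrite lt_def cmod_ge0 andbT cmod_eq0. Qed.

Lemma cmodX z n : cmod (z ^+ n) = cmod z ^+ n.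
Proof. by elim: n => [|n ih]; rewrite ?cmod1 // !exprS cmodM ih. Qed.

Lemma cmodR (x : R) : cmod x%:C = `|x|.
Proof. by rewrite /= expr0n addr0 sqrtr_sqr. Qed.

Lemma cmod_i : cmod ('i : R[i]) = 1.
Proof. by rewrite /= expr0n add0r expr1n sqrtr1. Qed.

Lemma cmod_sqr z : cmod z ^+ 2 = complex.Re z ^+ 2 + complex.Im z ^+ 2.
Proof. by case: z => a b /=; rewrite sqr_sqrtr // addr_ge0 ?sqr_ge0. Qed.

Lemma normRe_le z : `|complex.Re z| <= cmod z.
Proof.
rewrite -(@ler_pXn2r _ 2) ?nnegrE // cmod_sqr real_normK ?num_real //.
by rewrite lerDl sqr_ge0.
Qed.

Lemma normIm_le z : `|complex.Im z| <= cmod z.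
Proof.
rewrite -(@ler_pXn2r _ 2) ?nnegrE // cmod_sqr real_normK ?num_real //.
by rewrite lerDr sqr_ge0.
Qed.

Lemma Re_le_cmod z : complex.Re z <= cmod z.
Proof. exact: le_trans (ler_norm _) (normRe_le z). Qed.

Lemma cmod_leD z : cmod z <= `|complex.Re z| + `|complex.Im z|.
Proof.
rewrite {1}[z]complexE (le_trans (cmodD _ _)) // cmodM cmod_i mul1r.
by rewrite !cmodR.
Qed.

Lemma cmod_prod (I : Type) (r : seq I) (P : pred I) (F : I -> R[i]) :
  cmod (\prod_(i <- r | P i) F i) = \prod_(i <- r | P i) cmod (F i).
Proof. by apply: (big_morph _ cmodM cmod1). Qed.

Lemma cmod_distD (z w : R[i]) : cmod z - cmod w <= cmod (z + w).
Proof. by rewrite lerBlDr -(cmodN w) (le_trans _ (cmodD _ _)) // addrK. Qed.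

Lemma complex_eqP z w :
  complex.Re z = complex.Re w -> complex.Im z = complex.Im w -> z = w.
Proof. by case: z w => [a b] [c d] /= -> ->. Qed.

Lemma cReD z w : complex.Re (z + w) = complex.Re z + complex.Re w.
Proof. by case: z w => [a b] [c d]. Qed.
Lemma cImD z w : complex.Im (z + w) = complex.Im z + complex.Im w.
Proof. by case: z w => [a b] [c d]. Qed.
Lemma cReN z : complex.Re (- z) = - complex.Re z.
Proof. by case: z. Qed.
Lemma cImN z : complex.Im (- z) = - complex.Im z.
Proof. by case: z. Qed.
Lemma cReM z w : complex.Re (z * w) =
  complex.Re z * complex.Re w - complex.Im z * complex.Im w.
Proof. by case: z w => [a b] [c d]. Qed.
Lemma cImM z w : complex.Im (z * w) =
  complex.Re z * complex.Im w + complex.Im z * complex.Re w.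
Proof. by case: z w => [a b] [c d]. Qed.

Lemma cReC (x : R) : complex.Re x%:C = x. Proof. by []. Qed.
Lemma cImC (x : R) : complex.Im x%:C = 0. Proof. by []. Qed.
Lemma cRePair (x y : R) : complex.Re (x +i* y) = x. Proof. by []. Qed.
Lemma cImPair (x y : R) : complex.Im (x +i* y) = y. Proof. by []. Qed.
Lemma cRe_i : complex.Re ('i : R[i]) = 0. Proof. by []. Qed.
Lemma cIm_i : complex.Im ('i : R[i]) = 1. Proof. by []. Qed.
Definition ReImE := (cRe_i, cIm_i, cReD, cImD, cReN, cImN, cReM, cImM, cRePair, cImPair, cReC, cImC).
End Modulus.
#[export] Hint Resolve cmod_ge0 : core.

Section Derivatives.
Variable R : realType.
Local Notation C := R[i].

(* Derivation of C-valued maps in a variable of V, where V is embedded in C by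
   [j]: [j] is the identity for complex derivatives and the inclusion of the
   reals for curves. *)
Definition gder (V : zmodType) (j : V -> C) (f : V -> C) (z : V) (l : C) :=
  forall e : R, 0 < e -> exists2 d : R, 0 < d &
    forall w : V, cmod (j w) < d ->
      cmod (f (z + w) - f z - l * j w) <= e * cmod (j w).

Definition cdiff := gder (V := C) id.
Definition rder := gder (V := R) (real_complex R).

Section Generic.
Variables (V : zmodType) (j : V -> C).

Lemma gder_cst c z : gder j (fun=> c) z 0.
Proof.
move=> e e0; exists 1 => // w _; rewrite subrr mul0r subrr cmod0.
by rewrite mulr_ge0 // ltW.
Qed.

Lemma gderD f g z l m : gder j f z l -> gder j g z m ->
  gder j (fun w => f w + g w) z (l + m).
Proof.
move=> F G e e0; have e2 : 0 < e / 2 by lra.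
have [d1 d10 H1] := F _ e2; have [d2 d20 H2] := G _ e2.
exists (Num.min d1 d2); first by rewrite lt_min d10 d20.
move=> w; rewrite lt_min => /andP[/H1 h1 /H2 h2].
rewrite (_ : _ - _ - _ = (f (z + w) - f z - l * j w)
                     + (g (z + w) - g z - m * j w)); last by ring.
apply: (le_trans (cmodD _ _)); lra.
Qed.

Lemma gder_lin f z l c : gder j f z l -> gder j (fun w => c * f w) z (c * l).
Proof.
move=> F e e0; pose K := cmod c + 1.
have K0 : 0 < K by rewrite /K ltr_wpDl.
have [d d0 H] := F (e / K) (divr_gt0 e0 K0); exists d => // w /H h.
rewrite (_ : _ - _ - _ = c * (f (z + w) - f z - l * j w)); last by ring.
rewrite cmodM (le_trans (ler_wpM2l _ h)) // mulrA ler_wpM2r //.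
rewrite mulrCA -[leRHS]mulr1 ler_wpM2l ?(ltW e0) // ler_pdivrMr // mul1r.
by rewrite /K lerDl.
Qed.

Lemma gder_comp (f : C -> C) (g : V -> C) z l m : cdiff f (g z) l -> gder j g z m ->
  gder j (fun w => f (g w)) z (l * m).
Proof.
move=> F G e e0.
(* The error of [g] is first kept below [cmod (j w)], so [K] bounds the increment of [g]; [e] is
   then shared equally by the two errors. *)
pose K := cmod m + 1; have K0 : 0 < K by rewrite /K ltr_wpDl.
pose L := cmod l + 1; have L0 : 0 < L by rewrite /L ltr_wpDl.
have eK : 0 < e / 2 / K by rewrite divr_gt0 //; lra.
have eL : 0 < Num.min 1 (e / 2 / L).
  by rewrite lt_min ltr01 divr_gt0 //; lra.
have [d1 d10 H1] := F _ eK; have [d2 d20 H2] := G _ eL.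
exists (Num.min d2 (d1 / K)); first by rewrite lt_min d20 divr_gt0.
move=> w; rewrite lt_min => /andP[/H2 h2 wd].
have h2' : cmod (g (z + w) - g z - m * j w) <= cmod (j w).
  apply: (le_trans h2); rewrite -[leRHS]mul1r ler_wpM2r //.
  by rewrite ge_min lexx.
have h2'' : cmod (g (z + w) - g z - m * j w) <= e / 2 / L * cmod (j w).
  by apply: (le_trans h2); rewrite ler_wpM2r // ge_min lexx orbT.
have hK : cmod (g (z + w) - g z) <= K * cmod (j w).
  rewrite (_ : g (z + w) - g z =
    (g (z + w) - g z - m * j w) + m * j w); last by ring.
  apply: (le_trans (cmodD _ _)); rewrite cmodM /K; lra.
have := H1 (g (z + w) - g z) _; rewrite ltr_pdivlMr // mulrC in wd.
move=> /(_ (le_lt_trans hK wd)) /=.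
rewrite (_ : g z + (g (z + w) - g z) = g (z + w)); last by ring.
move=> h1.
rewrite (_ : _ - _ - _ = (f (g (z + w)) - f (g z) - l * (g (z + w) - g z))
   + l * (g (z + w) - g z - m * j w)); last by ring.
apply: (le_trans (cmodD _ _)); rewrite cmodM.
rewrite (_ : e * _ = e / 2 / K * (K * cmod (j w)) + L * (e / 2 / L * cmod (j w)));
  last by field; rewrite !gt_eqF.
apply: lerD.
  apply: (le_trans h1); apply: ler_wpM2l hK; exact: ltW.
apply: ler_pM => //; by rewrite /L lerDl.
Qed.

Lemma gder_ext f g z l : (forall w, f w = g w) -> gder j f z l -> gder j g z l.
Proof. by move=> /funext ->. Qed.

Lemma gder_eq f z l m : l = m -> gder j f z l -> gder j f z m.
Proof. by move=> ->. Qed.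

Lemma gder_local f g z l (d : R) : 0 < d -> j 0 = 0 ->
  (forall w, cmod (j w) < d -> f (z + w) = g (z + w)) ->
  gder j f z l -> gder j g z l.
Proof.
move=> d0 j0 fg F e e0; have [d1 d10 H] := F e e0.
exists (Num.min d d1); first by rewrite lt_min d0.
move=> w; rewrite lt_min => /andP[wd /H]; rewrite fg //.
by have := fg 0; rewrite j0 cmod0 addr0 => ->.
Qed.

End Generic.

Lemma cdiff_id z : cdiff id z 1.
Proof.
move=> e e0; exists 1 => // w _; rewrite (_ : _ - _ - _ = 0) ?cmod0; last by rewrite /=; ring.
by rewrite mulr_ge0 // ltW.
Qed.

Lemma cdiff_sqr z : cdiff (fun w => w ^+ 2) z (2 * z).
Proof.
move=> e e0; exists e => // w we.
rewrite (_ : _ - _ - _ = w * w); last by rewrite /=; ring.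
by rewrite cmodM ler_wpM2r // ltW.
Qed.

(** Polarisation: f g = ((f + g)^2 - (f - g)^2) / 4 reduces the product rule to linearity, the chain
    rule and the derivative of the square. *)
Lemma gderM (V : zmodType) (j : V -> C) f g z l m :
  gder j f z l -> gder j g z m ->
  gder j (fun w => f w * g w) z (l * g z + f z * m).
Proof.
move=> F G.
have P := gderD F G.
have M := gderD F (gder_lin (-1) G).
have := gder_lin (4^-1) (gderD (gder_comp (cdiff_sqr _) P)
  (gder_lin (-1) (gder_comp (cdiff_sqr _) M))).
move/gder_ext => H.
apply: (gder_eq _ (H _ _)) => [|w]; by field.
Qed.

Lemma gderB (V : zmodType) (j : V -> C) f g z l m :
  gder j f z l -> gder j g z m -> gder j (fun w => f w - g w) z (l - m).
Proof.
move=> F /(gder_lin (-1)) G; have := gderD F G; rewrite mulN1r.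
by apply: gder_ext => w; rewrite mulN1r.
Qed.

Lemma cdiff_inv z : z != 0 -> cdiff (fun w => w^-1) z (- (z ^- 2)).
Proof.
move=> z0 e e0; pose a := cmod z.
have a0 : 0 < a by rewrite cmod_gt0.
exists (Num.min (a / 2) (e * a ^+ 3 / 2)).
  by rewrite lt_min !divr_gt0 // ?mulr_gt0 // exprn_gt0.
move=> w; rewrite lt_min /= => /andP[h1 h2].
have h3 : a / 2 <= cmod (z + w).
  by have := cmod_distD z w; rewrite -/a; lra.
have zw0 : z + w != 0 by rewrite -cmod_gt0 (lt_le_trans _ h3) // divr_gt0.
rewrite (_ : _ - _ - _ = w * (w * (z ^- 2 * (z + w)^-1))); last first.
  by field; rewrite zw0 z0.
rewrite !cmodM mulrC ler_wpM2r // !cmodV cmodX -/a.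
rewrite -invfM ler_pdivrMr ?mulr_gt0 ?exprn_gt0 ?cmod_gt0 //.
apply: (le_trans (ltW h2)).
rewrite (_ : e * a ^+ 3 / 2 = e * (a ^+ 2 * (a / 2))); last by field.
by rewrite ler_pM2l // ler_pM2l // exprn_gt0.
Qed.

Lemma cdiffV f z l : cdiff f z l -> f z != 0 ->
  cdiff (fun w => (f w)^-1) z (- l / f z ^+ 2).
Proof.
move=> F fz; have := gder_comp (cdiff_inv fz) F; apply: gder_eq.
by rewrite mulrC mulrN mulNr.
Qed.

Lemma cdiffX f z l n : cdiff f z l ->
  cdiff (fun w => f w ^+ n) z (n%:R * f z ^+ n.-1 * l).
Proof.
move=> F; elim: n => [|n ih].
  by rewrite !mul0r; apply: gder_ext (@gder_cst _ _ 1 _) => w; rewrite expr0.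
have := gderM F ih; move/gder_ext => /(_ (fun w => f w ^+ n.+1)) H.
apply: gder_eq (H _) => [|w]; last by rewrite exprS.
case: n {ih H} => [|n] /=; first by ring.
by rewrite exprS; ring.
Qed.

Definition ccont (f : C -> C) z := forall e : R, 0 < e ->
  exists2 d : R, 0 < d & forall w, cmod (w - z) < d -> cmod (f w - f z) <= e.

Lemma cdiff_cont f z l : cdiff f z l -> ccont f z.
Proof.
move=> F e e0; have [d d0 H] := F 1 ltr01.
pose K := cmod l + 1; have K0 : 0 < K by rewrite /K ltr_wpDl.
exists (Num.min d (e / K)); first by rewrite lt_min d0 divr_gt0.
move=> w; rewrite lt_min => /andP[/H h]; rewrite ltr_pdivlMr // => h2.
move: h; rewrite /= [z + _]addrC subrK => h.
rewrite (_ : f w - f z = (f w - f z - l * (w - z)) + l * (w - z)); last by ring.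
apply: (le_trans (cmodD _ _)); rewrite cmodM /K in h2 *; lra.
Qed.

Lemma cdiff_uniq f z l m : cdiff f z l -> cdiff f z m -> l = m.
Proof.
move=> F G; apply/eqP; rewrite -subr_eq0 -cmod_eq0 eq_le cmod_ge0 andbT.
apply/ler_addgt0Pr => e e0; rewrite add0r.
have [d d0 H] := gderB F G e0.
have := H (d / 2)%:C; rewrite !cmodR gtr0_norm; last by lra.
move=> /(_ _)/wrap[]; first by lra.
rewrite (_ : _ - _ - _ = - ((l - m) * (d / 2)%:C)); last by ring.
by rewrite cmodN cmodM cmodR gtr0_norm ?ler_pM2r //; lra.
Qed.

End Derivatives.

(** * Comparison with the derivative of the statement, and mean value inequalities *)

Section Bridge.

(** One proof over a numeric field covers both real derivatives and derivatives over [R[i]]. The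
    division-free form admits the increment 0. *)
Lemma is_derive_epsP (K : numFieldType) (f : K -> K) (x l : K) :
  is_derive (x : K^o) 1 (f : K^o -> K^o) l <->
  forall e : K, 0 < e -> exists2 d : K, 0 < d &
    forall h : K, `|h| < d -> `|f (x + h) - f x - l * h| <= e * `|h|.
Proof.
have E (m h : K) : h != 0 ->
   `|m - h^-1 * (f (h * 1 + x) - f x)| = `|f (x + h) - f x - m * h| / `|h|.
  move=> h0; rewrite -normfV -normrM -normrN; congr `|_|.
  by rewrite mulr1 [h + x]addrC; field.
split => [[/cvg_ex[/= m fm] <-] e e0|H].
  have -> : 'D_1 (f : K^o -> K^o) x = m by exact: (cvg_lim _ fm).
  move/cvgrPdist_le : fm => /(_ _ e0); rewrite near_withinE.
  move=> /nbhs_normP[d /= d0 H]; exists d => // h hd.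
  have [->|h0] := eqVneq h 0.
    by rewrite addr0 subrr mulr0 subr0 normr0 mulr0.
  have := H h; rewrite /= sub0r normrN => /(_ hd h0) Hh.
  have {}Hh : `|m - h^-1 * (f (h * 1 + x) - f x)| <= e := Hh.
  by move: Hh; rewrite E // ler_pdivrMr ?normr_gt0.
have : (fun h : K => h^-1 *: (f (h *: 1 + x) - f x : K^o)) @ 0^' --> (l : K^o).
  apply/cvgrPdist_le => e e0; rewrite near_withinE.
  have [d d0 D] := H e e0.
  apply/nbhs_normP; exists d => // h /=; rewrite sub0r normrN => hd h0.
  suff : `|l - h^-1 * (f (h * 1 + x) - f x)| <= e by [].
  by rewrite E // ler_pdivrMr ?normr_gt0 // D.
move=> fl; split; last exact: (cvg_lim _ fl).
by apply/cvg_ex; exists l.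
Qed.

Variable R : realType.
Local Notation C := R[i].

Lemma cdiffP (f : C -> C) z l :
  is_derive (z : C^o) 1 (f : C^o -> C^o) l <-> cdiff f z l.
Proof.
split=> [/is_derive_epsP H e e0|H].
  have ec0 : (0 : C) < e%:C by rewrite ltcR.
  have [d d0 D] := H _ ec0.
  (* A positive element of [R[i]] is real; this is how radii and tolerances pass between [R[i]] and
     [R]. *)
  have dE : d = (complex.Re d)%:C.
    by apply: complex_eqP => //=; move: d0; rewrite ltcE => /andP[/eqP].
  exists (complex.Re d); first by move: d0; rewrite ltcE => /andP[].
  move=> w wd; have := D w; rewrite !normrc dE ltcR => /(_ wd).
  by rewrite -rmorphM lecR.
apply/is_derive_epsP => e e0.
have eE : e = (complex.Re e)%:C.
  by apply: complex_eqP => //=; move: e0; rewrite ltcE => /andP[/eqP].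
have [d d0 D] : exists2 d : R, 0 < d & forall w, cmod w < d ->
   cmod (f (z + w) - f z - l * w) <= complex.Re e * cmod w.
  by apply: H; move: e0; rewrite ltcE => /andP[].
exists d%:C; first by rewrite ltcR.
by move=> h; rewrite !normrc eE ltcR -rmorphM lecR; exact: D.
Qed.

Lemma entireP (f : C -> C) : entire f <-> forall z, exists l, cdiff f z l.
Proof.
split=> [H z|H z]; first by exists ('D_1 (f : C^o -> C^o) z); apply/cdiffP.
by have [l /cdiffP[]] := H z.
Qed.

Lemma rderP (g : R -> C) t l : rder g t l <->
  is_derive t 1 (fun s => complex.Re (g s)) (complex.Re l) /\
  is_derive t 1 (fun s => complex.Im (g s)) (complex.Im l).
Proof.
split=> [H|[/is_derive_epsP H1 /is_derive_epsP H2] e e0].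
  split; apply/is_derive_epsP => e e0; have [d d0 D] := H _ e0; exists d => // h;
  rewrite -cmodR => /D; rewrite cmodR; apply: le_trans.
    apply: le_trans (normRe_le _); rewrite !ReImE.
    by rewrite mulr0 subr0.
  apply: le_trans (normIm_le _); rewrite !ReImE.
  by rewrite mulr0 add0r.
have e2 : 0 < e / 2 by lra.
have [d1 d10 D1] := H1 _ e2; have [d2 d20 D2] := H2 _ e2.
exists (Num.min d1 d2); first by rewrite lt_min d10.
move=> h; rewrite cmodR lt_min => /andP[/D1 h1 /D2 h2].
apply: (le_trans (cmod_leD _)).
rewrite !ReImE mulr0 subr0 mulr0 add0r; lra.
Qed.

Lemma rder_id t : rder (@real_complex_def R (Phant R)) t 1.
Proof.
move=> e e0; exists 1 => // h _; rewrite (_ : _ - _ - _ = 0) ?cmod0.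
  by rewrite mulr_ge0 // ltW.
by rewrite rmorphD; ring.
Qed.

Lemma rder_line (f : C -> C) p d t l : cdiff f (p + t%:C * d) l ->
  rder (fun s => f (p + s%:C * d)) t (l * d).
Proof.
move=> F; apply: gder_comp => //.
have := gderD (@gder_cst _ _ (real_complex R) p t) (gder_lin d (rder_id t)).
by rewrite add0r mulr1; apply: gder_ext => s; rewrite mulrC.
Qed.

Lemma is_derive_le (F F' : R -> R) (a b : R) : a <= b ->
  (forall t : R, a <= t <= b -> is_derive t 1 F (F' t)) ->
  (forall t : R, a <= t <= b -> 0 <= F' t) -> F a <= F b.
Proof.
move=> ab HF F0.
have sub (t : R) : t \in `]a, b[ -> a <= t <= b.
  by rewrite in_itv /= => /andP[/ltW -> /ltW ->].
have dF (t : R) : t \in `]a, b[ -> derivable F t 1.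
  by move=> /sub /HF[].
have dF0 (t : R) : t \in `]a, b[ -> 0 <= F^`()%classic t.
  move=> /sub tab; rewrite derive1E; have := HF _ tab => -[_ ->]; exact: F0.
apply: (@ger0_derive1_le R F a b dF dF0 true false) => //; rewrite ?in_itv /= ?lexx ?ab //.
apply: derivable_within_continuous => t; rewrite in_itv /= => /HF[] //.
Qed.

(* The bound is obtained by testing the increment against its own direction. *)
Lemma rder_mvt (g l : R -> C) (G G' : R -> R) (a b : R) : a <= b ->
  (forall t : R, a <= t <= b -> rder g t (l t)) ->
  (forall t : R, a <= t <= b -> is_derive t 1 G (G' t)) ->
  (forall t : R, a <= t <= b -> cmod (l t) <= G' t) ->
  cmod (g b - g a) <= G b - G a.
Proof.
move=> ab Hg HG Hl; pose u := conjc (g b - g a); pose k := cmod u.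
have kE : cmod (g b - g a) = k by rewrite /k /u; case: (g b - g a) => x y /=; rewrite sqrrN.
have := @is_derive_le (fun t => k * G t - complex.Re (u * g t))
  (fun t => k * G' t - complex.Re (u * l t)) a b ab.
have dt (t : R) : a <= t <= b -> is_derive t 1 (fun t => k * G t - complex.Re (u * g t))
     (k * G' t - complex.Re (u * l t)).
  move=> tab; have /rderP[/= h _] := gder_lin u (Hg _ tab).
  apply: is_deriveB; exact: is_deriveZ (HG _ tab).
move=> /(_ dt) H.
have {H} : k * G a - complex.Re (u * g a) <= k * G b - complex.Re (u * g b).
  apply: H => t tab; rewrite subr_ge0 (le_trans (Re_le_cmod _)) // cmodM.
  by apply: ler_wpM2l; [exact: cmod_ge0|exact: Hl].
have E : complex.Re (u * g b) - complex.Re (u * g a) = k ^+ 2.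
  rewrite -kE cmod_sqr /u; case: (g b) (g a) => x y [x' y'] /=; ring.
rewrite kE; have [k0|k0] := eqVneq k 0.
  move=> _; rewrite k0 subr_ge0; apply: (is_derive_le ab HG) => t /Hl.
  by apply: le_trans.
move=> H; have k0' : 0 < k by rewrite lt_def k0 cmod_ge0.
rewrite -(ler_pM2l k0') -expr2 -E; lra.
Qed.

End Bridge.

(** * Cauchy's theorem on rectangles *)

Section Primitives.
Variable R : realType.
Local Notation C := R[i].

Lemma is_derive_incr (F G f : R -> R) (a b : R) : a <= b ->
  (forall t : R, a <= t <= b -> is_derive t 1 F (f t)) ->
  (forall t : R, a <= t <= b -> is_derive t 1 G (f t)) ->
  F b - F a = G b - G a.
Proof.
move=> ab HF HG.
have h1 := @is_derive_le R (fun t => F t - G t) (fun=> 0) a b ab.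
have h2 := @is_derive_le R (fun t => G t - F t) (fun=> 0) a b ab.
have d1 (t : R) : a <= t <= b -> is_derive t 1 (fun t => F t - G t) 0.
  move=> tab; rewrite -(subrr (f t)); apply: is_deriveB; [exact: HF|exact: HG].
have d2 (t : R) : a <= t <= b -> is_derive t 1 (fun t => G t - F t) 0.
  move=> tab; rewrite -(subrr (f t)); apply: is_deriveB; [exact: HG|exact: HF].
have {}h1 := h1 d1 (fun _ _ => lexx _); have {}h2 := h2 d2 (fun _ _ => lexx _); lra.
Qed.

(** The normalisation at 0 makes the primitives on nested intervals agree, so that [primitive_ex]
    can glue them. *)
Lemma primitive_seg (f : R -> R) (n : R) : 0 < n -> continuous f ->
  exists F : R -> R, F 0 = 0 /\ forall t : R, - n < t < n -> is_derive t 1 F (f t).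
Proof.
move=> n0 cf.
pose F x := (\int[lebesgue_measure]_(t in `[- n, x]) f t)%R.
exists (fun x => F x - F 0); split; first by rewrite subrr.
move=> t /andP[nt tn].
have [] := @continuous_FTC1_closed R f (- n) t n tn _ nt (cf t).
  apply: continuous_compact_integrable; first exact: segment_compact.
  by apply: continuous_subspaceT.
rewrite -/F => dF eF.
have HF : is_derive t 1 F (f t).
  by apply: (DeriveDef dF); rewrite -derive1E; exact: eF.
by have := is_deriveB HF (is_derive_cst (F 0) t 1); rewrite subr0.
Qed.

Lemma primitive_ex (f : R -> R) : continuous f ->
  exists F : R -> R, forall t : R, is_derive t 1 F (f t).
Proof.
move=> cf.
have /choice[U HU] : forall n : nat, exists F : R -> R, F 0 = 0 /\
    forall t : R, - n.+1%:R < t < n.+1%:R -> is_derive t 1 F (f t).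
  by move=> n; exact: primitive_seg.
have UE (n m : nat) (x : R) : (n <= m)%N -> - n.+1%:R < x < n.+1%:R -> U n x = U m x.
  move=> nm /andP[x1 x2]; have [Un0 dUn] := HU n; have [Um0 dUm] := HU m.
  have nm' : (n.+1%:R : R) <= m.+1%:R by rewrite ler_nat.
  have n0 : 0 < n.+1%:R :> R by rewrite ltr0n.
  have [x0|x0] := leP 0 x.
    have := @is_derive_incr (U n) (U m) f 0 x x0.
    rewrite Un0 Um0 !subr0; apply => t tx.
      apply: dUn; lra.
    apply: dUm; lra.
  have := @is_derive_incr (U n) (U m) f x 0 (ltW x0).
  rewrite Un0 Um0 !sub0r => H; apply: oppr_inj; apply: H => t tx.
    apply: dUn; lra.
  apply: dUm; lra.
(* Each point is interior to the interval of its index. Near [t] all indices are at most [n], so the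
   glued function coincides there with [U n]. *)
exists (fun x => U (Num.truncn `|x|).+1 x) => t.
pose n := (Num.truncn `|t|).+2.
have tn : `|t| < n.-1%:R by have /andP[] := truncn_itv (normr_ge0 t).
have n1 : n.-1%:R < n.+1%:R :> R by rewrite ltr_nat.
apply: (@near_eq_is_derive _ _ _ (U n)); last first.
  by apply: (HU n).2; rewrite -ltr_norml (lt_trans tn).
apply/nbhs_normP; exists (n.-1%:R - `|t|); first by rewrite /= subr_gt0.
move=> x /= xt.
have xn : `|x| < n.-1%:R.
  have := ler_normB t (t - x); rewrite (_ : t - (t - x) = x);
    last by ring.
  by move=> h; rewrite (le_lt_trans h) // addrC -ltrBrDr.
apply/esym; apply: UE.
  by rewrite ltnS -ltnS truncn_lt_nat // (lt_trans xn) // ltr_nat.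
have /andP[_ h] := truncn_itv (normr_ge0 x).
by rewrite -ltr_norml (lt_le_trans h) // ler_nat.
Qed.

Definition rcont (g : R -> C) := forall (t e : R), 0 < e ->
  exists2 d : R, 0 < d & forall s, `|s - t| < d -> cmod (g s - g t) <= e.

Lemma rcont_Re g : rcont g -> continuous (fun t => complex.Re (g t)).
Proof.
move=> H t; apply/cvgrPdist_le => e e0; have [d d0 D] := H t e e0.
apply/nbhs_normP; exists d => // s /=; rewrite distrC => /D h.
rewrite distrC; apply: le_trans h; apply: le_trans (normRe_le _).
by rewrite cReD cReN.
Qed.

Lemma rcont_Im g : rcont g -> continuous (fun t => complex.Im (g t)).
Proof.
move=> H t; apply/cvgrPdist_le => e e0; have [d d0 D] := H t e e0.
apply/nbhs_normP; exists d => // s /=; rewrite distrC => /D h.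
rewrite distrC; apply: le_trans h; apply: le_trans (normIm_le _).
by rewrite cImD cImN.
Qed.

(** Integrals are differences of one chosen primitive, with the zero function as default. Additivity
    over intervals is then pure algebra and holds for every integrand. *)
Definition cprim (g : R -> C) : R -> C :=
  xget (fun=> 0) [set G | forall t, rder G t (g t)].
Definition cint (g : R -> C) (a b : R) := cprim g b - cprim g a.

Lemma rcont_prim g : rcont g -> exists G, forall t, rder G t (g t).
Proof.
move=> H; have [A HA] := primitive_ex (rcont_Re H).
have [B HB] := primitive_ex (rcont_Im H).
by exists (fun t => A t +i* B t) => t; apply/rderP; split; [exact: HA|exact: HB].
Qed.

Lemma cprimP g : rcont g -> forall t, rder (cprim g) t (g t).
Proof.
move=> /rcont_prim[G HG]; rewrite /cprim; case: xgetP => [_ -> //|/(_ G)].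
by case.
Qed.

Lemma rder0_cst (G : R -> C) a b : (forall t, rder G t 0) -> G a = G b.
Proof.
move=> H; apply: complex_eqP.
  by apply: (@is_derive_0_is_cst _ (fun t => complex.Re (G t))) => t; have /rderP[] := H t.
by apply: (@is_derive_0_is_cst _ (fun t => complex.Im (G t))) => t; have /rderP[] := H t.
Qed.

Lemma cint_eq G g a b : (forall t, rder G t (g t)) -> cint g a b = G b - G a.
Proof.
move=> H; rewrite /cint /cprim; case: xgetP => [F _ HF|/(_ G)]; last by case.
have := @rder0_cst (fun t => F t - G t) a b; have E : forall t, rder (fun t => F t - G t) t 0.
  by move=> t; have := gderB (HF t) (H t); rewrite subrr.
move=> /(_ E) EE; apply/eqP; rewrite -subr_eq0.
rewrite (_ : _ - _ = (F b - G b) - (F a - G a)); last by ring.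
by rewrite EE subrr.
Qed.

Lemma cintD g a b c : cint g a b + cint g b c = cint g a c.
Proof. by rewrite /cint; ring. Qed.

Lemma cintN g a b : cint g a b = - cint g b a.
Proof. by rewrite /cint; ring. Qed.

Lemma rcontD g h : rcont g -> rcont h -> rcont (fun t => g t + h t).
Proof.
move=> G H t e e0; have e2 : 0 < e / 2 by lra.
have [d1 d10 D1] := G t _ e2; have [d2 d20 D2] := H t _ e2.
exists (Num.min d1 d2); first by rewrite lt_min d10.
move=> s; rewrite lt_min => /andP[/D1 h1 /D2 h2].
rewrite (_ : _ - _ = (g s - g t) + (h s - h t)); last by ring.
apply: (le_trans (cmodD _ _)); lra.
Qed.

Lemma rcontZ c g : rcont g -> rcont (fun t => c * g t).
Proof.
move=> G t e e0; pose K := cmod c + 1; have K0 : 0 < K by rewrite ltr_wpDl.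
have [d d0 D] := G t (e / K) (divr_gt0 e0 K0); exists d => // s /D.
rewrite ler_pdivlMr // => h; rewrite -mulrBr cmodM mulrC.
apply: le_trans h; apply: ler_wpM2l; first exact: cmod_ge0.
by rewrite /K lerDl.
Qed.

Lemma cint_lin c g h a b : rcont g -> rcont h ->
  cint (fun t => c * g t + h t) a b = c * cint g a b + cint h a b.
Proof.
move=> G H; rewrite (@cint_eq (fun t => c * cprim g t + cprim h t)).
  by rewrite /cint; ring.
by move=> t; apply: gderD (cprimP H t); apply: gder_lin (cprimP G t).
Qed.

Lemma cint_boundle g M (a b : R) : rcont g -> a <= b ->
  (forall t, a <= t <= b -> cmod (g t) <= M) -> cmod (cint g a b) <= M * (b - a).
Proof.
move=> G ab H.
have := @rder_mvt R (cprim g) g (fun t => M * t) (fun=> M) a b ab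
  (fun t _ => cprimP G t).
rewrite mulrBr; apply=> // t _.
by have := is_deriveZ M (is_derive_id t 1); rewrite /GRing.scale /= mulr1.
Qed.

Lemma cint_bound g M (a b : R) : rcont g ->
  (forall t, Num.min a b <= t <= Num.max a b -> cmod (g t) <= M) ->
  cmod (cint g a b) <= M * `|b - a|.
Proof.
move=> G; case: (leP a b) => ab H.
  by rewrite ger0_norm ?subr_ge0 // cint_boundle.
by rewrite cintN cmodN distrC gtr0_norm ?subr_gt0 // cint_boundle // ltW.
Qed.

End Primitives.

Section Rectangles.
Variable R : realType.
Local Notation C := R[i].
Implicit Types F G K : C -> C.

(** The boundary integral, counterclockwise when a <= b and c <= d; the corners may come in any
    order, with the corresponding sign. *)
Definition rint (F : C -> C) (a b c d : R) : C :=
  cint (fun x => F (x +i* c)) a b + 'i * cint (fun y => F (b +i* y)) c d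
  - cint (fun x => F (x +i* d)) a b - 'i * cint (fun y => F (a +i* y)) c d.

Lemma rint_addl F a m b c d : rint F a m c d + rint F m b c d = rint F a b c d.
Proof. by rewrite /rint -(cintD _ a m b) -(cintD (fun x => F (x +i* d)) a m b); ring. Qed.

Lemma rint_addr F a b c m d : rint F a b c m + rint F a b m d = rint F a b c d.
Proof.
by rewrite /rint -(cintD (fun y => F (b +i* y)) c m d) -(cintD (fun y => F (a +i* y)) c m d); ring.
Qed.

Lemma ccont_hor F : (forall z, ccont F z) -> forall c, rcont (fun x => F (x +i* c)).
Proof.
move=> H c t e e0; have [d d0 D] := H (t +i* c) e e0; exists d => // s st.
apply: D; rewrite (_ : _ - _ = (s - t)%:C) ?cmodR //.
by apply: complex_eqP => /=; rewrite ?subrr.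
Qed.

Lemma ccont_ver F : (forall z, ccont F z) -> forall a, rcont (fun y => F (a +i* y)).
Proof.
move=> H a t e e0; have [d d0 D] := H (a +i* t) e e0; exists d => // s st.
apply: D; rewrite (_ : _ - _ = 'i * (s - t)%:C) ?cmodM ?cmodR ?cmod_i ?mul1r //.
by apply: complex_eqP; rewrite !ReImE; ring.
Qed.

Lemma rint_bound F M a b c d : (forall z, ccont F z) ->
  (forall x y, Num.min a b <= x <= Num.max a b -> Num.min c d <= y <= Num.max c d ->
    cmod (F (x +i* y)) <= M) ->
  cmod (rint F a b c d) <= M * (2 * (`|b - a| + `|d - c|)).
Proof.
move=> Fc H.
have cc : Num.min c d <= c <= Num.max c d by rewrite ge_min le_max lexx.
have dd : Num.min c d <= d <= Num.max c d by rewrite ge_min le_max lexx !orbT.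
have aa : Num.min a b <= a <= Num.max a b by rewrite ge_min le_max lexx.
have bb : Num.min a b <= b <= Num.max a b by rewrite ge_min le_max lexx !orbT.
have h1 := cint_bound (ccont_hor Fc c) (fun t ht => H t c ht cc).
have h2 := cint_bound (ccont_hor Fc d) (fun t ht => H t d ht dd).
have h3 := cint_bound (ccont_ver Fc a) (fun t ht => H a t aa ht).
have h4 := cint_bound (ccont_ver Fc b) (fun t ht => H b t bb ht).
rewrite /rint; apply: (le_trans (cmodB _ _)); rewrite [cmod ('i * _)]cmodM cmod_i mul1r.
apply: (le_trans (lerD (cmodB _ _) (lexx _))).
apply: (le_trans (lerD (lerD (cmodD _ _) (lexx _)) (lexx _))).
rewrite [cmod ('i * _)]cmodM cmod_i mul1r; lra.
Qed.

Lemma rint_lin F G k a b c d : (forall z, ccont F z) -> (forall z, ccont G z) ->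
  rint (fun z => k * F z + G z) a b c d = k * rint F a b c d + rint G a b c d.
Proof.
move=> Fc Gc; rewrite /rint !cint_lin; try exact: ccont_hor; try exact: ccont_ver.
by ring.
Qed.

Lemma cdiff_hor F x c l : cdiff F (x +i* c) l -> rder (fun x => F (x +i* c)) x l.
Proof.
move=> H; have := @rder_line R F (0 +i* c) 1 x l.
have E s : 0 +i* c + s%:C * 1 = s +i* c.
  by rewrite mulr1; apply: complex_eqP => /=; rewrite ?add0r ?addr0.
rewrite E mulr1 => /(_ H); apply: gder_ext => s; by rewrite E.
Qed.

Lemma cdiff_ver F a y l : cdiff F (a +i* y) l -> rder (fun y => F (a +i* y)) y (l * 'i).
Proof.
move=> H; have := @rder_line R F (a +i* 0) 'i y l.
have E s : a +i* 0 + s%:C * 'i = a +i* s.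
  by apply: complex_eqP; rewrite !ReImE; ring.
rewrite E => /(_ H); apply: gder_ext => s; by rewrite E.
Qed.

Lemma rint_prim K F a b c d : (forall z, cdiff K z (F z)) -> rint F a b c d = 0.
Proof.
move=> H; rewrite /rint.
rewrite (@cint_eq _ (fun x => K (x +i* c)) (fun x => F (x +i* c))); last by move=> t; exact: cdiff_hor.
rewrite (@cint_eq _ (fun x => K (x +i* d)) (fun x => F (x +i* d))); last by move=> t; exact: cdiff_hor.
have i2 : - ('i * 'i) = 1 :> C by rewrite -expr2 sqr_i opprK.
rewrite (@cint_eq _ (fun y => - 'i * K (b +i* y)) (fun y => F (b +i* y))); last first.
  move=> t; have := gder_lin (- 'i) (cdiff_ver (H (b +i* t))).
  by apply: gder_eq; rewrite mulrCA mulNr i2 mulr1.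
rewrite (@cint_eq _ (fun y => - 'i * K (a +i* y)) (fun y => F (a +i* y))); last first.
  move=> t; have := gder_lin (- 'i) (cdiff_ver (H (a +i* t))).
  by apply: gder_eq; rewrite mulrCA mulNr i2 mulr1.
rewrite -!mulrBr !mulrA mulrN i2 !mul1r; ring.
Qed.

(** The segment from a to a + p with p of either sign, so that a rectangle can be described from any
    of its corners. *)
Definition between (a p x : R) := exists2 s : R, 0 <= s <= 1 & x = a + s * p.

Lemma between_ge a p x : Num.min a (a + p) <= x <= Num.max a (a + p) -> between a p x.
Proof.
rewrite ge_min le_max => /andP[h1 h2].
have [p0|p0] := eqVneq p 0.
  exists 0; rewrite ?lexx ?ler01 //; subst p; move: h1 h2; rewrite addr0 !orbb => h1 h2.
  by rewrite mulr0 addr0; apply/eqP; rewrite eq_le h1 h2.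
exists ((x - a) / p); last by field.
have [pp|pn] := ltP 0 p.
  rewrite ler_pdivlMr // ler_pdivrMr // mul0r mul1r.
  case/orP: h1 => h1; case/orP: h2 => h2; lra.
have pn' : p < 0 by rewrite lt_def eq_sym p0.
rewrite ler_ndivlMr // ler_ndivrMr // mul0r mul1r.
case/orP: h1 => h1; case/orP: h2 => h2; lra.
Qed.

(** If P failed, a quarter would fail at every stage, and the nested quarters shrink to a point
    where the local hypothesis applies. This serves Goursat's lemma and the boundedness of
    continuous functions on discs. *)
Lemma bisection (P : R -> R -> R -> R -> Prop) (a p c q : R) :
  (forall a p c q, P a (p / 2) c (q / 2) -> P (a + p / 2) (p / 2) c (q / 2) ->
     P a (p / 2) (c + q / 2) (q / 2) -> P (a + p / 2) (p / 2) (c + q / 2) (q / 2) ->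
     P a p c q) ->
  (forall x y, between a p x -> between c q y -> exists2 d : R, 0 < d &
     forall a p c q, `|p| + `|q| < d -> between a p x -> between c q y -> P a p c q) ->
  P a p c q.
Proof.
move=> Hsplit Hloc; apply: contrapT => nP.
(* Failure on a quarter of generation [n]. Its corner is kept as a fraction [u] of the sides, so
   that sides of length zero or negative length need no separate treatment. *)
pose Q (n : nat) (u : R * R) :=
  ~ P (a + u.1 * p) (p / 2 ^+ n) (c + u.2 * q) (q / 2 ^+ n).
pose ok (n : nat) (s s' : R) := s <= s' /\ s' + (2 ^+ n.+1)^-1 <= s + (2 ^+ n)^-1.
have p2 n : (2 ^+ n.+1)^-1 = (2 ^+ n)^-1 / 2 :> R by rewrite exprS invfM mulrC.
have pp n : 0 < (2 ^+ n)^-1 :> R by rewrite invr_gt0 exprn_gt0.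
(* The premise [Q] stands under the existential so that [choice] gives a total selection
   function. *)
have step (nu : nat * (R * R)) : exists v, Q nu.1 nu.2 ->
    [/\ Q nu.1.+1 v, ok nu.1 nu.2.1 v.1 & ok nu.1 nu.2.2 v.2].
  case: nu => n [s t] /=.
  have [q0|] := pselect (Q n (s, t)); last by exists (0, 0).
  have ok1 x : ok n x x by split => //; have := pp n; rewrite p2; lra.
  have ok2 x : ok n x (x + (2 ^+ n.+1)^-1).
    by split; have := pp n; rewrite p2; lra.
  apply: contrapT => /forallNP H; apply: q0.
  have E (x y : R) : x / 2 ^+ n / 2 = x / 2 ^+ n.+1 /\ y + x / 2 ^+ n / 2 = y + x / 2 ^+ n.+1.
    by split; rewrite exprS invfM; ring.
  have E2 (x y z : R) : x + (y + (2 ^+ n.+1)^-1) * z = x + y * z + z / 2 ^+ n.+1 by ring.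
  apply: Hsplit; rewrite ?(E _ 0).1 ?(E _ _).2; apply: contrapT => NP.
  - by apply: (H (s, t)) => _; split.
  - by apply: (H (s + (2 ^+ n.+1)^-1, t)) => _; split; rewrite // /Q /= E2.
  - by apply: (H (s, t + (2 ^+ n.+1)^-1)) => _; split; rewrite // /Q /= E2.
  - by apply: (H (s + (2 ^+ n.+1)^-1, t + (2 ^+ n.+1)^-1)) => _; split; rewrite // /Q /= !E2.
have [f Hf] := choice step.
pose u := fix u n : R * R := if n is m.+1 then f (m, u m) else (0, 0).
have Qu n : Q n (u n).
  elim: n => [|n ih]; last by have [] := Hf (n, u n) ih.
  by rewrite /Q /= !mul0r !addr0 expr0 !divr1.
have lim (w : nat -> R) : w 0%N = 0 -> (forall n, ok n (w n) (w n.+1)) ->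
    exists x : R, forall n, w n <= x <= w n + (2 ^+ n)^-1.
  move=> w0 Hw.
  have mono n m : (n <= m)%N -> w n <= w m /\ w m + (2 ^+ m)^-1 <= w n + (2 ^+ n)^-1.
    elim: m => [|m ih]; first by rewrite leqn0 => /eqP ->; split.
    rewrite leq_eqVlt => /orP[/eqP -> //|]; rewrite ltnS => /ih[h1 h2].
    have [h3 h4] := Hw m; split; lra.
  have ub n : ubound (range w) (w n + (2 ^+ n)^-1).
    move=> _ [m _ <-]; case: (leqP m n) => [/mono[h _]|/ltnW/mono[_ h]].
      by have := pp n; lra.
    by have := pp m; lra.
  have hs : has_sup (range w) by split; [exists (w 0%N), 0%N|exists (w 0%N + (2 ^+ 0)^-1)].
  exists (sup (range w)) => n; apply/andP; split.
    by apply: ub_le_sup; [exact: hs.2|exists n].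
  by apply: ge_sup; [exact: hs.1|exact: ub].
have [s Hs] := lim (fun n => (u n).1) erefl (fun n => let: And3 _ h _ := Hf (n, u n) (Qu n) in h).
have [t Ht] := lim (fun n => (u n).2) erefl (fun n => let: And3 _ _ h := Hf (n, u n) (Qu n) in h).
have btw (b r x : R) (w : R) n : w <= x <= w + (2 ^+ n)^-1 ->
    between (b + w * r) (r / 2 ^+ n) (b + x * r).
  move=> /andP[h1 h2]; exists ((x - w) * 2 ^+ n).
    rewrite mulr_ge0 ?subr_ge0 ?exprn_ge0 //=.
    by rewrite -ler_pdivlMr ?exprn_gt0 // mul1r lerBlDl.
  have : 2 ^+ n != 0 :> R by rewrite expf_neq0.
  by move=> ?; field.
have b0 (b r x : R) w : w 0%N = 0 -> (forall n, w n <= x <= w n + (2 ^+ n)^-1) ->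
    between b r (b + x * r).
  move=> w0 /(_ 0%N) /(btw b r); by rewrite w0 mul0r addr0 expr0 divr1.
have [d d0 D] := Hloc _ _ (b0 a p s (fun n => (u n).1) erefl Hs) (b0 c q t (fun n => (u n).2) erefl Ht).
have [n hn] : exists n : nat, `|p| + `|q| < d * 2 ^+ n.
  pose x := (`|p| + `|q|) / d; have x0 : 0 <= x by rewrite divr_ge0 ?addr_ge0 // ltW.
  have /andP[_ hx] := truncn_itv x0; exists (Num.truncn x).+1.
  rewrite mulrC -ltr_pdivrMr // (lt_trans hx) // -natrX ltr_nat.
  exact: ltn_expl.
apply: (Qu n); apply: D; [|exact: btw|exact: btw].
have p0 : 0 <= 2 ^+ n :> R by rewrite exprn_ge0.
by rewrite !normrM !normfV !(ger0_norm p0) -mulrDl ltr_pdivrMr ?exprn_gt0.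
Qed.

Lemma cdiff_affine (al be : C) z : cdiff (fun w => al + be * w) z be.
Proof.
have := gderD (@gder_cst _ _ id al z) (gder_lin be (@cdiff_id R z)).
by rewrite add0r mulr1.
Qed.

(** A bound by e times the square of the side sum is inherited from the quarters, whose sides are
    halved. Near a point of differentiability the affine part has a primitive and integrates to 0,
    while the remainder is small relative to the size. Differentiability is asked on the rectangle
    only, which leaves room for an exceptional point elsewhere. *)
Lemma goursat F a p c q : (forall z, ccont F z) ->
  (forall x y, between a p x -> between c q y -> exists l, cdiff F (x +i* y) l) ->
  rint F a (a + p) c (c + q) = 0.
Proof.
move=> Fc Fd; apply: Normc.eq0_normc; apply/eqP; rewrite eq_le cmod_ge0 andbT.
apply/ler_addgt0Pr => e0 e00; rewrite add0r.
pose S := (`|p| + `|q|) ^+ 2 + 1.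
have S0 : 0 < S by rewrite ltr_wpDl // sqr_ge0.
pose e := e0 / S; have ep : 0 < e by rewrite divr_gt0.
suff h : cmod (rint F a (a + p) c (c + q)) <= e * (`|p| + `|q|) ^+ 2.
  apply: (le_trans h); rewrite /e mulrAC ler_pdivrMr // ler_wpM2l ?(ltW e00) //.
  by rewrite /S lerDl.
apply: (@bisection (fun a p c q =>
  cmod (rint F a (a + p) c (c + q)) <= e * (`|p| + `|q|) ^+ 2)).
  move=> a' p' c' q' h1 h2 h3 h4.
  have hp (x y : R) : x + y = x + y / 2 + y / 2 by field.
  rewrite -(rint_addl F a' (a' + p' / 2)) -(rint_addr F a' _ c' (c' + q' / 2)).
  rewrite -(rint_addr F _ (a' + p') c' (c' + q' / 2)).
  rewrite [in a' + p'](hp a' p') [in c' + q'](hp c' q').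
  have -> : (`|p'| + `|q'|) ^+ 2 = 4 * (`|p' / 2| + `|q' / 2|) ^+ 2.
    have n2 : `|2^-1| = 2^-1 :> R by rewrite ger0_norm // invr_ge0.
    by rewrite !normrM n2; field.
  apply: (le_trans (cmodD _ _)).
  apply: (le_trans (lerD (cmodD _ _) (cmodD _ _))); lra.
move=> x y hx hy; have [l Fl] := Fd _ _ hx hy.
(* Half of [e], because the perimeter is twice the sum of the sides. *)
have e8 : 0 < e / 2 by lra.
have [d d0 D] := Fl _ e8; exists d => // a' p' c' q' pqd hx' hy'.
have -> : rint F a' (a' + p') c' (c' + q') =
   rint (fun z => F z - F (x +i* y) - l * (z - (x +i* y))) a' (a' + p') c' (c' + q').
  pose A z := - F (x +i* y) + l * (x +i* y) + (- l) * z.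
  have -> : (fun z => F z - F (x +i* y) - l * (z - (x +i* y))) =
     (fun z => 1 * F z + A z) by apply/funext => z; rewrite /A; ring.
  rewrite rint_lin //; last by move=> z; apply: cdiff_cont (cdiff_affine _ _ _).
  rewrite mul1r (_ : rint A _ _ _ _ = 0) ?addr0 //.
  pose be := - F (x +i* y) + l * (x +i* y).
  apply: (@rint_prim (fun z => be * z + (- l / 2) * z ^+ 2)) => z.
  have := gderD (gder_lin be (@cdiff_id R z)) (gder_lin (- l / 2) (@cdiff_sqr R z)).
  by apply: gder_eq; rewrite /A /be; field.
have cF : forall z, ccont (fun z => F z - F (x +i* y) - l * (z - (x +i* y))) z.
  move=> z; pose be := - F (x +i* y) + l * (x +i* y).
  have h1 := cdiff_cont (cdiff_affine be (- l) z).
  move=> e1 e10; have e12 : 0 < e1 / 2 by lra.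
  have [d1 d10 D1] := Fc z _ e12; have [d2 d20 D2] := h1 _ e12.
  exists (Num.min d1 d2); first by rewrite lt_min d10.
  move=> w; rewrite lt_min => /andP[/D1 k1 /D2 k2].
  rewrite (_ : _ - _ = (F w - F z) + (be + - l * w - (be + - l * z))); last first.
    by rewrite /be; ring.
  apply: (le_trans (cmodD _ _)); lra.
have := @rint_bound _ (e / 2 * (`|p'| + `|q'|)) a' (a' + p') c' (c' + q') cF.
rewrite ![_ + _ - _]addrC !addKr.
rewrite (_ : e * (`|p'| + `|q'|) ^+ 2 = e / 2 * (`|p'| + `|q'|) * (2 * (`|p'| + `|q'|))); last by field.
apply => x' y' /between_ge hx1 /between_ge hy1.
have [[s /andP[s0 s1] xE] [s' /andP[s0' s1'] x'E]] := (hx', hx1).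
have [[t /andP[t0 t1] yE] [t' /andP[t0' t1'] y'E]] := (hy', hy1).
have dist : cmod ((x' +i* y') - (x +i* y)) <= `|p'| + `|q'|.
  apply: (le_trans (cmod_leD _)); rewrite !ReImE.
  rewrite (_ : x' - x = (s' - s) * p'); last by rewrite x'E xE; ring.
  rewrite (_ : y' - y = (t' - t) * q'); last by rewrite y'E yE; ring.
  rewrite !normrM; apply: lerD; apply: ler_piMl => //; rewrite ler_norml; lra.
have := D ((x' +i* y') - (x +i* y)) (le_lt_trans dist pqd).
rewrite [x +i* y + _]addrC subrK => h; apply: (le_trans h).
by rewrite ler_pM2l.
Qed.

End Rectangles.

(** * Exceptional points and Morera's theorem *)

Section Morera.
Variable R : realType.
Local Notation C := R[i].
Implicit Types F G K : C -> C.

Lemma rint_xx F a c d : rint F a a c d = 0.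
Proof. by rewrite /rint /cint; ring. Qed.

Lemma rint_yy F a b c : rint F a b c c = 0.
Proof. by rewrite /rint /cint; ring. Qed.

Lemma goursat_off F a p c q x0 y0 : (forall z, ccont F z) ->
  (forall z, z != x0 +i* y0 -> exists l, cdiff F z l) ->
  (forall x y, between a p x -> between c q y -> x <> x0 \/ y <> y0) ->
  rint F a (a + p) c (c + q) = 0.
Proof.
move=> Fc Fd off; apply: goursat => // x y hx hy; apply: Fd.
by rewrite eq_complex /= negb_and; case: (off _ _ hx hy) => /eqP ->; rewrite ?orbT.
Qed.

(** Cutting off two rectangles that avoid the corner leaves a copy scaled by [th]. There F is
    bounded, and the perimeter is as small as desired. *)
Lemma goursat_corner F p q x0 y0 : (forall z, ccont F z) ->
  (forall z, z != x0 +i* y0 -> exists l, cdiff F z l) ->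
  rint F x0 (x0 + p) y0 (y0 + q) = 0.
Proof.
move=> Fc Fd; have [->|p0] := eqVneq p 0; first by rewrite addr0 rint_xx.
have [->|q0] := eqVneq q 0; first by rewrite addr0 rint_yy.
apply: Normc.eq0_normc; apply/eqP; rewrite eq_le cmod_ge0 andbT.
apply/ler_addgt0Pr => e e0; rewrite add0r.
have [d d0 D] := Fc (x0 +i* y0) 1 ltr01.
pose M := cmod (F (x0 +i* y0)) + 1; have M0 : 0 < M by rewrite ltr_wpDl.
pose S : R := `|p| + `|q|; have S0 : 0 < S by rewrite ltr_wpDl // normr_gt0.
pose th := Num.min (1 / 2) (Num.min (d / 2 / S) (e / 2 / S / M)).
have th0 : 0 < th by rewrite !lt_min !divr_gt0.
have th1 : th <= 1 / 2 by rewrite ge_min lexx.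
have thd : th * S < d.
  rewrite -ltr_pdivlMr //; apply: (@le_lt_trans _ _ (d / 2 / S)).
    by rewrite !ge_min lexx orbT.
  by rewrite ltr_pM2r ?invr_gt0 //; lra.
have the : 2 * (th * S * M) <= e.
  have : th <= e / 2 / S / M by rewrite !ge_min lexx !orbT.
  rewrite !ler_pdivlMr //; lra.
have np (s r : R) : 0 <= s <= 1 -> r != 0 -> th * r + s * (r - th * r) <> 0.
  move=> /andP[s0 s1] r0; rewrite (_ : _ + _ = (th + s * (1 - th)) * r); last by ring.
  apply/eqP; rewrite mulf_neq0 // gt_eqF // ltr_pwDl // mulr_ge0 //; lra.
have split_ (x r : R) : x + r = x + th * r + (r - th * r) by ring.
have -> : rint F x0 (x0 + p) y0 (y0 + q) = rint F x0 (x0 + th * p) y0 (y0 + th * q).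
  rewrite -(rint_addl F x0 (x0 + th * p)) -(rint_addr F x0 (x0 + th * p) y0 (y0 + th * q)).
  have -> : rint F x0 (x0 + th * p) (y0 + th * q) (y0 + q) = 0.
    rewrite (split_ y0 q); apply: (goursat_off Fc Fd) => x y _ [s s01 ->]; right => h.
    by apply: (np s q s01 q0); apply: (addrI y0); rewrite addr0 addrA.
  have -> : rint F (x0 + th * p) (x0 + p) y0 (y0 + q) = 0.
    rewrite (split_ x0 p); apply: (goursat_off Fc Fd) => x y [s s01 ->] _; left => h.
    by apply: (np s p s01 p0); apply: (addrI x0); rewrite addr0 addrA.
  by rewrite !addr0.
have := @rint_bound R F M x0 (x0 + th * p) y0 (y0 + th * q) Fc.
rewrite ![_ + th * _ - _]addrC !addKr !normrM -mulrDr !(gtr0_norm th0) -/S => H.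
apply: (le_trans (H _)); last by rewrite mulrC -mulrA.
move=> x y /between_ge[s /andP[s0 s1] ->] /between_ge[t /andP[t0 t1] ->].
rewrite -[F _](subrK (F (x0 +i* y0))) (le_trans (cmodD _ _)) //.
rewrite /M addrC lerD2l; apply: D; apply: le_lt_trans thd.
apply: (le_trans (cmod_leD _)); rewrite !ReImE ![_ + _ - _]addrC !addKr !normrM.
rewrite !(gtr0_norm th0) (ger0_norm s0) (ger0_norm t0) /S mulrDr.
by apply: lerD; rewrite ler_piMl // mulr_ge0 // ltW.
Qed.

(** Every rectangle is a signed combination of four rectangles with a corner at z0. *)
Lemma goursat_except F z0 a b c d : (forall z, ccont F z) ->
  (forall z, z != z0 -> exists l, cdiff F z l) -> rint F a b c d = 0.
Proof.
case: z0 => x0 y0 Fc Fd.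
have H p q : rint F x0 p y0 q = 0.
  have := @goursat_corner F (p - x0) (q - y0) x0 y0 Fc Fd.
  by rewrite [x0 + _]addrC [y0 + _]addrC !subrK.
have H2 p q r : rint F p q y0 r = 0.
  by have := rint_addl F x0 p q y0 r; rewrite !H add0r.
by have := rint_addr F a b y0 c d; rewrite !H2 add0r.
Qed.

Lemma cint_cst k a b : cint (fun=> k) a b = k * (b - a)%:C :> C.
Proof.
rewrite (@cint_eq _ (fun t => k * t%:C)); first by rewrite -mulrBr rmorphB.
by move=> t; have := gder_lin k (@rder_id R t); rewrite mulr1.
Qed.

Lemma morera F : (forall z, ccont F z) -> (forall a b c d, rint F a b c d = 0) ->
  exists K : C -> C, forall z, cdiff K z (F z).
Proof.
move=> Fc F0.
exists (fun z => cint (fun x => F (x +i* 0)) 0 (complex.Re z) +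
         'i * cint (fun y => F (complex.Re z +i* y)) 0 (complex.Im z)).
case=> x y e e0; have e4 : 0 < e / 2 by lra.
have [d d0 D] := Fc (x +i* y) _ e4; exists d => // -[w1 w2] wd /=.
set z := x +i* y in D *; rewrite -[Num.sqrt _]/(cmod (w1 +i* w2)).
have b1 : `|w1| <= cmod (w1 +i* w2) := normRe_le (w1 +i* w2).
have b2 : `|w2| <= cmod (w1 +i* w2) := normIm_le (w1 +i* w2).
pose A := cint (fun s => F (s +i* y)) x (x + w1).
pose B := cint (fun t => F ((x + w1) +i* t)) y (y + w2).
have E : cint (fun x => F (x +i* 0)) 0 (x + w1) +
     'i * cint (fun y => F ((x + w1) +i* y)) 0 (y + w2) -
     (cint (fun x => F (x +i* 0)) 0 x + 'i * cint (fun y => F (x +i* y)) 0 y)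
     = A + 'i * B.
  (* The primitive integrates along the real axis and then vertically. The rectangle between heights
     0 and y moves the increment of the horizontal part up to z, so only two short sides at z
     remain. *)
  have := F0 x (x + w1) 0 y; rewrite /rint -/A => h.
  rewrite -(cintD _ 0 x (x + w1)) -(cintD (fun t => F ((x + w1) +i* t)) 0 y).
  rewrite -[A]addr0 -h -/B; ring.
rewrite E.
have -> : A + 'i * B - F z * (w1 +i* w2) =
    cint (fun s => F (s +i* y) - F z) x (x + w1)
    + 'i * cint (fun t => F ((x + w1) +i* t) - F z) y (y + w2).
  have R1 g u v : rcont g -> cint (fun s => g s - F z) u v = cint g u v - F z * (v - u)%:C.
    move=> gc; have kc k : rcont (fun=> k : C) by move=> t e' e'0; exists 1 => // s _; rewrite subrr cmod0 ltW.
    have := @cint_lin _ (-1) (fun=> F z) g u v (kc _) gc.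
    rewrite cint_cst => h; transitivity (- 1 * (F z * (v - u)%:C) + cint g u v); last by ring.
    by rewrite -h; congr cint; apply/funext => s; ring.
  rewrite !R1 -/A -/B; [|exact: ccont_ver|exact: ccont_hor].
  rewrite (_ : x + w1 - x = w1); last by ring.
  rewrite (_ : y + w2 - y = w2); last by ring.
  rewrite (_ : w1 +i* w2 = w1%:C + 'i * w2%:C); first by ring.
  by apply: complex_eqP; rewrite !ReImE; ring.
have cB g : rcont g -> rcont (fun s => g s - F z).
  move=> gc t e' e'0; have [d' d'0 D'] := gc t e' e'0; exists d' => // s /D'.
  by rewrite opprB addrA subrK.
apply: (le_trans (cmodD _ _)); rewrite cmodM cmod_i mul1r.
have bt (u v t : R) : Num.min u (u + v) <= t <= Num.max u (u + v) -> `|t - u| <= `|v|.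
  move=> /between_ge[s /andP[s0 s1] ->]; rewrite addrC addKr normrM ler_piMl //.
  by rewrite ger0_norm.
rewrite (_ : e * cmod _ = e / 2 * cmod (w1 +i* w2) + e / 2 * cmod (w1 +i* w2)); last by field.
apply: lerD.
  have := @cint_bound R (fun s => F (s +i* y) - F z) (e / 2) x (x + w1).
  rewrite [x + _ - x]addrC addKr => H; apply: (le_trans (H _ _)).
  - exact: (cB _ (ccont_hor Fc y)).
  - move=> t /bt h; apply: D; rewrite (_ : _ - z = (t - x)%:C); last first.
      by apply: complex_eqP; rewrite !ReImE; ring.
    rewrite cmodR; apply: le_lt_trans wd; exact: le_trans b1.
  - by rewrite ler_wpM2l ?(ltW e4).
have := @cint_bound R (fun s => F ((x + w1) +i* s) - F z) (e / 2) y (y + w2).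
rewrite [y + _ - y]addrC addKr => H; apply: (le_trans (H _ _)).
- exact: (cB _ (ccont_ver Fc _)).
- move=> t /bt h; apply: D; rewrite (_ : _ - z = w1 +i* (t - y)); last first.
    by rewrite /z; apply: complex_eqP; rewrite !ReImE; [rewrite -[LHS]/(x + w1 - x)|]; ring.
  apply: le_lt_trans wd; rewrite -(@ler_pXn2r _ 2) ?nnegrE ?cmod_ge0 // !cmod_sqr /=.
  by rewrite lerD2l -[leLHS]real_normK ?num_real // -[leRHS]real_normK ?num_real // ler_pXn2r ?nnegrE.
- by rewrite ler_wpM2l ?(ltW e4).
Qed.

Lemma entire_primitive F : entire F -> exists2 K : C -> C, entire K & forall z, cdiff K z (F z).
Proof.
move=> /entireP F_; have Fc z : ccont F z by have [l /cdiff_cont] := F_ z.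
have [||K HK] := @morera F => //.
  by move=> a b c d; apply: (@goursat_except F 0).
by exists K => //; apply/entireP => z; exists (F z).
Qed.

End Morera.

(** * The exponential, mean values and Cauchy estimates *)

Section Cexp.
Variable R : realType.
Local Notation C := R[i].
Implicit Types z w : C.

Definition cexp z : C :=
  (expR (complex.Re z) * cos (complex.Im z)) +i*
  (expR (complex.Re z) * sin (complex.Im z)).

Lemma cexpD z w : cexp (z + w) = cexp z * cexp w.
Proof.
rewrite /cexp cReD cImD expRD cosD sinD.
by apply: complex_eqP; rewrite !ReImE; ring.
Qed.

Lemma cexp0 : cexp 0 = 1.
Proof. by rewrite /cexp /= expR0 cos0 sin0 mulr0 mulr1. Qed.

Lemma cmod_cexp z : cmod (cexp z) = expR (complex.Re z).
Proof.
apply/eqP; rewrite -(@eqrXn2 _ 2) ?cmod_ge0 ?expR_ge0 // cmod_sqr /cexp !ReImE.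
by rewrite !exprMn -mulrDr cos2Dsin2 mulr1.
Qed.

Lemma cexp_neq0 z : cexp z != 0.
Proof. by rewrite -cmod_gt0 cmod_cexp expR_gt0. Qed.

Lemma cexpN z : cexp (- z) = (cexp z)^-1.
Proof.
apply: (mulfI (cexp_neq0 z)); rewrite -cexpD subrr cexp0 divff //; exact: cexp_neq0.
Qed.

Lemma cexp_real (x : R) : cexp x%:C = (expR x)%:C.
Proof.
by apply: complex_eqP; rewrite /cexp !ReImE ?cos0 ?sin0 ?mulr1 ?mulr0.
Qed.

(** Differentiability at 0, from the real derivatives of [expR], [cos] and [sin] there; the addition
    formula carries it to every point. *)
Lemma cexp_small (e : R) : 0 < e -> exists2 d : R, 0 < d &
  forall w, cmod w < d -> cmod (cexp w - 1 - w) <= e * cmod w.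
Proof.
move=> e0; pose e1 : R := e / 16.
have e10 : 0 < e1 by rewrite divr_gt0.
have [d1 d10 D1] := (is_derive_epsP _ _ _).1 (is_derive_expR (0 : R)) _ e10.
have [d2 d20 D2] := (is_derive_epsP _ _ _).1 (is_derive_cos (0 : R)) _ e10.
have [d3 d30 D3] := (is_derive_epsP _ _ _).1 (is_derive_sin (0 : R)) _ e10.
exists (Num.min (Num.min d1 d2) (Num.min d3 (Num.min 1 (e / 4)))).
  by rewrite !lt_min d10 d20 d30 ltr01 divr_gt0.
case=> a b; rewrite !lt_min => /andP[/andP[w1 w2] /and3P[w3 w4 w5]].
set w := a +i* b in w1 w2 w3 w4 w5 *.
have ha : `|a| <= cmod w := normRe_le w.
have hb : `|b| <= cmod w := normIm_le w.
have {D1} := D1 a (le_lt_trans ha w1); rewrite add0r expR0 mul1r => h1.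
have {D2} := D2 b (le_lt_trans hb w2).
rewrite add0r cos0 sin0 oppr0 mul0r subr0 => h2.
have {D3} := D3 b (le_lt_trans hb w3); rewrite add0r sin0 subr0 cos0 mul1r => h3.
(* e^w - 1 - w = (e^a - 1 - a) e^(ib) + (1 + a) (e^(ib) - 1 - ib) + iab. The three terms cost 1, 4
   and 4 sixteenths of [e]. *)
have -> : cexp w - 1 - w = (expR a - 1 - a)%:C * cexp (0 +i* b)
   + (1 + a%:C) * ((cos b - 1) +i* (sin b - b)) + a%:C * ('i * b%:C).
  have r1 : complex.Re (1 : C) = 1 by [].
  have i1 : complex.Im (1 : C) = 0 by [].
  by apply: complex_eqP; rewrite /cexp /w !ReImE ?expR0 ?r1 ?i1; ring.
have k1 : cmod (cexp (0 +i* b)) = 1 by rewrite cmod_cexp ReImE expR0.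
have a1 : cmod (1 + a%:C) <= 2.
  by apply: (le_trans (cmodD _ _)); rewrite cmod1 cmodR; lra.
have k2 : cmod ((cos b - 1) +i* (sin b - b)) <= 2 * (e1 * cmod w).
  apply: (le_trans (cmod_leD _)); rewrite !ReImE.
  have : e1 * `|b| <= e1 * cmod w by rewrite ler_pM2l.
  lra.
have h1' : `|expR a - 1 - a| <= e1 * cmod w.
  by apply: (le_trans h1); rewrite ler_pM2l.
apply: (le_trans (cmodD _ _)); apply: (le_trans (lerD (cmodD _ _) (lexx _))).
rewrite !cmodM k1 mulr1 !cmodR cmod_i mul1r.
have k3 : cmod (1 + a%:C) * cmod ((cos b - 1) +i* (sin b - b)) <= 2 * (2 * (e1 * cmod w)).
  by apply: ler_pM => //; exact: cmod_ge0.
have k4 : `|a| * `|b| <= cmod w * (e / 4).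
  by apply: ler_pM => //; apply: (le_trans hb); exact: ltW.
apply: (le_trans (lerD (lerD h1' k3) k4)).
rewrite (_ : _ + _ + _ = 9 / 16 * (e * cmod w)); last by rewrite /e1; field.
by rewrite ler_piMl ?mulr_ge0 ?cmod_ge0 ?(ltW e0) //; lra.
Qed.

Lemma cdiff_cexp z : cdiff cexp z (cexp z).
Proof.
move=> e e0; have Z0 : 0 < expR (complex.Re z) by exact: expR_gt0.
have [d d0 D] := cexp_small (divr_gt0 e0 Z0); exists d => // w /D h.
rewrite cexpD (_ : _ - _ - _ = cexp z * (cexp w - 1 - w)); last by rewrite /=; ring.
rewrite cmodM cmod_cexp mulrC; apply: (le_trans (ler_wpM2r _ h)); first exact: ltW.
by rewrite mulrAC divfK // gt_eqF.
Qed.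

Lemma entire_cexp : entire cexp.
Proof. by apply/entireP => z; exists (cexp z); exact: cdiff_cexp. Qed.

Lemma cexp_periodic z : cexp (z + 'i * (2 * pi)%:C) = cexp z.
Proof.
rewrite /cexp cReD cImD !cReM !cImM !cRe_i !cIm_i !cReC !cImC mul0r !mulr0 subrr addr0 mul1r add0r.
by rewrite mulr_natl cosD2pi sinD2pi.
Qed.

End Cexp.

Section Circle.
Variable R : realType.
Local Notation C := R[i].
Implicit Types f g h : C -> C.

Definition cis (y : R) : C := cexp ('i * y%:C).

Lemma cmod_cis y : cmod (cis y) = 1.
Proof. by rewrite cmod_cexp !ReImE mul0r mulr0 subrr expR0. Qed.

Lemma entire_cont f : entire f -> forall z, ccont f z.
Proof. by move=> /entireP F z; have [l /cdiff_cont] := F z. Qed.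

Lemma entire_rint f a b c d : entire f -> rint f a b c d = 0.
Proof.
by move=> /[dup]/entire_cont fc /entireP F; apply: (@goursat_except _ f 0).
Qed.

(** In the coordinate z0 + e^z a circle is a vertical segment of length 2 pi. Periodicity cancels
    the horizontal sides of the rectangle, so circles of all radii give the same integral. *)
Lemma circle_cst g A B : entire g ->
  (forall z, g (z + 'i * (2 * pi)%:C) = g z) ->
  cint (fun y => g (A +i* y)) 0 (2 * pi) = cint (fun y => g (B +i* y)) 0 (2 * pi).
Proof.
move=> gE gp; have := entire_rint A B 0 (2 * pi) gE; rewrite /rint.
have -> : (fun x => g (x +i* (2 * pi))) = (fun x => g (x +i* 0)).
  apply/funext => x; rewrite -(gp (x +i* 0)); congr g.
  by apply: complex_eqP; rewrite !ReImE; ring.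
set X := cint _ A B; set P := cint _ 0 _; set Q := cint _ 0 _.
rewrite (_ : _ - _ - _ = 'i * (P - Q)); last by ring.
move=> /eqP; rewrite mulf_eq0 => /orP[|].
  by rewrite -cmod_eq0 cmod_i oner_eq0.
by rewrite subr_eq0 => /eqP.
Qed.

(** Applied with [B] tending to -oo, that is with circles shrinking to their centre. *)
Lemma circle_vanish h A : entire h ->
  (forall z, h (z + 'i * (2 * pi)%:C) = h z) ->
  (forall e : R, 0 < e -> exists B, forall y, cmod (h (B +i* y)) <= e) ->
  cint (fun y => h (A +i* y)) 0 (2 * pi) = 0.
Proof.
move=> hE hp hv; apply: Normc.eq0_normc; apply/eqP; rewrite eq_le cmod_ge0 andbT.
have p0 : 0 < pi :> R := pi_gt0 R.
apply/ler_addgt0Pr => e e0; rewrite add0r.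
have [B HB] := hv (e / (2 * pi)) (divr_gt0 e0 (mulr_gt0 (ltr0Sn _ 1) p0)).
rewrite (circle_cst A B) //.
have := @cint_bound R _ (e / (2 * pi)) 0 (2 * pi) (ccont_ver (entire_cont hE) B).
move=> /(_ (fun t _ => HB t)); rewrite subr0 ger0_norm ?divfK //.
  by rewrite mulf_neq0 // gt_eqF.
by rewrite mulr_ge0 // ltW.
Qed.

Lemma cexp_cis A y : cexp (A +i* y) = (expR A)%:C * cis y.
Proof.
by rewrite -cexp_real /cis -cexpD; congr cexp; apply: complex_eqP; rewrite !ReImE; ring.
Qed.

Lemma cisN_int : cint (fun y => cis (- y)) 0 (2 * pi) = 0.
Proof.
pose G (y : R) := 'i * cexp (0 + y%:C * (- 'i)).
have E s : cexp (0 + s%:C * (- 'i)) = cis (- s).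
  by rewrite /cis; congr cexp; apply: complex_eqP; rewrite !ReImE; ring.
rewrite (@cint_eq _ G).
  have c2 : cexp ('i * (2 * pi)%:C) = 1 :> C.
    by rewrite -[X in cexp X]add0r cexp_periodic cexp0.
  by rewrite /G !add0r mul0r cexp0 mulrN cexpN [_%:C * _]mulrC c2 invr1 mulr1 subrr.
move=> t; have := gder_lin 'i (@rder_line R (@cexp R) 0 (- 'i) t _ (cdiff_cexp _)).
apply: gder_eq; rewrite E mulrCA mulrN -expr2 sqr_i opprK mulr1 //.
Qed.

Lemma entire_shift f z0 : entire f -> entire (fun w => f (z0 + w)).
Proof.
move=> /entireP F; apply/entireP => z; have [l Fl] := F (z0 + z); exists (l * 1).
apply: gder_comp Fl _; have := gderD (@gder_cst _ _ id z0 z) (@cdiff_id R z).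
by rewrite add0r.
Qed.

Lemma entireM f g : entire f -> entire g -> entire (fun w => f w * g w).
Proof.
move=> /entireP F /entireP G; apply/entireP => z.
by have [[l Fl] [m Gm]] := (F z, G z); exists (l * g z + f z * m); exact: gderM.
Qed.

Lemma entireD f g : entire f -> entire g -> entire (fun w => f w + g w).
Proof.
move=> /entireP F /entireP G; apply/entireP => z.
by have [[l Fl] [m Gm]] := (F z, G z); exists (l + m); exact: gderD.
Qed.

Lemma entire_cst c : entire (fun=> c : C).
Proof. by apply/entireP => z; exists 0; exact: gder_cst. Qed.

Lemma entire_id : entire (id : C -> C).
Proof. by apply/entireP => z; exists 1; exact: cdiff_id. Qed.

Lemma entireZ c f : entire f -> entire (fun w => c * f w).
Proof. by move=> F; exact (entireM (@entire_cst c) F). Qed.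

Lemma entireN f : entire f -> entire (fun w => - f w).
Proof.
by move=> /(@entireZ (-1) f); rewrite (_ : (fun w => _) = (fun w => - f w)) //; apply/funext => w; rewrite mulN1r.
Qed.

Lemma entireB f g : entire f -> entire g -> entire (fun w => f w - g w).
Proof. by move=> F /entireN G; exact (entireD F G). Qed.

Lemma entire_comp f g : entire f -> entire g -> entire (fun w => f (g w)).
Proof.
move=> /entireP F /entireP G; apply/entireP => z.
by have [m Gm] := G z; have [l Fl] := F (g z); exists (l * m); exact: gder_comp.
Qed.

Lemma entireX f n : entire f -> entire (fun w => f w ^+ n).
Proof.
move=> /entireP F; apply/entireP => z.
by have [l Fl] := F z; exists (n%:R * f z ^+ n.-1 * l); exact: cdiffX.
Qed.

Lemma entire_prod (I : Type) (r : seq I) (F : I -> C -> C) :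
  (forall i, entire (F i)) -> entire (fun w => \prod_(i <- r) F i w).
Proof.
move=> H; elim: r => [|i r ih].
  rewrite (_ : (fun w => _) = (fun=> 1)); first exact: entire_cst.
  by apply/funext => w; rewrite big_nil.
rewrite (_ : (fun w => _) = (fun w => F i w * \prod_(j <- r) F j w)).
  exact (entireM (H i) ih).
by apply/funext => w; rewrite big_cons.
Qed.

Lemma cint_ext (u v : R -> C) a b : (forall t, u t = v t) -> cint u a b = cint v a b.
Proof. by move=> /funext ->. Qed.

Lemma mean_value f z0 (r : R) : 0 < r -> entire f ->
  cint (fun y => f (z0 + r%:C * cis y)) 0 (2 * pi) = (2 * pi)%:C * f z0.
Proof.
move=> r0 F; pose h z := f (z0 + cexp z) - f z0.
have hE : entire h.
  exact (entireB (entire_comp (@entire_shift f z0 F) (@entire_cexp R)) (@entire_cst (f z0))).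
have hp z : h (z + 'i * (2 * pi)%:C) = h z by rewrite /h cexp_periodic.
have := @circle_vanish h (ln r) hE hp; rewrite -[X in _ -> X = 0]/(cint _ _ _).
have hv e : 0 < e -> exists B, forall y, cmod (h (B +i* y)) <= e.
  move=> /(entire_cont F z0)[d d0 D]; exists (ln (d / 2)) => y.
  apply: D; rewrite addrC addKr cmod_cexp /= lnK ?posrE; lra.
move=> /(_ hv); rewrite /h.
have fc : rcont (fun y => f (z0 + cexp (ln r +i* y))).
  apply: (@ccont_ver _ (fun z => f (z0 + cexp z))); apply: entire_cont.
  exact (entire_comp (@entire_shift f z0 F) (@entire_cexp R)).
have kc : rcont (fun=> f z0) by move=> t e e0; exists 1 => // s _; rewrite subrr cmod0 ltW.
rewrite (@cint_ext _ (fun y => -1 * f z0 + f (z0 + cexp (ln r +i* y)))); last first.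
  by move=> t; ring.
rewrite (@cint_lin _ (-1) (fun=> f z0)) // cint_cst subr0 => /eqP.
rewrite mulN1r addrC subr_eq0 => /eqP h0; rewrite [RHS]mulrC -h0; apply: cint_ext => y.
by rewrite cexp_cis lnK.
Qed.

(** Cauchy's formula for the derivative. Once the affine part at z0 is removed, the quotient by e^z
    tends to 0 on small circles, which is differentiability itself. *)
Lemma mean_deriv f z0 l (r : R) : 0 < r -> entire f -> cdiff f z0 l ->
  cint (fun y => f (z0 + r%:C * cis y) * cis (- y)) 0 (2 * pi) = (2 * pi * r)%:C * l.
Proof.
move=> r0 F Fl; pose h z := (f (z0 + cexp z) - f z0 - l * cexp z) * cexp (- z).
have eN : entire (fun z : C => cexp (- z)).
  exact (entire_comp (@entire_cexp R) (entireN (@entire_id))).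
have eF : entire (fun z : C => f (z0 + cexp z)).
  exact (entire_comp (@entire_shift f z0 F) (@entire_cexp R)).
have hE : entire h.
  exact (entireM (entireB (entireB eF (@entire_cst (f z0))) (@entireZ l _ (@entire_cexp R))) eN).
have hp z : h (z + 'i * (2 * pi)%:C) = h z by rewrite /h !cexpN !cexp_periodic.
have hv e : 0 < e -> exists B, forall y, cmod (h (B +i* y)) <= e.
  move=> /Fl[d d0 D]; exists (ln (d / 2)) => y.
  have d20 : 0 < d / 2 by lra.
  rewrite cmodM cexpN cmodV ler_pdivrMr ?cmod_gt0 ?cexp_neq0 //.
  by apply: D; rewrite cmod_cexp /= lnK ?posrE; lra.
have := @circle_vanish h (ln r) hE hp hv; rewrite /h.
have c1 : rcont (fun y => f (z0 + cexp (ln r +i* y)) * cexp (- (ln r +i* y))).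
  apply: (@ccont_ver _ (fun z => f (z0 + cexp z) * cexp (- z))); exact (entire_cont (entireM eF eN)).
have c2 : rcont (fun y => cexp (- (ln r +i* y))).
  exact: (@ccont_ver _ (fun z => cexp (- z)) (entire_cont eN)).
have kc : rcont (fun=> l) by move=> t e e0; exists 1 => // s _; rewrite subrr cmod0 ltW.
(* The constant term integrates to 0 by [cisN_int]; the linear term contributes 2 pi l. *)
rewrite (@cint_ext _ (fun y => - f z0 * cexp (- (ln r +i* y)) + ((-1) * l + f (z0 + cexp (ln r +i* y)) * cexp (- (ln r +i* y))))); last first.
  move=> t; have := divff (cexp_neq0 (ln r +i* t)); rewrite cexpN => E.
  by rewrite mulrBl mulrBl -mulrA E mulr1; ring.
rewrite cint_lin //; last by apply: rcontD => //; exact: rcontZ.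
rewrite (@cint_lin _ (-1) (fun=> l)) // cint_cst subr0.
have E y : cexp (- (ln r +i* y)) = (r^-1)%:C * cis (- y).
  rewrite -[LHS](_ : cexp ((- ln r) +i* (- y)) = _).
    by rewrite cexp_cis expRN lnK.
  by congr cexp; apply: complex_eqP; rewrite !ReImE.
have cc : rcont (fun y => cis (- y)).
  have := rcontZ r%:C c2; rewrite (_ : (fun t => _) = (fun y => cis (- y))) //.
  by apply/funext => t; rewrite E mulrA -rmorphM mulfV ?gt_eqF // mul1r.
have z_c : rcont (fun=> 0 : C) by move=> t e e0; exists 1 => // s _; rewrite subrr cmod0 ltW.
have lin (k : C) (u : R -> C) : rcont u -> cint (fun y => k * u y) 0 (2 * pi) = k * cint u 0 (2 * pi).
  move=> uc; have := @cint_lin _ k u (fun=> 0) 0 (2 * pi) uc z_c.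
  rewrite cint_cst mul0r addr0 => <-; by apply: cint_ext => t; rewrite addr0.
rewrite (@cint_ext (fun y => cexp (- (ln r +i* y))) (fun y => (r^-1)%:C * cis (- y))) //.
rewrite lin // cisN_int !mulr0 add0r => /eqP; rewrite mulN1r addrC subr_eq0 => /eqP h0.
have fcc : rcont (fun y => f (z0 + r%:C * cis y) * cis (- y)).
  have := rcontZ r%:C c1; rewrite (_ : (fun t => _) = (fun y => f (z0 + r%:C * cis y) * cis (- y))) //.
  apply/funext => t; rewrite E cexp_cis lnK //.
  by rewrite mulrCA (mulrA r%:C) -rmorphM mulfV ?gt_eqF // mul1r.
have {h0} : r%:C * cint (fun y : R => f (z0 + cexp (ln r +i* y)) * cexp (- (ln r +i* y))) 0 (2 * pi) = r%:C * (l * (2 * pi)%:C) by rewrite h0.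
rewrite -lin // (@cint_ext _ (fun y => f (z0 + r%:C * cis y) * cis (- y))).
  by move=> ->; rewrite !rmorphM; ring.
move=> t; rewrite E cexp_cis lnK //.
by rewrite mulrCA (mulrA r%:C) -rmorphM mulfV ?gt_eqF // mul1r.
Qed.

End Circle.

(** * Cauchy estimates, removable singularities and locally uniform limits *)

Section CauchyEstimates.
Variable R : realType.
Local Notation C := R[i].
Implicit Types f g h : C -> C.

Lemma circle_cont f (z0 : C) (r : R) : 0 < r -> entire f ->
  rcont (fun y => f (z0 + r%:C * cis y)).
Proof.
move=> r0 F; rewrite (_ : (fun y => _) = (fun y => f (z0 + cexp (ln r +i* y)))).
  apply: (@ccont_ver _ (fun z => f (z0 + cexp z))).
  exact (entire_cont (entire_comp (@entire_shift _ f z0 F) (@entire_cexp R))).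
by apply/funext => y; rewrite cexp_cis lnK.
Qed.

Lemma cis_cont : rcont (fun y : R => cis (- y)).
Proof.
rewrite (_ : (fun y => _) = (fun y => cexp (- (0 +i* y)))).
  apply: (@ccont_ver _ (fun z => cexp (- z))).
  exact (entire_cont (entire_comp (@entire_cexp R) (entireN (@entire_id R)))).
by apply/funext => y; rewrite /cis; congr cexp; apply: complex_eqP; rewrite !ReImE; ring.
Qed.

Lemma rcont_local_bound (g : R -> C) t : rcont g ->
  exists2 d : R, 0 < d & forall s, `|s - t| < d -> cmod (g s) <= cmod (g t) + 1.
Proof.
move=> gc; have [d d0 D] := gc t 1 ltr01; exists d => // s /D h.
by rewrite -[g s](subrK (g t)) (le_trans (cmodD _ _)) // addrC lerD2l.
Qed.

Lemma rcontM (g h : R -> C) : rcont g -> rcont h -> rcont (fun t => g t * h t).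
Proof.
move=> gc hc t e e0.
pose K := cmod (g t) + 1; have K0 : 0 < K by rewrite ltr_wpDl ?cmod_ge0.
pose L := cmod (h t) + 1; have L0 : 0 < L by rewrite ltr_wpDl ?cmod_ge0.
have [d1 d10 D1] := rcont_local_bound t gc.
have [d2 d20 D2] := gc t (e / 2 / L) (divr_gt0 (divr_gt0 e0 (ltr0Sn _ 1)) L0).
have [d3 d30 D3] := hc t (e / 2 / K) (divr_gt0 (divr_gt0 e0 (ltr0Sn _ 1)) K0).
exists (Num.min d1 (Num.min d2 d3)); first by rewrite !lt_min d10 d20.
move=> s; rewrite !lt_min => /and3P[/D1 h1 /D2 h2 /D3 h3].
rewrite (_ : _ - _ = g s * (h s - h t) + (g s - g t) * h t); last by ring.
apply: (le_trans (cmodD _ _)); rewrite !cmodM.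
rewrite (_ : e = K * (e / 2 / K) + (e / 2 / L) * L); last by field; rewrite !gt_eqF.
apply: lerD; apply: ler_pM; rewrite ?cmod_ge0 //.
by rewrite lerDl.
Qed.

Lemma max_modulus f z0 (r M : R) : 0 < r -> entire f ->
  (forall w, cmod w = r -> cmod (f (z0 + w)) <= M) -> cmod (f z0) <= M.
Proof.
move=> r0 F H; have p0 : 0 < 2 * pi :> R by rewrite mulr_gt0 // pi_gt0.
rewrite -(ler_pM2l p0) -[X in X * _ <= _](gtr0_norm p0) -cmodR -cmodM.
rewrite -(@mean_value _ _ _ _ r0 F).
have := @cint_bound R _ M 0 (2 * pi) (@circle_cont f z0 r r0 F).
rewrite subr0 (gtr0_norm p0) [_ * (2 * pi)]mulrC; apply => t _; apply: H.
by rewrite cmodM cmod_cis mulr1 cmodR gtr0_norm.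
Qed.

Lemma cauchy_estimate f z0 l (r M : R) : 0 < r -> entire f -> cdiff f z0 l ->
  (forall w, cmod w = r -> cmod (f (z0 + w)) <= M) -> cmod l <= M / r.
Proof.
move=> r0 F Fl H; have p0 : 0 < 2 * pi :> R by rewrite mulr_gt0 // pi_gt0.
rewrite ler_pdivlMr // -(ler_pM2l p0) -[X in X * _ <= _](gtr0_norm p0).
rewrite -[r in X in X <= _](gtr0_norm r0) mulrCA -mulrC -normrM -cmodR -cmodM.
rewrite -(mean_deriv r0 F Fl).
have := @cint_bound R _ M 0 (2 * pi) (rcontM (@circle_cont f z0 r r0 F) cis_cont).
rewrite subr0 (gtr0_norm p0) [_ * (2 * pi)]mulrC; apply => t _; rewrite cmodM cmod_cis mulr1; apply: H.
by rewrite cmodM cmod_cis mulr1 cmodR gtr0_norm.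
Qed.

Lemma ccont_bounded f (r : R) : (forall z, ccont f z) ->
  exists2 M : R, 0 <= M & forall z, cmod z <= r -> cmod (f z) <= M.
Proof.
move=> fc.
have [M HM] : exists M, forall x y, between (- r) (2 * r) x -> between (- r) (2 * r) y ->
    cmod (f (x +i* y)) <= M.
  apply: (@bisection _ (fun a p c q => exists M, forall x y, between a p x ->
     between c q y -> cmod (f (x +i* y)) <= M)).
    move=> a p c q [M1 H1] [M2 H2] [M3 H3] [M4 H4].
    exists (Num.max (Num.max M1 M2) (Num.max M3 M4)) => x y.
    have half (b s x' : R) : between b s x' -> between b (s / 2) x' \/ between (b + s / 2) (s / 2) x'.
      move=> [t /andP[t0 t1] ->]; have [th|th] := leP t (1 / 2).
        by left; exists (2 * t); [lra|field].
      by right; exists (2 * t - 1); [lra|field].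
    by move=> /half[hx|hx] /half[hy|hy]; rewrite !le_max ?(H1 _ _ hx hy) ?(H2 _ _ hx hy) ?(H3 _ _ hx hy) ?(H4 _ _ hx hy) ?orbT.
  move=> x y _ _; have [d d0 D] := fc (x +i* y) 1 ltr01; exists d => // a p c q pqd.
  move=> [s /andP[s0 s1] xE] [t /andP[t0 t1] yE].
  exists (cmod (f (x +i* y)) + 1) => x' y' [s' /andP[s0' s1'] xE'] [t' /andP[t0' t1'] yE'].
  rewrite -[f (x' +i* y')](subrK (f (x +i* y))) (le_trans (cmodD _ _)) // addrC lerD2l.
  apply: D; apply: le_lt_trans pqd; apply: (le_trans (cmod_leD _)); rewrite !ReImE.
  rewrite (_ : x' - x = (s' - s) * p); last by rewrite xE' xE; ring.
  rewrite (_ : y' - y = (t' - t) * q); last by rewrite yE' yE; ring.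
  by rewrite !normrM; apply: lerD; apply: ler_piMl => //; rewrite ler_norml; lra.
exists (Num.max 0 M) => [|[x y] zr]; first by rewrite le_max lexx.
have btw (t : R) : `|t| <= r -> between (- r) (2 * r) t.
  move=> tr; have r0 : 0 <= r := le_trans (normr_ge0 t) tr.
  apply: between_ge; rewrite ge_min le_max; move: tr; rewrite ler_norml => /andP[-> h] /=.
  by apply/orP; right; lra.
rewrite le_max HM ?orbT //; apply: btw; apply: le_trans zr.
  exact: (normRe_le (x +i* y)).
exact: (normIm_le (x +i* y)).
Qed.

Lemma cmod_mvt f f' (z k : C) M : (forall w, cdiff f w (f' w)) ->
  (forall t : R, 0 <= t <= 1 -> cmod (f' (z + t%:C * k)) <= M) ->
  cmod (f (z + k) - f z) <= M * cmod k.
Proof.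
move=> Hf HM.
have := @rder_mvt R (fun t => f (z + t%:C * k)) (fun t => f' (z + t%:C * k) * k)
  (fun t => (M * cmod k) * t) (fun=> M * cmod k) 0 1 ler01.
rewrite mul1r mul0r addr0 mulr1 mulr0 subr0; apply.
- by move=> t _; exact: rder_line.
- by move=> t _; have := is_deriveZ (M * cmod k) (is_derive_id t 1); rewrite /GRing.scale /= mulr1.
- by move=> t /HM h; rewrite cmodM ler_wpM2r ?cmod_ge0.
Qed.

(** The Cauchy estimate bounds f' on discs; applied to f(. + k) - f it makes f' Lipschitz there,
    hence continuous. Then f' is an integral of f over a circle of radius 1, and it is
    differentiated under the integral sign, the error being controlled by the Lipschitz bound. *)
Lemma entire_derivative f : entire f ->
  exists f', (forall z, cdiff f z (f' z)) /\ entire f'.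
Proof.
move=> F; have /choice[f' Hf'] := (entireP f).1 F.
exists f'; split; first exact Hf'.
have p0 : 0 < 2 * pi :> R by rewrite mulr_gt0 // pi_gt0.
have bnd r : exists2 M : R, 0 <= M & forall z, cmod z <= r -> cmod (f' z) <= M.
  have [M M0 HM] := ccont_bounded (r + 1) (entire_cont F).
  exists M => // z zr; rewrite -[M]divr1.
  apply: (cauchy_estimate ltr01 F (Hf' z)) => w w1; apply: HM.
  by apply: (le_trans (cmodD _ _)); rewrite w1 lerD2r.
have seg (z k : C) (t : R) : 0 <= t <= 1 -> cmod (z + t%:C * k) <= cmod z + cmod k.
  move=> /andP[t0 t1]; apply: (le_trans (cmodD _ _)); rewrite lerD2l cmodM cmodR.
  by rewrite ger0_norm // ler_piMl ?cmod_ge0.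
have lip r : exists2 M : R, 0 <= M & forall z k, cmod z <= r -> cmod k <= 1 ->
    cmod (f' (z + k) - f' z) <= M * cmod k.
  have [M M0 HM] := bnd (r + 2); exists M => // z k zr k1.
  have sh (w : C) : cdiff (fun w => f (w + k)) w (f' (w + k)).
    have h := gderD (@cdiff_id R w) (@gder_cst _ _ id k w).
    by have := gder_comp (g := fun w => w + k) (Hf' (w + k)) h; rewrite addr0 mulr1.
  have cd : cdiff (fun w => f (w + k) - f w) z (f' (z + k) - f' z).
    exact: gderB (sh z) (Hf' z).
  have e : entire (fun w => f (w + k) - f w).
    by apply/entireP => w; exists (f' (w + k) - f' w); exact: gderB (sh w) (Hf' w).
  rewrite -[M * _]divr1; apply: (cauchy_estimate ltr01 e cd) => w w1.
  apply: (cmod_mvt Hf') => t t01; apply: HM; apply: (le_trans (seg _ _ _ t01)).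
  have := cmodD z w; lra.
have fc z : ccont f' z.
  have [M M0 HM] := lip (cmod z) => e e0.
  have M1 : 0 < M + 1 by lra.
  exists (Num.min 1 (e / (M + 1))); first by rewrite lt_min ltr01 divr_gt0.
  move=> w; rewrite lt_min ltr_pdivlMr // => /andP[w1 w2].
  have := HM z (w - z) (lexx _) (ltW w1); rewrite [z + _]addrC subrK => h.
  apply: (le_trans h); have := cmod_ge0 (w - z); nra.
apply/entireP => z.
(* The candidate for the second derivative: Cauchy's formula with f' in place of f. *)
pose A := cint (fun y => f' (z + 1%:C * cis y) * cis (- y)) 0 (2 * pi) / (2 * pi)%:C.
exists A => e e0.
have [M M0 HM] := lip (cmod z + 2).
have M1 : 0 < M + 1 by lra.
exists (Num.min 1 (e / (M + 1))); first by rewrite lt_min ltr01 divr_gt0.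
move=> k; rewrite lt_min ltr_pdivlMr // => /andP[k1 k2].
have md w : cint (fun y => f (w + 1%:C * cis y) * cis (- y)) 0 (2 * pi) = (2 * pi)%:C * f' w.
  by rewrite (mean_deriv ltr01 F (Hf' w)) mulr1.
have p0c : (2 * pi)%:C != 0 :> C by rewrite -cmod_gt0 cmodR gtr0_norm.
have c1 w : rcont (fun y => f (w + 1%:C * cis y) * cis (- y)).
  exact: rcontM (@circle_cont f w 1 ltr01 F) cis_cont.
have c2 : rcont (fun y => f' (z + 1%:C * cis y) * cis (- y)).
  apply: rcontM cis_cont => t e1 e10.
  have [d d0 D] := fc (z + 1%:C * cis t) _ e10.
  have [d' d'0 D'] := @circle_cont (fun w => w) z 1 ltr01 (@entire_id R) t (d / 2) (divr_gt0 d0 (ltr0Sn _ 1)).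
  by exists d' => // s /D' h; apply: D; apply: (le_lt_trans h); lra.
have E : (2 * pi)%:C * (f' (z + k) - f' z - A * k) =
  cint (fun y => (- k) * (f' (z + 1%:C * cis y) * cis (- y)) +
    ((- 1) * (f (z + 1%:C * cis y) * cis (- y)) + f (z + k + 1%:C * cis y) * cis (- y))) 0 (2 * pi).
  rewrite cint_lin //; last by apply: rcontD => //; exact: rcontZ.
  by rewrite cint_lin // !md /A; move: p0c; move: (_ %:C) => P P0; field.
rewrite -(ler_pM2l p0) -[X in X * _ <= _](gtr0_norm p0) -cmodR -cmodM E.
have cc : rcont (fun y => (- k) * (f' (z + 1%:C * cis y) * cis (- y)) +
    ((- 1) * (f (z + 1%:C * cis y) * cis (- y)) + f (z + k + 1%:C * cis y) * cis (- y))).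
  by apply: rcontD; [exact: rcontZ|apply: rcontD => //; exact: rcontZ].
have := @cint_bound R _ (e * cmod k) 0 (2 * pi) cc; rewrite subr0 (gtr0_norm p0) [_ * (2 * pi)]mulrC.
apply => t _; set w := z + 1%:C * cis t.
rewrite (_ : z + k + 1%:C * cis t = w + k); last by rewrite /w; ring.
rewrite (_ : _ + _ = (f (w + k) - f w - f' w * k) * cis (- t)); last by ring.
rewrite cmodM cmod_cis mulr1.
have wz : cmod w <= cmod z + 1.
  by apply: (le_trans (cmodD _ _)); rewrite mul1r cmod_cis.
have Hg v : cdiff (fun v => f v - f' w * v) v (f' v - f' w).
  have := gderB (Hf' v) (gder_lin (f' w) (@cdiff_id R v)); rewrite mulr1; exact.
have := @cmod_mvt _ _ w k (M * cmod k) Hg.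
rewrite (_ : _ - _ - (_ - _) = f (w + k) - f w - f' w * k); last by ring.
move=> H; apply: (le_trans (H _)).
  move=> s /[dup]/seg hs /andP[s0 s1].
  have sk : cmod (s%:C * k) <= cmod k.
    by rewrite cmodM cmodR ger0_norm // ler_piMl ?cmod_ge0.
  apply: (le_trans (HM _ _ _ _)); [lra|lra|by rewrite ler_wpM2l].
rewrite ler_wpM2r ?cmod_ge0 //; have := cmod_ge0 k; nra.
Qed.

Lemma morera_entire f : (forall z, ccont f z) -> (forall a b c d, rint f a b c d = 0) ->
  entire f.
Proof.
move=> fc f0; have [K HK] := morera fc f0.
have KE : entire K by apply/entireP => z; exists (f z).
have [K' [HK' K'E]] := entire_derivative KE.
by have -> : f = K' by apply/funext => z; exact: cdiff_uniq (HK z) (HK' z).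
Qed.

(** The difference quotient, completed by the derivative at a, is continuous everywhere and
    differentiable off a; [goursat_except] and Morera's theorem remove the singularity. *)
Lemma entire_division f a : entire f ->
  exists2 g, entire g & forall z, f z = f a + (z - a) * g z.
Proof.
move=> F; have [l Fl] := (entireP f).1 F a.
pose g z := if z == a then l else (f z - f a) / (z - a).
have gE z : f z = f a + (z - a) * g z.
  rewrite /g; case: eqVneq => [->|za]; first by rewrite subrr mul0r addr0.
  by rewrite mulrC divfK ?subr_eq0 // addrC subrK.
have gd z : z != a -> exists m, cdiff g z m.
  move=> za; have [m Fm] := (entireP f).1 F z.
  have za' : z - a != 0 by rewrite subr_eq0.
  eexists; apply: (@gder_local _ _ _ (fun w => (f w - f a) * (w - a)^-1) g z _ (cmod (z - a))); rewrite ?cmod_gt0 //.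
    move=> w wza; rewrite /g; case: eqVneq => // zwa.
    by move: wza; rewrite -zwa opprD addrA subrr add0r cmodN ltxx.
  apply: gderM (gderB Fm (@gder_cst _ _ id (f a) z)) _.
  exact: cdiffV (gderB (@cdiff_id R z) (@gder_cst _ _ id a z)) za'.
have gc z : ccont g z.
  have [->|za] := eqVneq z a; last by have [m /cdiff_cont] := gd z za.
  move=> e e0; have [d d0 D] := Fl e e0; exists d => // w.
  rewrite /g eqxx; case: (eqVneq w a) => [->|wa].
    by rewrite !subrr cmod0 => _; exact: ltW.
  have wa' : w - a != 0 by rewrite subr_eq0.
  move=> /D; rewrite [a + _]addrC subrK => h.
  rewrite (_ : _ - l = (f w - f a - l * (w - a)) / (w - a)); last by field.
  by rewrite cmodM cmodV ler_pdivrMr ?cmod_gt0.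
exists g; last exact gE.
apply: morera_entire; first exact gc.
by move=> *; exact: (@goursat_except _ g a).
Qed.

Lemma norm_between (u v t : R) : Num.min u v <= t <= Num.max u v -> `|t| <= `|u| + `|v|.
Proof.
rewrite ge_min le_max => /andP[h1 h2].
have := ler_norm u; have := ler_norm v; have := ler_norm (- u); have := ler_norm (- v).
rewrite !normrN => k1 k2 k3 k4; rewrite ler_norml.
have := normr_ge0 u; have := normr_ge0 v => k5 k6.
by case/orP: h1 => h1; case/orP: h2 => h2; apply/andP; split; lra.
Qed.

(** Rectangle integrals pass to locally uniform limits, so Morera's theorem applies. *)
Lemma entire_limit (F : nat -> C -> C) f : (forall n, entire (F n)) ->
  (forall r e : R, 0 < e -> exists N : nat, forall n, (N <= n)%N ->
     forall z, cmod z <= r -> cmod (F n z - f z) <= e) -> entire f.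
Proof.
move=> FE Ff.
have fc z : ccont f z.
  move=> e e0; have e3 : 0 < e / 3 by lra.
  have [N HN] := Ff (cmod z + 1) _ e3.
  have [d d0 D] := entire_cont (FE N) z e3.
  exists (Num.min 1 d) => [|w]; first by rewrite lt_min ltr01.
  rewrite lt_min => /andP[w1 /D h].
  have h1 := HN N (leqnn _) z; have h2 := HN N (leqnn _) w.
  rewrite (_ : f w - f z = (F N w - F N z) + (F N z - f z) - (F N w - f w)); last by ring.
  apply: (le_trans (cmodB _ _)); apply: (le_trans (lerD (cmodD _ _) (lexx _))).
  have : cmod (F N z - f z) <= e / 3 by apply: h1; lra.
  have : cmod (F N w - f w) <= e / 3.
    apply: h2; rewrite -[w](subrK z) (le_trans (cmodD _ _)) //; lra.
  lra.
apply: morera_entire; first exact fc.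
move=> a b c d.
apply: Normc.eq0_normc; apply/eqP; rewrite eq_le cmod_ge0 andbT.
apply/ler_addgt0Pr => e e0; rewrite add0r.
pose S : R := 2 * (`|b - a| + `|d - c|) + 1; have S0 : 0 < S by rewrite ltr_wpDl // mulr_ge0 // addr_ge0.
pose r : R := `|a| + `|b| + `|c| + `|d|.
have [N HN] := Ff r (e / S) (divr_gt0 e0 S0).
have := @rint_lin R (F N) f (-1) a b c d (entire_cont (FE N)) fc.
rewrite (entire_rint _ _ _ _ (FE N)) mulr0 add0r => <-.
apply: (le_trans (@rint_bound _ _ (e / S) _ _ _ _ _ _)).
- move=> z e1 e10; have e2 : 0 < e1 / 2 by lra.
  have [d1 d10 D1] := entire_cont (FE N) z e2; have [d2 d20 D2] := fc z _ e2.
  exists (Num.min d1 d2); first by rewrite lt_min d10.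
  move=> w; rewrite lt_min => /andP[/D1 h1 /D2 h2].
  rewrite (_ : _ - _ = (f w - f z) - (F N w - F N z)); last by ring.
  apply: (le_trans (cmodB _ _)); lra.
- move=> x y hx hy; rewrite (_ : _ + _ = - (F N (x +i* y) - f (x +i* y))); last by ring.
  rewrite cmodN; apply: HN => //; apply: (le_trans (cmod_leD _)); rewrite !ReImE /r.
  have := norm_between hx; have := norm_between hy; lra.
- rewrite mulrAC ler_pdivrMr // ler_wpM2l ?(ltW e0) // /S; lra.
Qed.

End CauchyEstimates.

(** * Infinite products and Jensen's inequality *)

Section InfiniteProducts.
Variable R : realType.
Local Notation C := R[i].

Lemma real_cauchy (u : nat -> R) :
  (forall e, 0 < e -> exists N, forall n m, (N <= n)%N -> (N <= m)%N -> `|u n - u m| <= e) ->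
  exists l : R, forall e, 0 < e -> exists N, forall n, (N <= n)%N -> `|u n - l| <= e.
Proof.
(* The limit is the supremum of the eventual lower bounds of the sequence. *)
move=> H; pose A := [set x : R | exists N, forall n, (N <= n)%N -> x <= u n].
have lo e : 0 < e -> exists N, [/\ forall n m, (N <= n)%N -> (N <= m)%N -> `|u n - u m| <= e,
    A (u N - e) & ubound A (u N + e)].
  move=> e0; have [N HN] := H e e0; exists N; split=> //.
    exists N => n Nn; have := HN N n (leqnn _) Nn; rewrite ler_norml => /andP[]; lra.
  move=> x [N' HN']; have := HN' (maxn N N') (leq_maxr _ _).
  have := HN (maxn N N') N (leq_maxl _ _) (leqnn _); rewrite ler_norml => /andP[]; lra.
have hs : has_sup A.
  by have [N [_ h1 h2]] := lo 1 ltr01; split; [exists (u N - 1)|exists (u N + 1)].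
exists (sup A) => e e0; have [N [h0 h1 h2]] := lo (e / 2) (divr_gt0 e0 (ltr0Sn _ 1)).
exists N => n Nn; have := h0 n N Nn (leqnn _).
have := ub_le_sup hs.2 h1; have := ge_sup hs.1 h2.
by rewrite !ler_norml => k1 k2 /andP[k3 k4]; apply/andP; split; lra.
Qed.

Lemma complex_cauchy (u : nat -> C) :
  (forall e, 0 < e -> exists N, forall n m, (N <= n)%N -> (N <= m)%N -> cmod (u n - u m) <= e) ->
  exists l : C, forall e, 0 < e -> exists N, forall n, (N <= n)%N -> cmod (u n - l) <= e.
Proof.
move=> H.
have [a Ha] : exists l : R, forall e, 0 < e -> exists N, forall n, (N <= n)%N ->
    `|complex.Re (u n) - l| <= e.
  apply: real_cauchy => e /H[N HN]; exists N => n m Nn Nm.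
  by apply: le_trans (HN n m Nn Nm); rewrite -cReN -cReD normRe_le.
have [b Hb] : exists l : R, forall e, 0 < e -> exists N, forall n, (N <= n)%N ->
    `|complex.Im (u n) - l| <= e.
  apply: real_cauchy => e /H[N HN]; exists N => n m Nn Nm.
  by apply: le_trans (HN n m Nn Nm); rewrite -cImN -cImD normIm_le.
exists (a +i* b) => e e0; have e2 : 0 < e / 2 by lra.
have [N HN] := Ha _ e2; have [N' HN'] := Hb _ e2; exists (maxn N N') => n.
rewrite geq_max => /andP[/HN h1 /HN' h2].
apply: (le_trans (cmod_leD _)); rewrite !ReImE; lra.
Qed.

(** The form e^c - 1 is stable under products, because u p - 1 = (u - 1) p + (p - 1) and the
    exponents add. *)
Lemma prod_sub1 (I : Type) (r : seq I) (u : I -> C) (c : I -> R) :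
  (forall i, 0 <= c i) ->
  (forall i, cmod (u i - 1) <= expR (c i) - 1) ->
  cmod (\prod_(i <- r) u i - 1) <= expR (\sum_(i <- r) c i) - 1.
Proof.
move=> c0 H; elim: r => [|i r ih]; first by rewrite !big_nil subrr cmod0 expR0 subrr.
rewrite !big_cons expRD; set p := \prod_(j <- r) _ in ih *; set s := expR (\sum_(j <- r) _) in ih *.
rewrite (_ : u i * p - 1 = (u i - 1) * p + (p - 1)); last by ring.
apply: (le_trans (cmodD _ _)); rewrite cmodM.
have ps : cmod p <= s.
  by rewrite -[p](subrK 1) (le_trans (cmodD _ _)) // cmod1 -lerBrDr.
have : cmod (u i - 1) * cmod p <= (expR (c i) - 1) * s.
  by apply: ler_pM; rewrite ?cmod_ge0.
lra.
Qed.

Lemma bounded_sum_cauchy (c : nat -> R) M : (forall n, 0 <= c n) ->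
  (forall n, \sum_(k < n) c k <= M) -> forall e, 0 < e ->
  exists N, forall n m, (N <= n)%N -> (n <= m)%N -> \sum_(n <= k < m) c k <= e.
Proof.
move=> c0 cM e e0; pose S n := \sum_(k < n) c k.
have hs : has_sup (range S).
  by split; [exists (S 0%N), 0%N|exists M => _ [n _ <-]; exact: cM].
have [_ [N _ <-] HN] := sup_adherent e0 hs.
exists N => n m Nn nm.
have mono i j : (i <= j)%N -> S i <= S j.
  move=> ij; rewrite /S -!(big_mkord xpredT) (@big_cat_nat _ _ _ i 0 j) //= lerDl.
  exact: sumr_ge0.
have -> : \sum_(n <= k < m) c k = S m - S n.
  by rewrite /S -!(big_mkord xpredT) (@big_cat_nat _ _ _ n 0 m) //= [RHS]addrC addKr.
have : S m <= sup (range S) by apply: ub_le_sup; [exact: hs.2|exists m].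
have := mono _ _ Nn; lra.
Qed.

(** [c r n] measures [u n] logarithmically on the disc of radius r. By [prod_sub1] the tails of the
    product are close to 1, which gives uniform convergence on discs and keeps the limit away from
    0. *)
Lemma infinite_product (u : nat -> C -> C) (c : R -> nat -> R) :
  (forall n, entire (u n)) -> (forall r n, 0 <= c r n) ->
  (forall r, exists M, forall n, \sum_(k < n) c r k <= M) ->
  (forall r n z, cmod z <= r -> cmod (u n z - 1) <= expR (c r n) - 1) ->
  exists P : C -> C, [/\ entire P,
    forall z (e : R), 0 < e -> exists N, forall n, (N <= n)%N ->
      cmod (\prod_(k < n) u k z - P z) <= e &
    forall z, (forall n, u n z != 0) -> P z != 0].
Proof.
move=> ue c0 cM uc.
pose p n z := \prod_(k < n) u k z.
have split_ n m z : (n <= m)%N -> p m z = p n z * \prod_(n <= k < m) u k z.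
  by move=> nm; rewrite /p -!(big_mkord xpredT (fun k => u k z)) (@big_cat_nat _ _ _ n 0 m).
have tail r n m z : cmod z <= r ->
    cmod (\prod_(n <= k < m) u k z - 1) <= expR (\sum_(n <= k < m) c r k) - 1.
  by move=> zr; apply: prod_sub1 => i //; exact: uc.
have bnd r : exists2 K : R, 0 < K & forall n z, cmod z <= r -> cmod (p n z) <= K.
  have [M HM] := cM r; exists (expR M) => [|n z zr]; first exact: expR_gt0.
  have := tail r 0%N n z zr; rewrite !(big_mkord xpredT) -/(p n z) => h.
  have : expR (\sum_(k < n) c r k) <= expR M by rewrite ler_expR.
  have := cmodD (p n z - 1) 1; rewrite subrK cmod1; lra.
have cau r e : 0 < e -> exists N, forall n m z, cmod z <= r -> (N <= n)%N -> (N <= m)%N ->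
    cmod (p n z - p m z) <= e.
  move=> e0; have [K K0 HK] := bnd r; have [M HM] := cM r.
  have d0 : 0 < ln (1 + e / K) by rewrite ln_gt0 // ltrDl divr_gt0.
  have [N HN] := bounded_sum_cauchy (c0 r) HM d0; exists N.
  have half n m z : cmod z <= r -> (N <= n)%N -> (n <= m)%N -> cmod (p n z - p m z) <= e.
    move=> zr Nn nm; rewrite (split_ n m) // -[p n z in X in X - _]mulr1 -mulrBr cmodM.
    have h1 := HK n z zr; have := tail r n m z zr; rewrite cmodBC => h2.
    have h3 : expR (\sum_(n <= k < m) c r k) <= 1 + e / K.
      by rewrite -[leRHS](@lnK R) ?ler_expR ?HN // posrE ltr_wpDl // divr_gt0.
    rewrite [e](_ : _ = K * (e / K)); last by rewrite mulrCA divff ?mulr1 // gt_eqF.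
    by apply: ler_pM; rewrite ?cmod_ge0 //; apply: (le_trans h2); rewrite lerBlDl.
  move=> n m z zr Nn Nm; case: (leqP n m) => nm; first exact: half.
  by rewrite cmodBC half // ltnW.
have /choice[P HP] z : exists l : C, forall e, 0 < e -> exists N, forall n, (N <= n)%N ->
    cmod (p n z - l) <= e.
  apply: complex_cauchy => e /(cau (cmod z))[N HN]; exists N => n m Nn Nm.
  exact: HN.
have unif r e : 0 < e -> exists N, forall n, (N <= n)%N -> forall z, cmod z <= r ->
    cmod (p n z - P z) <= e.
  move=> /(cau r)[N HN]; exists N => n Nn z zr; apply/ler_addgt0Pr => d d0.
  have [N' HN'] := HP z _ d0.
  have := HN n (maxn N N') z zr Nn (leq_maxl _ _); have := HN' (maxn N N') (leq_maxr _ _).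
  have := cmodD (p n z - p (maxn N N') z) (p (maxn N N') z - P z).
  rewrite addrA subrK; lra.
exists P; split; first 2 last.
- move=> z uz; have [M HM] := cM (cmod z).
  (* From [N] on the tails stay within 1/2 of 1, so partial products keep at least half of |p N z|,
     while their distance to the limit is at most a quarter of it. *)
  have d0 : 0 < ln (1 + 1 / 2) :> R by rewrite ln_gt0 // ltrDl divr_gt0.
  have [N HN] := bounded_sum_cauchy (c0 (cmod z)) HM d0.
  have pN : 0 < cmod (p N z) by rewrite cmod_gt0; apply/prodf_neq0 => i _.
  have [N' HN'] := HP z (cmod (p N z) / 4) (divr_gt0 pN (ltr0Sn _ 3)).
  set m := maxn N N'; have := HN' m (leq_maxr _ _).
  rewrite (split_ N m) ?leq_maxl // -cmod_gt0; set q := \prod_(_ <= _ < _) _.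
  have : cmod (1 - q) <= 1 / 2.
    rewrite cmodBC; apply: (le_trans (tail (cmod z) N m z (lexx _))).
    rewrite lerBlDl -[leRHS](@lnK R) ?ler_expR ?HN ?leq_maxl // posrE; lra.
  have := cmodD (1 - q) q; rewrite subrK cmod1 => h1 h2 h3.
  have h4 : 1 / 2 <= cmod q by lra.
  have h5 : cmod (p N z) * (1 / 2) <= cmod (p N z * q) by rewrite cmodM ler_pM2l.
  have := cmodD (p N z * q - P z) (P z); rewrite subrK; lra.
- apply: (@entire_limit _ p) => [n|]; last exact unif.
  exact (@entire_prod R _ (index_enum 'I_n) (fun k : 'I_n => u k) (fun k => ue k)).
- exact: HP.
Qed.

End InfiniteProducts.

(** * Extraction of zeros and Jensen's inequality *)

Section Jensen.
Variable R : realType.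
Local Notation C := R[i].
Implicit Types f g h q : C -> C.

Lemma ccont_eq f g a : ccont f a -> ccont g a -> (forall w, w != a -> f w = g w) -> f a = g a.
Proof.
move=> fc gc fg; apply/eqP; rewrite -subr_eq0 -cmod_eq0 eq_le cmod_ge0 andbT.
apply/ler_addgt0Pr => e e0; rewrite add0r; have e2 : 0 < e / 2 by lra.
have [d1 d10 D1] := fc _ e2; have [d2 d20 D2] := gc _ e2.
pose d := Num.min d1 d2 / 2; have d0 : 0 < d by rewrite divr_gt0 // lt_min d10.
have dd : d < d1 /\ d < d2.
  have : Num.min d1 d2 <= d1 by rewrite ge_min lexx.
  have : Num.min d1 d2 <= d2 by rewrite ge_min lexx orbT.
  by rewrite /d; split; lra.
pose w := a + d%:C; have wa : w - a = d%:C by rewrite /w addrC addKr.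
have cw : cmod (w - a) = d by rewrite wa cmodR gtr0_norm.
have := D1 w; rewrite cw => /(_ dd.1) h1; have := D2 w; rewrite cw => /(_ dd.2) h2.
have wna : w != a by rewrite -subr_eq0 -cmod_gt0 cw.
rewrite (_ : f a - g a = (g w - g a) - (f w - f a)); last by rewrite (fg w) //; ring.
apply: (le_trans (cmodB _ _)); lra.
Qed.

(** [q] stands for the zeros already extracted. It does not vanish at a, so the power of w - a has
    to divide g. *)
Lemma entire_divX q g h a m : entire q -> entire g -> entire h -> q a != 0 ->
  (forall w, q w * g w = (w - a) ^+ m * h w) ->
  exists2 g', entire g' & forall w, g w = (w - a) ^+ m * g' w.
Proof.
move=> qE gE hE qa; elim: m g gE => [|m ih] g gE H.
  by exists g; first exact gE; move=> w; rewrite expr0 mul1r.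
have g0 : g a = 0.
  have /eqP := H a; rewrite subrr expr0n mul0r mulf_eq0 (negbTE qa) /=.
  by move/eqP.
have [g1 g1E Hg1] := entire_division a gE.
have [||g' g'E Hg'] := ih g1; first exact g1E.
  move=> w; have [->|wa] := eqVneq w a; last first.
    apply: (mulfI (_ : w - a != 0)); first by rewrite subr_eq0.
    by rewrite [RHS]mulrA -exprS -H Hg1 g0 add0r; ring.
  (* Off a one cancels w - a; at a the identity follows by continuity. *)
  apply: (@ccont_eq (fun w => q w * g1 w) (fun w => (w - a) ^+ m * h w)).
  - exact (entire_cont (entireM qE g1E) a).
  - exact (entire_cont (entireM (@entireX R _ m (entireB (@entire_id R) (@entire_cst R a))) hE) a).
  - move=> v va; apply: (mulfI (_ : v - a != 0)); first by rewrite subr_eq0.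
    by rewrite [RHS]mulrA -exprS -H Hg1 g0 add0r; ring.
exists g' => [|w]; first exact g'E.
by rewrite Hg1 g0 add0r Hg' exprS mulrA.
Qed.

Lemma entire_sub_prod (L : seq C) (m : C -> nat) : entire (fun w => \prod_(a <- L) (w - a) ^+ m a).
Proof.
exact (@entire_prod R _ L (fun a w => (w - a) ^+ m a)
  (fun a => @entireX R _ (m a) (entireB (@entire_id R) (@entire_cst R a)))).
Qed.

Lemma entire_factor f (L : seq C) (m : C -> nat) : entire f -> uniq L ->
  (forall a, a \in L -> zero_of_order f a (m a)) ->
  exists2 g, entire g & forall w, f w = \prod_(a <- L) (w - a) ^+ m a * g w.
Proof.
move=> fE; elim: L => [|a L ih] /=.
  by exists f; first exact fE; move=> w; rewrite big_nil mul1r.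
move=> /andP[aL uL] H.
have [g gE Hg] := ih uL (fun b bL => H b (mem_behead (s := a :: L) bL)).
have [h [hE _ Hh]] := H a (mem_head _ _).
have qa : \prod_(b <- L) (a - b) ^+ m b != 0.
  rewrite prodf_seq_neq0; apply/allP => b bL /=; rewrite expf_neq0 // subr_eq0.
  by apply: contraNneq aL => ->.
have [w|g' g'E Hg'] := @entire_divX (fun w => \prod_(b <- L) (w - b) ^+ m b) g h a (m a)
   (@entire_sub_prod L m) gE hE qa.
  by rewrite -Hg Hh.
exists g' => [|w]; first exact g'E.
by rewrite Hg Hg' big_cons; ring.
Qed.

Lemma conjcB (z w : C) : conjc (z - w) = conjc z - conjc w.
Proof. by case: z w => x y [u v]; apply: complex_eqP => //=; rewrite opprD. Qed.

(** Each zero w - a is replaced by [B a w], which has the same modulus on the circle |w| = S. The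
    resulting function is bounded by M at the centre, where |B a 0| = S is at least S / s times |t -
    a|. *)
Lemma jensen f (L : seq C) (m : C -> nat) (t : C) (s S M : R) : entire f -> uniq L ->
  (forall a, a \in L -> zero_of_order f a (m a)) ->
  (forall a, a \in L -> cmod (a - t) <= s) -> 0 < s < S ->
  (forall w, cmod w = S -> cmod (f (t + w)) <= M) ->
  (S / s) ^+ (\sum_(a <- L) m a)%N * cmod (f t) <= M.
Proof.
move=> fE uL Hz Hs /andP[s0 sS] HM; have S0 : 0 < S := lt_trans s0 sS.
have [g gE Hg] := entire_factor fE uL Hz.
pose B a w := (S%:C ^+ 2 - conjc (a - t) * w) / S%:C.
pose F w := g (t + w) * \prod_(a <- L) B a w ^+ m a.
have BE a : entire (B a).
  have h := entireB (@entire_cst R (S%:C ^+ 2)) (@entireZ R (conjc (a - t)) _ (@entire_id R)).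
  have h2 := entireM h (@entire_cst R (S%:C^-1)); exact h2.
have FE : entire F.
  exact (entireM (@entire_shift R g t gE) (@entire_prod R _ L (fun a w => B a w ^+ m a) (fun a => @entireX R _ (m a) (BE a)))).
have Bc a w : cmod w = S -> cmod (B a w) = cmod (t + w - a).
  move=> wS; rewrite /B; have SE : S%:C ^+ 2 = conjc w * w.
    rewrite -wS -rmorphXn /= cmod_sqr; case: w {wS} => x y; apply: complex_eqP; rewrite !ReImE /=; ring.
  have -> : S%:C ^+ 2 - conjc (a - t) * w = conjc (t + w - a) * w.
    by rewrite SE (_ : t + w - a = w - (a - t)); [rewrite (conjcB w) mulrBl|ring].
  rewrite !cmodM cmodV cmodR gtr0_norm // wS mulfK ?gt_eqF //.
  by case: (t + w - a) => x y /=; rewrite sqrrN.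
have F0 : cmod (F 0) <= M.
  apply: (@max_modulus _ F 0 S) => // w wS; rewrite add0r.
  rewrite (_ : cmod (F w) = cmod (f (t + w))); first exact: HM.
  rewrite /F Hg !cmodM !cmod_prod mulrC; congr (_ * _).
  by apply: eq_bigr => a _; rewrite !cmodX Bc.
apply: le_trans F0.
rewrite /F addr0 Hg !cmodM !cmod_prod mulrA [leRHS]mulrC ler_wpM2r ?cmod_ge0 //.

have -> : (S / s) ^+ (\sum_(a <- L) m a)%N = \prod_(a <- L) (S / s) ^+ m a.
  by elim: (L) => [|a l ih]; rewrite ?big_nil ?expr0 // !big_cons exprD ih.
rewrite -big_split /= big_seq [leRHS]big_seq; apply: ler_prod => a aL.
rewrite mulr_ge0 ?exprn_ge0 ?mulr_ge0 ?invr_ge0 ?(ltW s0) ?(ltW S0) ?cmod_ge0 //=.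
rewrite !cmodX -exprMn; apply: lerXn2r; rewrite ?nnegrE ?mulr_ge0 ?mulr_ge0 ?invr_ge0 ?(ltW s0) ?(ltW S0) ?cmod_ge0 //.
rewrite /B mulr0 subr0 cmodM cmodX cmodV cmodR gtr0_norm // expr2 mulfK ?gt_eqF //.
rewrite cmodBC mulrAC ler_pdivrMr // ler_pM2l //; exact: Hs.
Qed.

End Jensen.

(** * Real powers and eventual inequalities *)

Section RealPowers.
Variable R : realType.
Implicit Types (x y p q u h d c K A rho : R).

Lemma powR_le x y p : 0 <= x -> x <= y -> 0 <= p -> x `^ p <= y `^ p.
Proof.
by move=> x0 xy p0; apply: ge0_ler_powR => //; rewrite ?nnegrE // (le_trans x0).
Qed.

(** A ratio t = z / (x + y) in [0, 1] satisfies t <= t^p; the inequalities for z = x and z = y are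
    added. *)
Lemma powR_subadd x y p : 0 <= x -> 0 <= y -> 0 < p -> p <= 1 ->
  (x + y) `^ p <= x `^ p + y `^ p.
Proof.
move=> x0 y0 p0 p1.
have [s0|s0] := eqVneq (x + y) 0.
  by rewrite s0 powR0 ?gt_eqF // addr_ge0 ?powR_ge0.
have s0' : 0 < x + y by rewrite lt_def s0 addr_ge0.
have key z : 0 <= z -> z <= x + y -> z / (x + y) * (x + y) `^ p <= z `^ p.
  move=> z0 zs; have [->|zn] := eqVneq z 0; first by rewrite !mul0r powR_ge0.
  have zp : 0 < z by rewrite lt_def zn.
  have -> : z `^ p = (z / (x + y)) `^ p * (x + y) `^ p.
    by rewrite -powRM ?divfK // ?gt_eqF // ?divr_ge0 // ltW.
  rewrite ler_wpM2r ?powR_ge0 //; apply: ger1_powR => //.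
  by rewrite divr_gt0 //= ler_pdivrMr // mul1r.
have h1 := key x x0 (_ : x <= x + y); have h2 := key y y0 (_ : y <= x + y).
have := lerD (h1 _) (h2 _); rewrite lerDl lerDr -mulrDl -mulrDl divff // mul1r.
exact.
Qed.

(* Young's inequality against the constant 1. *)
Lemma powR_tangent rho b h : 1 < rho -> 0 < b -> 0 <= h ->
  b `^ rho + rho * b `^ (rho - 1) * (h - b) <= h `^ rho.
Proof.
move=> r1 b0 h0; have r0 : 0 < rho by lra.
have q0 : 0 < rho / (rho - 1) by rewrite divr_gt0 //; lra.
have := @conjugate_powR R (h / b) 1 rho (rho / (rho - 1)) (divr_ge0 h0 (ltW b0)) ler01 r0 q0.
have -> : rho^-1 + (rho / (rho - 1))^-1 = 1 by field; apply/andP; split; lra.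
have hb : (h / b) `^ rho = h `^ rho / b `^ rho.
  by rewrite powRM ?invr_ge0 ?(ltW b0) // -(powR_inv1 (ltW b0)) -powRrM mulN1r powRN.
move=> /(_ erefl); rewrite mulr1 powR1 hb => H.
have bb : 0 < b `^ rho by rewrite powR_gt0.
have -> : b `^ (rho - 1) = b `^ rho * b^-1.
  by rewrite powRB ?powRr1 ?(ltW b0) // gt_eqF ?implybT.
have {}H : h / b <= h `^ rho / b `^ rho / rho + (rho - 1) / rho.
  by apply: (le_trans H); rewrite lerD2l mul1r invf_div.
have {}H : rho * (h / b) <= h `^ rho / b `^ rho + (rho - 1).
  have := ler_wpM2l (ltW r0) H.
  by rewrite [leRHS](_ : _ = h `^ rho / b `^ rho + (rho - 1)) //; field; rewrite !gt_eqF.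
have := ler_wpM2l (ltW bb) H.
rewrite [leRHS](_ : _ = h `^ rho + b `^ rho * (rho - 1)) => [{}H|]; last by field; rewrite gt_eqF.
rewrite (_ : _ + _ = b `^ rho * (rho * (h / b)) - b `^ rho * (rho - 1)); first lra.
by field; rewrite gt_eqF.
Qed.

Lemma powR_dominated p q A d : 0 < p -> p < q -> 0 <= A -> 0 < d ->
  exists2 C : R, 0 <= C & forall u, 0 <= u -> A * u `^ p <= d * u `^ q + C.
Proof.
(* Above the threshold [u0] the quotient of the two powers exceeds A / d; below it the left side is
   at most its value at [u0]. *)
move=> p0 pq A0 d0; pose u0 := (A / d) `^ ((q - p)^-1).
have qp : 0 < q - p by lra.
exists (A * u0 `^ p) => [|u u_ge0]; first by rewrite mulr_ge0 ?powR_ge0.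
have [uu|uu] := leP u u0.
  apply: (@le_trans _ _ (A * u0 `^ p)); last by rewrite lerDr mulr_ge0 ?powR_ge0 // ltW.
  by rewrite ler_wpM2l // powR_le // ltW.
have up : 0 < u by apply: le_lt_trans uu; rewrite powR_ge0.
apply: (@le_trans _ _ (d * u `^ q)); last by rewrite lerDl mulr_ge0 ?powR_ge0.
have un : u != 0 by rewrite gt_eqF.
have -> : u `^ q = u `^ (q - p) * u `^ p by rewrite -powRD ?un ?implybT // subrK.
rewrite mulrA ler_wpM2r ?powR_ge0 //.
rewrite mulrC -ler_pdivrMr //.
have -> : A / d = u0 `^ (q - p).
  by rewrite /u0 -powRrM mulVf ?gt_eqF // powRr1 // divr_ge0 // ltW.
by apply: powR_le; rewrite ?powR_ge0 ?ltW //.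
Qed.

Lemma ln_powR_le p u : 0 < p -> 0 < u -> ln u <= u `^ p / p.
Proof.
move=> p0 u0; rewrite ler_pdivlMr // mulrC -ln_powR ltW // ln_sublinear //.
by rewrite powR_gt0.
Qed.

Definition evt (P : R -> Prop) := exists2 h0 : R, 0 < h0 & forall h, h0 <= h -> P h.

Lemma evt_and (P Q : R -> Prop) : evt P -> evt Q -> evt (fun h => P h /\ Q h).
Proof.
move=> [a a0 HP] [b b0 HQ]; exists (Num.max a b); first by rewrite lt_max a0.
by move=> h; rewrite ge_max => /andP[/HP ? /HQ ?].
Qed.

Lemma evt_mono (P Q : R -> Prop) : (forall h, 0 < h -> P h -> Q h) -> evt P -> evt Q.
Proof.
by move=> PQ [a a0 HP]; exists a => // h ah; apply: PQ (HP h ah); exact: lt_le_trans ah.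
Qed.

Lemma evt_ge c : evt (fun h => c <= h).
Proof.
exists (Num.max 1 c); first by rewrite lt_max ltr01.
by move=> h; rewrite ge_max => /andP[].
Qed.

Lemma evt_shift (P : R -> Prop) c : 0 <= c -> evt P -> evt (fun h => P (h + c)).
Proof. by move=> c0 [a a0 H]; exists a => // h ah; apply: H; lra. Qed.

Lemma evt_pinfty (P : R -> Prop) : (\forall t \near +oo, P t) -> evt P.
Proof.
move=> [M [_ HM]]; exists (Num.max 1 (M + 1)); first by rewrite lt_max ltr01.
move=> h; rewrite ge_max => /andP[_ h1]; apply: HM; lra.
Qed.

Lemma pinfty_evt (P : R -> Prop) : evt P -> \forall t \near +oo, P t.
Proof.
move=> [a a0 H]; exists a; split; first exact: num_real.
by move=> t /ltW /H.
Qed.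

Lemma evt_powR_shift rho c d : 0 < rho -> 0 <= c -> 0 < d ->
  evt (fun h => (h + c) `^ rho <= (1 + d) * h `^ rho).
Proof.
(* k^rho = 1 + d, and h + c <= k h as soon as h >= c / (k - 1). *)
move=> r0 c0 d0; pose k := (1 + d) `^ (rho^-1).
have k1 : 1 < k.
  have ri : 0 < rho^-1 by rewrite invr_gt0.
  have := @gt0_ltr_powR R _ ri 1 (1 + d); rewrite powR1 !nnegrE; apply; lra.
apply: evt_mono (evt_ge (c / (k - 1))) => h h0 hc.
have ck : c <= h * (k - 1) by rewrite -ler_pdivrMr // subr_gt0.
have -> : 1 + d = k `^ rho.
  by rewrite /k -powRrM mulVf ?gt_eqF // powRr1 //; lra.
rewrite -powRM; [|lra|lra]; apply: powR_le; lra.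
Qed.

Lemma evt_powR_small q rho K c d : 0 <= q -> q < rho -> 0 <= K -> 0 <= c -> 0 < d ->
  evt (fun h => K * (h + c) `^ q <= d * h `^ rho).
Proof.
move=> q0 qr K0 c0 d0; have rq : 0 < rho - q by lra.
pose M := K * 2 `^ q / d; have M0 : 0 <= M by rewrite divr_ge0 ?mulr_ge0 ?powR_ge0 // ltW.
apply: evt_mono (evt_and (evt_ge c) (evt_ge (M `^ ((rho - q)^-1)))) => h h0 [hc hM].
apply: (@le_trans _ _ (K * (2 * h) `^ q)).
  by rewrite ler_wpM2l // powR_le //; lra.
have hn : h != 0 by rewrite gt_eqF.
have -> : h `^ rho = h `^ (rho - q) * h `^ q by rewrite -powRD ?hn ?implybT // subrK.
rewrite powRM ?(ltW h0) // !mulrA ler_wpM2r ?powR_ge0 //.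
rewrite [leRHS]mulrC -ler_pdivrMr // -/M.
have -> : M = (M `^ ((rho - q)^-1)) `^ (rho - q).
  by rewrite -powRrM mulVf ?gt_eqF // powRr1.
by apply: powR_le; rewrite ?powR_ge0 // ltW.
Qed.

Lemma evt_cst_small rho K d : 0 < rho -> 0 < d -> evt (fun h => K <= d * h `^ rho).
Proof.
move=> r0 d0; have := @evt_powR_small 0 rho `|K| 0 d (lexx _) r0 (normr_ge0 _) (lexx _) d0.
apply: evt_mono => h h0; rewrite powRr0 mulr1; apply: le_trans; exact: ler_norm.
Qed.

Lemma evt_ln_small rho K c d : 0 < rho -> 0 < K -> 0 <= c -> 0 < d ->
  evt (fun h => ln (K * (h + c)) <= d * h `^ rho).
Proof.
move=> r0 K0 c0 d0; have r2 : 0 < rho / 2 by lra.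
have KK : 0 <= K `^ (rho / 2) / (rho / 2) by rewrite divr_ge0 ?powR_ge0 // ltW.
have r3 : rho / 2 < rho by lra.
apply: evt_mono (evt_powR_small (ltW r2) r3 KK c0 d0) => h h0; apply: le_trans.
have hc : 0 < h + c by lra.
apply: (le_trans (ln_powR_le r2 (mulr_gt0 K0 hc))).
by rewrite powRM ?(ltW K0) ?(ltW hc) // mulrAC.
Qed.

End RealPowers.

(** * Necessity *)

Section Counting.
Variable R : realType.
Local Notation C := R[i].
Implicit Types (D : divisor R) (L : seq C) (x r h : R).

Definition inbox x r h (z : C) : Prop := `|complex.Re z - x| <= r /\ `|complex.Im z| <= h.

Lemma fsbig_mult D L : uniq L ->
  (\sum_(z \in [set` L]) ((D z)%:R : R)%:E = ((\sum_(z <- L) D z)%N%:R : R)%:E)%E.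
Proof.
move=> uL; rewrite -fsbig_seq //; elim: L {uL} => [|z L ih]; first by rewrite !big_nil.
by rewrite !big_cons ih natrD EFinD.
Qed.

(** Together with [seq_le_n] this replaces the extended-real sum by sums over duplicate-free lists,
    on which all counting is done. *)
Lemma n_le_seq D x r h (B : R) :
  (forall L, uniq L -> (forall z, z \in L -> inbox x r h z) -> (\sum_(z <- L) D z)%N%:R <= B) ->
  (n_ D x r h <= B%:E)%E.
Proof.
move=> H; rewrite /n_ /esum; apply: ge_ereal_sup => _ [A [fA AS] <-].
have /finite_seqP[s sE] := fA.
have -> : A = [set` undup s].
  by rewrite sE; apply/seteqP; split => z /=; rewrite mem_undup.
rewrite fsbig_mult ?undup_uniq // lee_fin; apply: H; first exact: undup_uniq.
by move=> z; rewrite mem_undup => zs; apply: AS; rewrite sE.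
Qed.

Lemma seq_le_n D x r h L : uniq L -> (forall z, z \in L -> inbox x r h z) ->
  (((\sum_(z <- L) D z)%N%:R : R)%:E <= n_ D x r h)%E.
Proof.
move=> uL HL; rewrite -fsbig_mult //; apply: ereal_sup_ubound.
by exists [set` L] => //; split; [exact: finite_seq|exact: HL].
Qed.

Lemma M_ge (f : C -> C) h z : `|complex.Im z| <= h -> ((cmod (f z))%:E <= M_ f h)%E.
Proof. by move=> zh; apply: ereal_sup_ubound; exists z. Qed.

Lemma limf_esup_evt (F : R -> \bar R) (s e : R) : 0 < e ->
  (limf_esup F (pinfty_nbhs R) <= s%:E)%E -> evt (fun h => (F h <= (s + e)%:E)%E).
Proof.
move=> e0 H; apply: evt_pinfty.
have : (limf_esup F (pinfty_nbhs R) < (s + e)%:E)%E.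
  by apply: (le_lt_trans H); rewrite lte_fin ltrDl.
move=> /ereal_inf_lt[_ [V VF <-] hV].
apply: filterS VF => h Vh; apply: ltW; apply: le_lt_trans hV.
by apply: ereal_sup_ubound; exists h.
Qed.

Lemma evt_limf_esup (F : R -> \bar R) (s : R) :
  (forall e, 0 < e -> evt (fun h => (F h <= (s + e)%:E)%E)) ->
  (limf_esup F (pinfty_nbhs R) <= s%:E)%E.
Proof.
move=> H; apply/lee_addgt0Pr => e e0.
have HV := pinfty_evt (H e e0).
apply: (@le_trans _ _ (ereal_sup (F @` [set h | (F h <= (s + e)%:E)%E]))).
  by apply: ereal_inf_lbound; eexists; first exact: HV.
by apply: ge_ereal_sup => _ [h hF <-].
Qed.

End Counting.

Section Necessity.
Variable R : realType.
Local Notation C := R[i].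

(** Jensen's inequality with radii s = h + a + 2 and S = s + 1 around a real point within a of x.
    The smaller disc contains the box, and ln (S / s) >= 1 / S produces the factor S = h + a + 3. *)
Lemma zeros_unit_box (f : C -> C) (D : divisor R) (a x h E : R) (L : seq C) :
  0 < a -> 0 < h -> 1 <= E -> entire f -> (forall z, zero_of_order f z (D z)) ->
  (M_ f (h + a + 3) < +oo)%E ->
  ((- E)%:E <= ereal_sup [set lne (cmod (f t%:C))%:E | t in [set t : R | (`|x - t| <= a)%R]])%E ->
  uniq L -> (forall z, z \in L -> inbox x 1 h z) ->
  (\sum_(z <- L) D z)%N%:R <=
    (h + a + 3) * (Num.max 0 (ln (fine (M_ f (h + a + 3)))) + 2) * E.
Proof.
move=> a0 h0 E1 fE fD Mfin Hlow uL HL.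
set S := h + a + 3; set M := fine _; pose s := h + a + 2.
(* [E + 1] because the supremum need not be attained; the factor [+ 2] of the conclusion absorbs it,
   as E >= 1. *)
have [t [ta ft0 ftE]] : exists t : R, [/\ `|x - t| <= a, 0 < cmod (f t%:C) &
     - (E + 1) <= ln (cmod (f t%:C))].
  apply: contrapT => /forallNP H.
  have : (ereal_sup [set lne (cmod (f t%:C))%:E | t in [set t : R | (`|x - t| <= a)%R]]
      <= (- (E + 1))%:E)%E.
    apply: ge_ereal_sup => _ [t ta <-].
    have [f0|f0] := leP (cmod (f t%:C)) 0; first by rewrite le0_lneNy ?lee_fin // leNye.
    rewrite lne_EFin // lee_fin leNgt; apply/negP => h1; apply: (H t); split=> //.
    exact: ltW.
  by move=> /(le_trans Hlow); rewrite lee_fin; lra.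
have s0 : 0 < s by rewrite /s; lra.
have sS : s < S by rewrite /s /S; lra.
have MB w : cmod w = S -> cmod (f (t%:C + w)) <= M.
  move=> wS; rewrite /M -lee_fin fineK.
    by apply: M_ge; rewrite cImD cImC add0r -/S -wS normIm_le.
  rewrite fin_numElt Mfin andbT; apply: lt_le_trans (M_ge f (z := 0) _).
    by rewrite ltNyr.
  by rewrite normr0; lra.
have near z : z \in L -> cmod (z - t%:C) <= s.
  move=> /HL[h1 h2]; apply: (le_trans (cmod_leD _)); rewrite !ReImE subr0.
  have := ler_distD x (complex.Re z) t; rewrite /s; lra.
have := jensen (t := t%:C) (s := s) (S := S) fE uL (fun z _ => fD z) near _ MB.
rewrite s0 sS => /(_ isT); set n := (\sum_(z <- L) D z)%N => J.
have r0 : 0 < S / s by rewrite divr_gt0 // (lt_trans s0).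
have rn : 0 < (S / s) ^+ n by rewrite exprn_gt0.
have M0 : 0 < M by apply: lt_le_trans J; rewrite mulr_gt0.
have lJ : ln (S / s) *+ n + ln (cmod (f t%:C)) <= ln M.
  rewrite -lnXn // -lnM ?posrE // ler_ln ?posrE //; exact: mulr_gt0.
have S0 : 0 < S := lt_trans s0 sS.
have lS : S^-1 <= ln (S / s).
  have := @le_ln1Dx R (s / S - 1) _; rewrite (addrC 1) subrK => h1.
  have : ln (s / S) <= s / S - 1 by apply: h1; rewrite ltrBrDr addNr divr_gt0.
  rewrite -[S / s]invf_div lnV ?posrE ?divr_gt0 //.
  have -> : s / S = 1 - S^-1 by rewrite /s /S; field; rewrite gt_eqF.
  lra.
have nS : S^-1 * n%:R <= ln M + (E + 1).
  apply: (@le_trans _ _ (ln (S / s) *+ n)); last lra.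
  by rewrite -[leRHS]mulr_natr ler_wpM2r.
have n_le : n%:R <= S * (ln M + (E + 1)).
  by rewrite -ler_pdivrMl.
apply: (le_trans n_le); rewrite -mulrA ler_pM2l //.
have : ln M <= Num.max 0 (ln M) by rewrite le_max lexx orbT.
have : 0 <= Num.max 0 (ln M) by rewrite le_max lexx.
set l := Num.max _ _ => l0 lM; nra.
Qed.

(** The interval of half-width r is covered by at most r + 1 pieces of length 2 with centres within
    r + 1 of x. Subadditivity of the p-th power separates x from r. *)
Lemma box_cover (D : divisor R) (B p b x r h : R) :
  0 <= B -> 0 < p -> p <= 1 -> 0 <= b -> 0 < r ->
  (forall x (L : seq C), uniq L -> (forall z, z \in L -> inbox x 1 h z) ->
     (\sum_(z <- L) D z)%N%:R <= B * expR (b * `|x| `^ p)) ->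
  forall L : seq C, uniq L -> (forall z, z \in L -> inbox x r h z) ->
     (\sum_(z <- L) D z)%N%:R <= (r + 1) * (B * expR (b * (`|x| `^ p + (r + 1) `^ p))).
Proof.
move=> B0 p0 p1 b0 r0 H L uL HL.
pose k (z : C) := Num.truncn ((complex.Re z - x + r) / 2).
pose K := Num.truncn r.
have kb z : z \in L -> (k z < K.+1)%N.
  move=> /HL[]; rewrite ler_norml => /andP[h1 h2] _.
  rewrite ltnS /k /K; apply: le_truncn; lra.
rewrite (@partition_big _ _ _ _ _ _ xpredT (fun z => inord (k z) : 'I_K.+1) xpredT) //=.
rewrite natr_sum; apply: (@le_trans _ _ (\sum_(j < K.+1) (B * expR (b * (`|x| `^ p + (r + 1) `^ p))))).
  apply: ler_sum => j _; rewrite -big_filter.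
  set xj := x - r + 2 * j%:R + 1.
  have jr : j%:R <= r :> R.
    apply: (@le_trans _ _ K%:R); first by rewrite ler_nat -ltnS.
    by have /andP[] := truncn_itv (ltW r0).
  apply: (le_trans (H xj _ _ _)); first exact: filter_uniq.
    move=> z; rewrite mem_filter => /andP[/eqP kj zL]; have [zx zh] := HL z zL; split=> //.
    have {}kj : k z = j by rewrite -kj inordK // kb.
    move: zx; rewrite ler_norml => /andP[h1 h2].
    have z0 : 0 <= (complex.Re z - x + r) / 2 by lra.
    have /andP[] := truncn_itv z0; rewrite -/(k z) kj -[j.+1%:R]natr1 => h3 h4.
    rewrite ler_norml /xj; lra.
  rewrite ler_wpM2l // ler_expR ler_wpM2l //.
  apply: le_trans (powR_subadd _ _ _ _) => //; last lra.
  apply: powR_le; rewrite ?(ltW p0) //.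
  rewrite (_ : xj = x + (xj - x)); last by ring.
  apply: (le_trans (ler_normD _ _)); rewrite lerD2l ler_norml /xj.
  have := ler0n R j; lra.
rewrite sumr_const card_ord -[leLHS]mulr_natl ler_wpM2r ?mulr_ge0 ?expR_ge0 //.
by rewrite -[K.+1%:R]natr1 lerD2r; have /andP[] := truncn_itv (ltW r0).
Qed.

Theorem necessity (D : divisor R) (rho sigma : R) (f : C -> C) : 1 < rho -> 0 <= sigma ->
  growth_class_star rho sigma f -> zero_divisor f D ->
  exists (eps K : R) (s : R -> R),
     [/\ 0 < eps < rho, 0 < K, s t @[t --> +oo%R] --> sigma &
       forall x r h : R, 0 < r -> 0 < h ->
         (lne (n_ D x r h) <=
          (K + r + s h * h `^ rho
             + K * `|x| `^ ((rho - eps) / (1 + rho - eps)))%R%:E)%E].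
Proof.
move=> rho1 sig0 [[fE Mfin Mlim] [eps [a [b [/andP[eps0 epsr] a0 b0 flow]]]]] [_ fD].
set p := (rho - eps) / (1 + rho - eps).
have d0 : 0 < 1 + rho - eps by lra.
have p0 : 0 < p by rewrite divr_gt0 //; lra.
have p1 : p < 1 by rewrite ltr_pdivrMr //; lra.
pose l (S : R) := Num.max 0 (ln (fine (M_ f S))).
have l0 S : 0 <= l S by rewrite le_max lexx.
pose B (h : R) := (h + a + 3) * (l (h + a + 3) + 2).
have B1 h : 0 < h -> 1 <= B h.
  move=> h0; have := l0 (h + a + 3); rewrite /B; nra.
have unit_box h x (L : seq C) : 0 < h -> uniq L -> (forall z, z \in L -> inbox x 1 h z) ->
     (\sum_(z <- L) D z)%N%:R <= B h * expR (b * `|x| `^ p).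
  move=> h0 uL HL; apply: (@zeros_unit_box f D a x h) => //.
  - by rewrite -expR0 ler_expR mulr_ge0 ?powR_ge0 // ltW.
  - by apply: Mfin; lra.
(* The coefficient of r has to be exactly 1: b (r + 1)^p and ln (r + 1) <= 2 (r + 1)^(1/2) are each
   at most (r + 1) / 2 plus a constant. *)
have [C1 C10 HC1] := @powR_dominated R p 1 b (1 / 2) p0 p1 (ltW b0) (divr_gt0 ltr01 (ltr0Sn _ 1)).
have h2 : 0 < 1 / 2 :> R by lra.
have h21 : 1 / 2 < 1 :> R by lra.
have [C2 C20 HC2] := @powR_dominated R (1 / 2) 1 2 (1 / 2) h2 h21 (ler0n _ _) h2.
pose K := C1 + C2 + 1 + b.
(* The growth of f only gives a limsup of at most sigma; the maximum makes [s] converge to sigma. *)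
pose s h := Num.max sigma (ln (B h) / h `^ rho).
exists eps, K, s; split; first by rewrite eps0.
- by rewrite /K; lra.
- apply/cvgrPdist_le => e e0; apply: pinfty_evt.
  have e4 : 0 < e / 4 by lra.
  have rho0 : 0 < rho by lra.
  have c0 : 0 <= a + 3 by lra.
  (* Chosen so that multiplying sigma + e / 4 by one plus this number gives sigma + e / 2. *)
  have d1 : 0 < e / 4 / (sigma + e / 4) by rewrite divr_gt0 // ltr_wpDl.
  have := evt_and (evt_and (evt_shift c0 (limf_esup_evt e4 Mlim)) (evt_powR_shift rho0 c0 d1))
    (evt_ln_small rho0 (ltr0Sn _ 2 : 0 < 3) c0 e4).
  apply: evt_mono => h h0 [[hM hS] hL].
  have S0 : 0 < h + (a + 3) by rewrite !addr_gt0.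
  have hr : 0 < h `^ rho by rewrite powR_gt0.
  have sle : ln (B h) <= (sigma + e) * h `^ rho.
    pose E := expR ((sigma + e / 4) * (h + (a + 3)) `^ rho).
    have E0 : 0 < E by exact: expR_gt0.
    have E1 : 1 <= E by rewrite -[X in X <= _]expR0 ler_expR mulr_ge0 ?powR_ge0 // addr_ge0 // ltW.
    have lE : l (h + (a + 3)) <= E.
      rewrite /l ge_max (le_trans ler01 E1) /=.
      have Sr : 0 < (h + (a + 3)) `^ rho by rewrite powR_gt0.
      have Mf : M_ f (h + (a + 3)) \is a fin_num.
        rewrite fin_numElt Mfin // andbT; apply: lt_le_trans (M_ge f (z := 0) _).
          by rewrite ltNyr.
        by rewrite normr0 ltW.
      move: hM; rewrite -(fineK Mf) lee_pdivrMr //.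
      set M := fine _; have [M0|M0] := leP M 0; first by rewrite ln0 // (le_trans ler01).
      rewrite lne_EFin //; have [L0|L0] := leP (ln M) 0; first by rewrite (le_trans L0) // (le_trans ler01).
      rewrite lne_EFin // -EFinM lee_fin => hM; rewrite -[leLHS](@lnK R) ?posrE // ler_expR.
      exact: hM.
    have BE : B h <= 3 * (h + (a + 3)) * E.
      rewrite /B -addrA [3 * _]mulrC -mulrA ler_pM2l //; lra.
    have B0 : 0 < B h by apply: lt_le_trans (B1 h h0).
    apply: (@le_trans _ _ (ln (3 * (h + (a + 3)) * E))).
      have P0 : 0 < 3 * (h + (a + 3)) by rewrite mulr_gt0.
      by rewrite ler_ln ?posrE //; exact: mulr_gt0.
    rewrite lnM ?posrE ?mulr_gt0 //.
    rewrite /E expRK.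
    have se : 0 < sigma + e / 4 by rewrite ltr_wpDl.
    have key : (sigma + e / 4) * (h + (a + 3)) `^ rho <= (sigma + e / 4 + e / 4) * h `^ rho.
      apply: (le_trans (ler_wpM2l (ltW se) hS)); rewrite mulrA.
      rewrite (_ : (sigma + e / 4) * (1 + e / 4 / (sigma + e / 4)) = sigma + e / 4 + e / 4) //.
      by rewrite mulrDr mulr1 [_ * (_ / _ / _)]mulrC divfK // gt_eqF.
    apply: (le_trans (lerD hL key)); rewrite -mulrDl ler_pM2r //; lra.
  rewrite distrC ger0_norm ?subr_ge0 ?le_max ?lexx // lerBlDr ge_max.
  by rewrite lerDr (ltW e0) ler_pdivrMr // addrC.
move=> x r h r0 h0.
have B0 : 0 < B h by apply: lt_le_trans (B1 h h0).
have p1' := ltW p1.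
have HB := @box_cover D (B h) p b x r h (ltW B0) p0 p1' (ltW b0) r0
  (fun x L => unit_box h x L h0).
have /(le_trans _) := n_le_seq HB.
set N := (r + 1) * _ => HN.
have r1 : 0 < r + 1 by rewrite addr_gt0.
have N0 : 0 < N by rewrite /N; apply: mulr_gt0 => //; apply: mulr_gt0 => //; exact: expR_gt0.
have {}HN : (n_ D x r h <= N%:E)%E by apply: HN.
have n0 : (0 <= n_ D x r h)%E by apply: esum_ge0 => z _; rewrite lee_fin.
apply: (@le_trans _ _ (lne N%:E)).
  by rewrite lee_lne // in_itv /= ?leey ?andbT // lee_fin ltW.
rewrite lne_EFin // lee_fin /N lnM ?posrE //; last by apply: mulr_gt0 => //; exact: expR_gt0.
rewrite lnM ?posrE ?expR_gt0 // expRK.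
have k1 : ln (B h) <= s h * h `^ rho.
  rewrite -ler_pdivrMr ?powR_gt0 // /s le_max lexx orbT //.
have k2 := ln_powR_le h2 r1.
have := HC1 (r + 1) (ltW r1); have := HC2 (r + 1) (ltW r1); rewrite powRr1 ?(ltW r1) // => k3 k4.
have k5 : 0 <= `|x| `^ p := powR_ge0 _ _.
rewrite /K; nra.
Qed.

End Necessity.

(** * Elementary factors *)

Section LogDerivative.
Variable R : realType.
Local Notation C := R[i].

(* z = w e^u for some |u| <= g, up to the inequalities that will be needed. *)
Definition logclose (g : R) (z w : C) :=
  [/\ cmod z <= expR g * cmod w, cmod w <= expR g * cmod z,
      cmod (z - w) <= (expR g - 1) * cmod w & cmod (z - w) <= (expR g - 1) * cmod z].

Lemma logclose_sym g z w : logclose g z w -> logclose g w z.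
Proof. by move=> [h1 h2 h3 h4]; split=> //; rewrite cmodBC. Qed.

Lemma logclose_le g g' z w : g <= g' -> logclose g z w -> logclose g' z w.
Proof.
move=> gg [h1 h2 h3 h4]; have e : expR g <= expR g' by rewrite ler_expR.
split.
- by apply: (le_trans h1); rewrite ler_wpM2r ?cmod_ge0.
- by apply: (le_trans h2); rewrite ler_wpM2r ?cmod_ge0.
- by apply: (le_trans h3); rewrite ler_wpM2r ?cmod_ge0 // lerB.
- by apply: (le_trans h4); rewrite ler_wpM2r ?cmod_ge0 // lerB.
Qed.

Lemma logclose_trans g1 g2 z w v : 0 <= g1 -> 0 <= g2 -> logclose g1 z w -> logclose g2 w v ->
  logclose (g1 + g2) z v.
Proof.
move=> g10 g20 [h1 h2 h3 h4] [k1 k2 k3 k4]; rewrite /logclose expRD.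
have e1 : 1 <= expR g1 by rewrite -expR0 ler_expR.
have e2 : 1 <= expR g2 by rewrite -expR0 ler_expR.
have t : cmod (z - v) <= cmod (z - w) + cmod (w - v).
  by have := cmodD (z - w) (w - v); rewrite addrA subrK.
move: e1 e2 h1 h2 h3 h4 k1 k2 k3 k4 t; move: (expR g1) (expR g2) => a b.
move: (cmod_ge0 z) (cmod_ge0 w) (cmod_ge0 v); move: (cmod (z - w)) (cmod (w - v)) (cmod (z - v)).
move: (cmod z) (cmod w) (cmod v) => x y u d1 d2 d3 x0 y0 u0 e1 e2 h1 h2 h3 h4 k1 k2 k3 k4 t.
have a0 : 0 <= a by lra. have b0 : 0 <= b by lra.
split.
- by apply: (le_trans h1); rewrite -mulrA ler_wpM2l.
- apply: (le_trans k2); have : b * y <= b * (a * x) by rewrite ler_wpM2l.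
  lra.
- apply: (le_trans t); have : (a - 1) * y <= (a - 1) * (b * u) by rewrite ler_wpM2l // subr_ge0.
  lra.
- apply: (le_trans t); have : (b - 1) * y <= (b - 1) * (a * x) by rewrite ler_wpM2l // subr_ge0.
  lra.
Qed.

Lemma is_derive_expR_comp (G : R -> R) (G' k t : R) : is_derive t 1 G G' ->
  is_derive t 1 (fun t => expR (k * G t)) (expR (k * G t) * (k * G')).
Proof.
move=> dG; have := @is_derive1_comp R expR (fun t => k * G t) t _ _ (is_derive_expR _) (is_deriveZ k dG).
by [].
Qed.

Lemma rder_cmod2 (y : R -> C) (l : C) (t : R) : rder y t l ->
  is_derive t 1 (fun t => cmod (y t) ^+ 2)
    (2 * (complex.Re (y t) * complex.Re l + complex.Im (y t) * complex.Im l)).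
Proof.
move=> /rderP[dr di].
have := is_deriveD (is_deriveM dr dr) (is_deriveM di di).
rewrite (_ : (fun t => cmod (y t) ^+ 2) = (fun t => complex.Re (y t)) * (fun t => complex.Re (y t)) +
   (fun t => complex.Im (y t)) * (fun t => complex.Im (y t))).
  by move/is_derive_eq; apply; rewrite /GRing.scale /=; ring.
by apply/funext => u; rewrite cmod_sqr !expr2.
Qed.

(** The derivative of |y|^2 e^(kG) is 2 e^(kG) |y|^2 (k G' / 2 + Re c), which the bound on c makes
    nonnegative. *)
Lemma gronwall (y c : R -> C) (G G' : R -> R) (k a b : R) : a <= b -> k ^+ 2 = 4 ->
  (forall t : R, a <= t <= b -> rder y t (c t * y t)) ->
  (forall t : R, a <= t <= b -> is_derive t 1 G (G' t)) ->
  (forall t : R, a <= t <= b -> cmod (c t) <= k / 2 * G' t) ->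
  cmod (y a) ^+ 2 * expR (k * G a) <= cmod (y b) ^+ 2 * expR (k * G b).
Proof.
move=> ab k2 Hy HG Hc.
apply: (@is_derive_le R (fun t => cmod (y t) ^+ 2 * expR (k * G t)) (fun t =>
  cmod (y t) ^+ 2 * (expR (k * G t) * (k * G' t)) +
  expR (k * G t) * (2 * (complex.Re (y t) * complex.Re (c t * y t) + complex.Im (y t) * complex.Im (c t * y t)))) a b ab).
  move=> t tab.
  exact: is_deriveM (rder_cmod2 (Hy t tab)) (is_derive_expR_comp k (HG t tab)).
move=> t tab.
rewrite [leRHS](_ : _ = 2 * (expR (k * G t) * cmod (y t) ^+ 2) * (k / 2 * G' t + complex.Re (c t))).
  apply: mulr_ge0; first by apply: mulr_ge0 => //; apply: mulr_ge0; [exact: expR_ge0|exact: sqr_ge0].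
  have := Hc t tab; have := Re_le_cmod (- c t); rewrite cmodN cReN; lra.
by rewrite !cmod_sqr !ReImE; field.
Qed.

(** The two bounds on moduli are Gronwall's inequality forwards and, through t -> -t, backwards. The
    two bounds on differences follow from the mean value inequality, with multiples of e^(-G) and
    e^G as comparison functions. *)
Lemma log_derivative_bound (y c : R -> C) (G G' : R -> R) (a b : R) : a <= b ->
  (forall t : R, a <= t <= b -> rder y t (c t * y t)) ->
  (forall t : R, a <= t <= b -> is_derive t 1 G (G' t)) ->
  (forall t : R, a <= t <= b -> cmod (c t) <= G' t) ->
  logclose (G b - G a) (y a) (y b).
Proof.
move=> ab Hy HG Hc.
have up (u v : R) : a <= u -> u <= v -> v <= b -> cmod (y u) <= expR (G v - G u) * cmod (y v).
  move=> au uv vb.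
  have sub (t : R) : u <= t <= v -> a <= t <= b.
    by move=> /andP[h1 h2]; rewrite (le_trans au h1) (le_trans h2 vb).
  have := @gronwall y c G G' 2 u v uv _ (fun t h => Hy t (sub t h)) (fun t h => HG t (sub t h)).
  have e4 : 2 ^+ 2 = 4 :> R by rewrite expr2; ring.
  move=> /(_ e4) H; rewrite -(@ler_pXn2r _ 2) ?nnegrE ?mulr_ge0 ?expR_ge0 ?cmod_ge0 //.
  rewrite exprMn -expRM_natl mulrC.
  have {}H : cmod (y u) ^+ 2 * expR (2 * G u) <= cmod (y v) ^+ 2 * expR (2 * G v).
    by apply: H => t h; rewrite divff ?mul1r ?pnatr_eq0 //; exact: Hc (sub t h).
  by rewrite mulrBr expRB mulrA ler_pdivlMr ?expR_gt0.
have dn (u v : R) : a <= u -> u <= v -> v <= b -> cmod (y v) <= expR (G v - G u) * cmod (y u).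
  move=> au uv vb.
  have sub (t : R) : - v <= t <= - u -> a <= - t <= b.
    by move=> /andP[h1 h2]; apply/andP; split; lra.
  have Hy' (t : R) : - v <= t <= - u -> rder (fun t => y (- t)) t (- c (- t) * y (- t)).
    move=> tuv; have := Hy _ (sub t tuv); rewrite mulNr => H e e0.
    have [d d0 D] := H e e0; exists d => // w; rewrite -cmodN -rmorphN => /D.
    by rewrite opprD !rmorphN mulrN mulNr cmodN.
  have HG' (t : R) : - v <= t <= - u -> is_derive t 1 (fun t => - G (- t)) (G' (- t)).
    move=> tuv; have h := is_deriveN (is_derive_id t (1 : R)).
    have := is_deriveN (@is_derive1_comp R G (fun t => - t) t _ _ (HG _ (sub t tuv)) h).
    by rewrite mulrN mulr1 opprK.
  have := @gronwall (fun t => y (- t)) (fun t => - c (- t)) (fun t => - G (- t)) (fun t => G' (- t)) 2 (- v) (- u).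
  rewrite lerN2 => /(_ uv); rewrite !opprK.
  have e4 : 2 ^+ 2 = 4 :> R by rewrite expr2; ring.
  move=> /(_ e4 Hy' HG') H; rewrite -(@ler_pXn2r _ 2) ?nnegrE ?mulr_ge0 ?expR_ge0 ?cmod_ge0 //.
  rewrite exprMn -expRM_natl mulrC.
  have {}H : cmod (y v) ^+ 2 * expR (2 * - G v) <= cmod (y u) ^+ 2 * expR (2 * - G u).
    by apply: H => t h; rewrite divff ?mul1r ?pnatr_eq0 // cmodN; exact: Hc (sub t h).
  move: H; rewrite !mulrN !expRN ler_pdivrMr ?expR_gt0 // mulrBr expRB => H.
  by apply: (le_trans H); rewrite mulrAC mulrA.
have G'0 t : a <= t <= b -> 0 <= G' t by move=> /Hc; apply: le_trans; exact: cmod_ge0.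
have dexp (k m t : R) : a <= t <= b ->
    is_derive t 1 (fun t => m * expR (k * G t)) (m * (expR (k * G t) * (k * G' t))).
  by move=> tab; have := is_deriveZ m (is_derive_expR_comp k (HG t tab)).
split.
- exact: up.
- exact: dn.
- rewrite cmodBC.
  have := @rder_mvt R y (fun t => c t * y t)
    (fun t => (- (expR (G b) * cmod (y b))) * expR (-1 * G t))
    (fun t => (- (expR (G b) * cmod (y b))) * (expR (-1 * G t) * (-1 * G' t))) a b ab Hy (dexp _ _).
  move=> H; apply: (le_trans (H _)).
    move=> t /[dup] tab /andP[ta tb]; rewrite cmodM mulrC.
    rewrite [leRHS](_ : _ = (expR (G b - G t) * cmod (y b)) * G' t).
      by apply: ler_pM; rewrite ?cmod_ge0 ?Hc // up.
    by rewrite !mulN1r expRB expRN; field; rewrite gt_eqF ?expR_gt0.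
  rewrite le_eqVlt; apply/orP; left; apply/eqP; rewrite !mulN1r expRB !expRN; field.
  by rewrite !gt_eqF ?expR_gt0.
- rewrite cmodBC.
  have := @rder_mvt R y (fun t => c t * y t)
    (fun t => (expR (- G a) * cmod (y a)) * expR (1 * G t))
    (fun t => (expR (- G a) * cmod (y a)) * (expR (1 * G t) * (1 * G' t))) a b ab Hy (dexp _ _).
  move=> H; apply: (le_trans (H _)).
    move=> t /[dup] tab /andP[ta tb]; rewrite cmodM mulrC.
    rewrite [leRHS](_ : _ = (expR (G t - G a) * cmod (y a)) * G' t).
      by apply: ler_pM; rewrite ?cmod_ge0 ?Hc // dn.
    by rewrite !mul1r expRB expRN; field; rewrite gt_eqF ?expR_gt0.
  rewrite le_eqVlt; apply/orP; left; apply/eqP; rewrite !mul1r expRB !expRN; field.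
  by rewrite !gt_eqF ?expR_gt0.
Qed.

End LogDerivative.

Section ElementaryFactor.
Variable R : realType.
Local Notation C := R[i].
Implicit Types (T u S : R) (N : nat) (s : C).

Lemma cexp_sub1 s : 0 <= complex.Re s -> cmod (1 - cexp (- s)) <= cmod s.
Proof.
move=> s0; have d w : cdiff (fun w : C => cexp (- w)) w (- cexp (- w)).
  have := gder_comp (g := fun w : C => - w) (@cdiff_cexp R (- w)) (_ : gder id _ w (- 1)).
  rewrite mulrN1; apply.
  have := gderB (@gder_cst _ _ id 0 w) (@cdiff_id R w); rewrite sub0r.
  by apply: gder_ext => v; rewrite sub0r.
have := @cmod_mvt R _ _ 0 s 1 d; rewrite add0r oppr0 cexp0 mul1r cmodBC; apply.
move=> t /andP[t0 t1]; rewrite cmodN cmod_cexp add0r -expR0 ler_expR.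
by rewrite !ReImE mul0r subr0 oppr_le0 mulr_ge0.
Qed.

(** E(s) = (1 - e^(-s)) / s, the Laplace transform of the uniform density on [0, 1]. The last
    identity transports the bounds from the right half-plane to the left one. *)
Lemma sinc_exists : exists E : C -> C, [/\ entire E, E 0 = 1,
  forall s, 0 <= complex.Re s -> cmod (E s) <= 1,
  forall s, 0 <= complex.Re s -> s != 0 -> cmod (E s) <= 2 / cmod s &
  forall s, E s = cexp (- s) * E (- s)].
Proof.
have fE : entire (fun s : C => 1 - cexp (- s)).
  exact (entireB (@entire_cst R 1) (entire_comp (@entire_cexp R) (entireN (@entire_id R)))).
have [E EE HE] := entire_division 0 fE.
have {}HE s : 1 - cexp (- s) = s * E s.
  by rewrite HE oppr0 cexp0 subrr add0r addr0.
have Ed s : s != 0 -> E s = (1 - cexp (- s)) / s by move=> s0; rewrite HE mulrC mulKf.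
have E0 : E 0 = 1.
  have d1 : cdiff (fun s : C => 1 - cexp (- s)) 0 1.
    have d0 : gder id (fun w : C => - w) 0 (-1).
      have := gderB (@gder_cst _ _ id 0 0) (@cdiff_id R 0); rewrite sub0r.
      by apply: gder_ext => v; rewrite sub0r.
    have := gder_comp (g := fun w : C => - w) (@cdiff_cexp R (- 0)) d0.
    move/(gderB (@gder_cst _ _ id 1 0)); apply: gder_eq.
    by rewrite oppr0 cexp0 mul1r opprK add0r.
  have [l El] := (entireP E).1 EE 0.
  have := gderM (@cdiff_id R 0) El; rewrite mul0r addr0 mul1r => d2.
  apply: cdiff_uniq d2 _; apply: gder_ext d1 => w; exact: HE.
have b1 s : 0 <= complex.Re s -> cmod (E s) <= 1.
  move=> s0; have [->|sn] := eqVneq s 0; first by rewrite E0 cmod1.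
  by rewrite Ed // cmodM cmodV ler_pdivrMr ?cmod_gt0 // mul1r cexp_sub1.
exists E; split=> //.
- move=> s s0 sn; rewrite Ed // cmodM cmodV ler_wpM2r ?invr_ge0 ?cmod_ge0 //.
  apply: (le_trans (cmodB _ _)); rewrite cmod1 cmod_cexp cReN.
  have : expR (- complex.Re s) <= 1 by rewrite -expR0 ler_expR oppr_le0.
  lra.
- move=> s; have [->|sn] := eqVneq s 0; first by rewrite oppr0 cexp0 mul1r.
  rewrite Ed // Ed ?oppr_eq0 // opprK !cexpN; have := cexp_neq0 s.
  by move: (cexp s) => e e0; field; rewrite e0 sn.
Qed.

(** The N-th power of min(1, 2N / u): it bounds |E(s / N)|^N for |s| = u in the right half-plane, E
    being the function of [sinc_exists]. For u >= 2 e N it is at most e^(-N), which is why N will be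
    chosen according to |Re a|. *)
Definition kappa N u : R := (N.*2%:R / Num.max N.*2%:R u) ^+ N.

Section Kappa.
Variable N : nat.
Hypothesis N0 : (0 < N)%N.

Lemma kappa_base u : 0 < Num.max (N.*2%:R : R) u.
Proof. by rewrite lt_max ltr0n double_gt0 N0. Qed.

Lemma kappa_frac u : 0 <= N.*2%:R / Num.max (N.*2%:R : R) u <= 1.
Proof.
by rewrite divr_ge0 ?(ltW (kappa_base u)) //= ler_pdivrMr ?kappa_base // mul1r le_max lexx.
Qed.

Lemma kappa_ge0 u : 0 <= kappa N u.
Proof. by have /andP[h _] := kappa_frac u; rewrite exprn_ge0. Qed.

Lemma kappa_le1 u : kappa N u <= 1.
Proof. by have /andP[h1 h2] := kappa_frac u; rewrite exprn_ile1. Qed.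

Lemma kappa_anti u v : u <= v -> kappa N v <= kappa N u.
Proof.
move=> uv; apply: lerXn2r; rewrite ?nnegrE; try by have /andP[] := kappa_frac u.
  by have /andP[] := kappa_frac v.
rewrite ler_wpM2l // lef_pV2 ?posrE ?kappa_base //.
by rewrite ge_max !le_max lexx uv orbT.
Qed.

Lemma kappa_eq1 u : u <= N.*2%:R -> kappa N u = 1.
Proof.
move=> uN; rewrite /kappa max_l // divff ?expr1n //.
by rewrite pnatr_eq0 -lt0n double_gt0.
Qed.
End Kappa.

(* The kernel is the Laplace transform of a probability density supported in
   [T, T + 1], which makes it decay like [kappa] along horizontal lines. *)
Lemma kernel_exists T N : 1 <= T -> (0 < N)%N -> exists Q : C -> C, [/\ entire Q, Q 0 = 1 &
  forall s, cmod (Q s) <= kappa N (cmod s) * expR (- T * complex.Re s + Num.max 0 (- complex.Re s))].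
Proof.
move=> T1 N0; have [E [EE E0 Eb1 Eb2 Es]] := sinc_exists.
have NC : N%:R != 0 :> C by rewrite pnatr_eq0 -lt0n.
have NR : 0 < N%:R :> R by rewrite ltr0n.
(* In the left half-plane each of the N rescaled copies of [E] costs e^(-Re s / N), hence e^(-Re s)
   altogether: this is the [Num.max] of the bound. *)
exists (fun s => cexp ((- T)%:C * s) * E (s / N%:R) ^+ N); split.
- exact (entireM (entire_comp (@entire_cexp R) (@entireZ R ((- T)%:C) _ (@entire_id R)))
    (@entireX R _ N (entire_comp EE (entireM (@entire_id R) (@entire_cst R (N%:R^-1)))))).
- by rewrite mulr0 cexp0 mul0r E0 expr1n mulr1.
move=> s.
have NE : s / N%:R = s * (N%:R^-1)%:C by rewrite rmorphV ?unitfE ?gt_eqF // rmorph_nat.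
have reN : complex.Re (s / N%:R) = complex.Re s / N%:R.
  by rewrite NE !ReImE mulr0 subr0.
have cN : cmod (s / N%:R) = cmod s / N%:R.
  by rewrite NE cmodM cmodR ger0_norm // invr_ge0 ltW.
have Epos w : 0 <= complex.Re w -> cmod (E w) <= N.*2%:R / Num.max N.*2%:R (N%:R * cmod w).
  move=> w0; rewrite /Num.max; case: ltP => h.
    have wn : w != 0 by apply: contraTneq h => ->; rewrite cmod0 mulr0 -leNgt.
    apply: (le_trans (Eb2 _ w0 wn)); rewrite -muln2 natrM invfM mulrACA divff ?gt_eqF // mul1r //.
  by rewrite divff ?Eb1 // pnatr_eq0 -lt0n double_gt0.
have Eall : cmod (E (s / N%:R)) <= expR (Num.max 0 (- complex.Re s) / N%:R) *
     (N.*2%:R / Num.max N.*2%:R (cmod s)).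
  have cs : N%:R * cmod (s / N%:R) = cmod s by rewrite cN mulrC divfK // gt_eqF.
  have [s0|s0] := leP 0 (complex.Re s).
    rewrite max_l ?oppr_le0 // mul0r expR0 mul1r -[in X in _ <= X]cs; apply: Epos.
    by rewrite reN divr_ge0 // ltW.
  rewrite max_r ?oppr_ge0 ?(ltW s0) // Es cmodM cmod_cexp cReN reN -mulNr.
  rewrite ler_wpM2l ?expR_ge0 // -[in X in _ <= X]cs.
  have := Epos (- (s / N%:R)); rewrite cmodN; apply.
  by rewrite cReN reN oppr_ge0 mulr_le0_ge0 ?invr_ge0 ?(ltW NR) // ltW.
rewrite cmodM cmod_cexp cmodX expRD mulrC.
have -> : complex.Re ((- T)%:C * s) = - T * complex.Re s by rewrite !ReImE mul0r subr0.
rewrite [leRHS]mulrCA -[leLHS]mulrC ler_wpM2l ?expR_ge0 //.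
have h := lerXn2r N _ _ Eall; apply: (le_trans (h _ _)).
- by rewrite nnegrE cmod_ge0.
- by rewrite nnegrE mulr_ge0 ?expR_ge0 //; have /andP[] := kappa_frac N0 (cmod s).
by rewrite exprMn -expRM_natl mulrCA divff ?mulr1 ?gt_eqF // mulrC.
Qed.

Lemma expR_ge_id u : u <= expR u.
Proof. by have := expR_ge1Dx u; lra. Qed.

Lemma expRN_le u : 0 < u -> expR (- u) <= u^-1.
Proof. by move=> u0; rewrite expRN lef_pV2 ?posrE ?expR_gt0 // expR_ge_id. Qed.

Lemma logclose_div g (z w : C) : w != 0 -> logclose g z w -> logclose g (z / w) 1.
Proof.
move=> w0 [h1 h2 h3 h4]; have c0 : 0 < cmod w by rewrite cmod_gt0.
have E : z / w - 1 = (z - w) / w by field.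
split; rewrite ?E cmodM ?cmodV ?cmod1 ?mulr1.
- by rewrite ler_pdivrMr.
- by rewrite mulrA ler_pdivlMr // mul1r.
- by rewrite ler_pdivrMr.
- by rewrite cmodM cmodV mulrA ler_wpM2r // invr_ge0 ltW.
Qed.

(* The bound decays like [expR (- T * Re s)], up to shifting [Re s] by a
   constant, which the application can afford. *)
Definition factor_bound T N eps s : R :=
  4 * kappa N `|complex.Im s| *
  expR (- T * complex.Re s + `|complex.Re s| + 8 * T + 8) + eps.

(** y = s e^(-H) satisfies y' / y = Q / s, so it tends to a limit along rays going to the right, and
    this limit is common to all rays. Normalising by the value at a far real point S makes s g s
    close to 1 up to the integral of Q / s along a ray from s. Near the zero, where Q / s is not
    small, the maximum principle takes over. *)
Lemma factor_exists T N (eps : R) : 1 <= T -> (0 < N)%N -> 0 < eps ->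
  exists g : C -> C, [/\ entire g, forall s, g s != 0,
   forall s, 1 <= `|complex.Re s| \/ 1 <= `|complex.Im s| ->
     logclose (factor_bound T N eps s) (s * g s) 1 &
   forall s, `|complex.Re s| <= 1 -> `|complex.Im s| <= 1 ->
     cmod (s * g s) <= expR (factor_bound T N eps s) /\
     cmod s <= expR (factor_bound T N eps s) * cmod (s * g s)].
Proof.
move=> T1 N0 eps0; have [Q [QE Q0 QB]] := kernel_exists T1 N0.
have [h hE Hh] := entire_division 0 (entireB (@entire_cst R 1) QE).
have {}Hh s : 1 - Q s = s * h s by rewrite Hh Q0 subrr add0r subr0.
have [H HE HH] := entire_primitive hE.
pose y s := s * cexp (- H s).
have dy s : cdiff y s (cexp (- H s) * Q s).
  have d1 := gder_comp (g := fun w => - H w) (@cdiff_cexp R (- H s)) (_ : gder id _ s (- h s)).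
  have d2 : gder id (fun w => - H w) s (- h s).
    have := gder_lin (-1) (HH s); rewrite mulN1r; apply: gder_ext => w; exact: mulN1r.
  have := gderM (@cdiff_id R s) (d1 d2); apply: gder_eq.
  have -> : Q s = 1 - s * h s by rewrite -Hh; ring.
  by ring.
have y_neq0 s : s != 0 -> y s != 0 by move=> s0; rewrite mulf_neq0 // cexp_neq0.
have line (s d : C) t : s + t%:C * d != 0 ->
    rder (fun t => y (s + t%:C * d)) t ((Q (s + t%:C * d) / (s + t%:C * d) * d) * y (s + t%:C * d)).
  move=> p0; have := @rder_line R y s d t _ (dy _); apply: gder_eq; rewrite /y.
  by move: (s + t%:C * d) p0 => p p0; field.
(* The 4 is the product of |d| <= 2 and 1 / |s + t d| <= 2 on the rays used below. *)
pose B0 s := 4 * kappa N `|complex.Im s| * expR (- T * complex.Re s + Num.max 0 (- complex.Re s)).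
have B00 s : 0 <= B0 s by rewrite mulr_ge0 ?mulr_ge0 ?expR_ge0 ?kappa_ge0.
(* The ray goes to the right and away from the horizontal axis: the bound on [Q] decays like e^(-T
   t) from its value at s, and the ray keeps distance 1/2 from the zero. *)
have ray s (sg tau : R) : 1 <= `|complex.Re s| \/ 1 <= `|complex.Im s| ->
    `|sg| = 1 -> 0 <= sg * complex.Im s -> 0 <= tau ->
    logclose (B0 s) (y s) (y (s + tau%:C * (1 +i* sg))).
  move=> sout sg1 sgs tau0; set d := 1 +i* sg.
  have Rep t : complex.Re (s + t%:C * d) = complex.Re s + t by rewrite !ReImE; ring.
  have Imp t : complex.Im (s + t%:C * d) = complex.Im s + t * sg by rewrite !ReImE; ring.
  have aImp t : 0 <= t -> `|complex.Im (s + t%:C * d)| = `|complex.Im s| + t.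
    move=> t0; rewrite Imp -[LHS]mul1r -{1}sg1 -normrM mulrDr mulrCA.
    have -> : sg * sg = 1 by rewrite -expr2 -[LHS]real_normK ?num_real // sg1 expr1n.
    rewrite mulr1 ger0_norm ?addr_ge0 //; congr (_ + _).
    by rewrite -[RHS]mul1r -sg1 -normrM ger0_norm.
  have pbig t : 0 <= t -> 1 / 2 <= cmod (s + t%:C * d).
    move=> t0; have [i1|i1] := leP (1 / 2) (`|complex.Im s| + t).
      by apply: (le_trans i1); rewrite -aImp //; exact: normIm_le.
    apply: le_trans (normRe_le _); rewrite Rep.
    have := normr_ge0 (complex.Im s) => i0.
    have := ler_normB (complex.Re s + t) t; rewrite addrK (ger0_norm t0).
    by case: sout => h1; lra.
  have d2 : cmod d <= 2 by apply: (le_trans (cmod_leD _)); rewrite /= normr1 sg1; lra.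
  have p_neq0 t : 0 <= t -> s + t%:C * d != 0.
    by move=> t0; rewrite -cmod_gt0 (lt_le_trans _ (pbig t t0)) // divr_gt0.
  have T0 : 0 < T by lra.
  have := @log_derivative_bound R (fun t => y (s + t%:C * d))
    (fun t => Q (s + t%:C * d) / (s + t%:C * d) * d)
    (fun t => (- (B0 s / T)) * expR (- T * t)) (fun t => (- (B0 s / T)) * (expR (- T * t) * (- T * 1))) 0 tau tau0.
  rewrite mul0r addr0 => HL; apply: logclose_le (HL _ _ _).
  - rewrite mulr0 expR0 mulr1 opprK mulNr.
    have : 0 <= B0 s / T * expR (- T * tau) by exact: mulr_ge0 (divr_ge0 (B00 s) (ltW T0)) (expR_ge0 _).
    have : B0 s / T <= B0 s by rewrite ler_pdivrMr // ler_peMr.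
    lra.
  - by move=> t /andP[t0 _]; exact: line (p_neq0 t t0).
  - move=> t /andP[t0 _]; have p0 : 0 < cmod (s + t%:C * d) by rewrite cmod_gt0 p_neq0.
    rewrite !cmodM cmodV.
    have k1 : cmod (Q (s + t%:C * d)) <= kappa N `|complex.Im s| *
        expR (- T * complex.Re s + Num.max 0 (- complex.Re s) + - T * t).
      apply: (le_trans (QB _)); apply: ler_pM; rewrite ?kappa_ge0 ?expR_ge0 //.
        apply: kappa_anti => //; apply: le_trans (normIm_le _); rewrite aImp //; lra.
      rewrite ler_expR Rep.
      have : Num.max 0 (- (complex.Re s + t)) <= Num.max 0 (- complex.Re s).
        by rewrite ge_max !le_max lexx /= lerN2 lerDl t0 orbT.
      lra.
    have k2 : (cmod (s + t%:C * d))^-1 <= 2.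
      have h2 : 0 < 1 / 2 :> R by lra.
      rewrite -[leRHS](_ : (1 / 2)^-1 = 2); last by field.
      by rewrite lef_pV2 ?posrE // pbig.
    rewrite [leRHS](_ : _ = kappa N `|complex.Im s| *
        expR (- T * complex.Re s + Num.max 0 (- complex.Re s) + - T * t) * 2 * 2).
      apply: ler_pM; rewrite ?mulr_ge0 ?invr_ge0 ?cmod_ge0 //.
      by apply: ler_pM; rewrite ?invr_ge0 ?cmod_ge0.
    by rewrite /B0 [in RHS]expRD; field; rewrite gt_eqF.
pose e3 := eps / 3; have e30 : 0 < e3 by rewrite divr_gt0.
(* Then 4 e^(-T S) <= 4 / S <= [e3], which bounds the variation of y along the ray from [S]. *)
pose S := Num.max 1 (4 / e3).
have S1 : 1 <= S by rewrite le_max lexx.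
have S0 : 0 < S by lra.
have BS : B0 S%:C <= e3.
  rewrite /B0 !ReImE normr0 kappa_eq1 // mulr1 max_l; last by rewrite oppr_le0 ltW.
  rewrite addr0; apply: (@le_trans _ _ (4 * S^-1)).
    rewrite ler_wpM2l //; apply: le_trans (expRN_le S0); rewrite ler_expR mulNr lerN2.
    by rewrite ler_peMl // ltW.
  rewrite ler_pdivrMr // mulrC -ler_pdivrMr //.
  by rewrite /S le_max lexx orbT.
have yS : y S%:C != 0 by apply: y_neq0; rewrite -cmod_gt0 cmodR gtr0_norm.
have out s : 1 <= `|complex.Re s| \/ 1 <= `|complex.Im s| ->
    logclose (B0 s + eps) (y s) (y S%:C).
  move=> sout.
  have [sg [sg1 sgs]] : exists sg : R, `|sg| = 1 /\ 0 <= sg * complex.Im s.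
    have [i0|i0] := leP 0 (complex.Im s).
      by exists 1; rewrite normr1 mul1r.
    by exists (-1); rewrite normrN1 mulN1r oppr_ge0 ltW.
  pose L := cmod (S%:C - s); have L0 : 0 <= L by exact: cmod_ge0.
  (* The segment joining the two translated points lies in Re >= m, where |Q| <= e^(-m) <= 1 / m.
     Its length L therefore contributes at most L / m <= [e3]. *)
  pose m := L / e3 + 1; have m0 : 1 <= m by rewrite lerDr divr_ge0 // ltW.
  pose tau := m + `|complex.Re s|.
  have tau0 : 0 <= tau by rewrite addr_ge0 //; lra.
  set d := 1 +i* sg.
  have Rp t : 0 <= t <= 1 -> m <= complex.Re (s + tau%:C * d + t%:C * (S%:C - s)).
    move=> /andP[t0 t1].
    have -> : complex.Re (s + tau%:C * d + t%:C * (S%:C - s)) =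
        (1 - t) * complex.Re s + t * S + tau by rewrite !ReImE; ring.
    have r1 : - `|complex.Re s| <= complex.Re s by rewrite lerNl -normrN ler_norm.
    have r2 : (1 - t) * (- `|complex.Re s|) <= (1 - t) * complex.Re s.
      by rewrite ler_wpM2l // subr_ge0.
    have r3 : 0 <= t * S by rewrite mulr_ge0 // ltW.
    have r4 : 0 <= t * `|complex.Re s| by rewrite mulr_ge0.
    rewrite /tau; lra.
  have pbig t : 0 <= t <= 1 -> 1 <= cmod (s + tau%:C * d + t%:C * (S%:C - s)).
    by move=> /Rp h1; apply: (le_trans (le_trans m0 h1)); exact: Re_le_cmod.
  have far : logclose e3 (y (s + tau%:C * d)) (y (S%:C + tau%:C * d)).
    have := @log_derivative_bound R (fun t => y (s + tau%:C * d + t%:C * (S%:C - s)))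
      (fun t => Q (s + tau%:C * d + t%:C * (S%:C - s)) / (s + tau%:C * d + t%:C * (S%:C - s)) * (S%:C - s))
      (fun t => e3 * t) (fun=> e3) 0 1 ler01.
    rewrite mul0r addr0 mul1r mulr1 mulr0 subr0 (_ : s + _ + _ = S%:C + tau%:C * d); last by ring.
    apply.
    - move=> t t01; apply: line; rewrite -cmod_gt0; exact: lt_le_trans (pbig t t01).
    - by move=> t _; have := is_deriveZ e3 (is_derive_id t (1 : R)); rewrite /GRing.scale /= mulr1.
    - move=> t t01; rewrite !cmodM cmodV -/L.
      have q1 : cmod (Q (s + tau%:C * d + t%:C * (S%:C - s))) <= expR (- m).
        apply: (le_trans (QB _)); rewrite -[leRHS]mul1r; apply: ler_pM; rewrite ?kappa_ge0 ?kappa_le1 ?expR_ge0 //.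
        have h1 := Rp t t01; rewrite ler_expR max_l ?addr0 ?mulNr ?lerN2 ?oppr_le0; last by lra.
        apply: (le_trans h1); rewrite ler_peMl //; lra.
      have q2 : cmod (Q (s + tau%:C * d + t%:C * (S%:C - s))) / cmod (s + tau%:C * d + t%:C * (S%:C - s)) <= expR (- m).
        have p1 := pbig t t01; rewrite ler_pdivrMr; last by lra.
        by apply: (le_trans q1); rewrite ler_peMr ?expR_ge0.
      apply: (le_trans (ler_wpM2r L0 q2)).
      have m00 : 0 < m by lra.
      apply: (le_trans (ler_wpM2r L0 (expRN_le m00))).
      rewrite mulrC ler_pdivrMr // mulrC -ler_pdivrMr // /m; lra.
  have r1 := ray s sg tau sout sg1 sgs tau0.
  have r2 : logclose (B0 S%:C) (y S%:C) (y (S%:C + tau%:C * d)).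
    apply: ray => //; first by left; rewrite !ReImE gtr0_norm.
    by rewrite !ReImE mulr0.
  have := logclose_trans (B00 s) (ltW e30) r1 far.
  move=> /logclose_trans /(_ (logclose_sym r2)); move=> /(_ (addr_ge0 (B00 s) (ltW e30)) (B00 _)).
  apply: logclose_le; move: BS; rewrite /e3; lra.
exists (fun s => cexp (- H s) / y S%:C).
have ygE s : s * (cexp (- H s) / y S%:C) = y s / y S%:C by rewrite mulrA.
have B0F s : B0 s + eps <= factor_bound T N eps s.
  rewrite lerD2r ler_wpM2l ?mulr_ge0 ?kappa_ge0 // ler_expR.
  have : Num.max 0 (- complex.Re s) <= `|complex.Re s|.
    by rewrite ge_max normr_ge0 -normrN ler_norm.
  lra.
have outer s : 1 <= `|complex.Re s| \/ 1 <= `|complex.Im s| ->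
     logclose (B0 s + eps) (y s / y S%:C) 1.
  by move=> /out; exact: logclose_div.
split.
- exact (entireM (entire_comp (@entire_cexp R) (entireN HE)) (@entire_cst R ((y S%:C)^-1))).
- by move=> s; rewrite mulf_neq0 ?invr_neq0 ?cexp_neq0.
- by move=> s sout; rewrite ygE; apply: logclose_le (B0F s) (outer s sout).
move=> s s1 s2; rewrite ygE.
(* A circle of radius 5 about a point of the closed unit box stays in the region of the outer
   estimate, since 5 > 2 + 2. *)
have five : 0 < 5 :> R by [].
have vout (w : C) : cmod w = 5 -> 1 <= `|complex.Re (s + w)| \/ 1 <= `|complex.Im (s + w)|.
  move=> w5; have [h1|h1] := leP 1 `|complex.Re (s + w)|; first by left.
  have [h2|h2] := leP 1 `|complex.Im (s + w)|; first by right.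
  have := cmod_leD w; rewrite w5 cReD cImD in h1 h2 *.
  have := ler_normB (complex.Re s + complex.Re w) (complex.Re s).
  have := ler_normB (complex.Im s + complex.Im w) (complex.Im s).
  rewrite ![_ + _ - _]addrAC !subrr !add0r; lra.
pose b := 4 * expR (6 * T + 6) + eps.
have vb (w : C) : cmod w = 5 -> logclose b (y (s + w) / y S%:C) 1.
  move=> w5; apply: logclose_le (outer _ (vout w w5)); rewrite lerD2r /B0 -mulrA ler_wpM2l //.
  rewrite -[leRHS]mul1r; apply: ler_pM; rewrite ?kappa_ge0 ?kappa_le1 ?expR_ge0 // ler_expR.
  have r6 : `|complex.Re (s + w)| <= 6.
    rewrite cReD (le_trans (ler_normD _ _)) //; have := normRe_le w; lra.
  move: r6; rewrite ler_norml => /andP[r6 r6'].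
  have r7 : Num.max 0 (- complex.Re (s + w)) <= 6 by rewrite ge_max; lra.
  have r8 : - T * complex.Re (s + w) <= T * 6.
    by rewrite mulNr -mulrN ler_wpM2l //; lra.
  lra.
have bF : 7 + b <= factor_bound T N eps s.
  rewrite addrA lerD2r (kappa_eq1 N0) ?mulr1; last first.
    by apply: (le_trans s2); rewrite ler1n double_gt0.
  apply: (@le_trans _ _ (4 * expR (7 * T + 7))).
    rewrite (_ : 7 * T + 7 = (T + 1) + (6 * T + 6)); last by ring.
    rewrite expRD.
    have : 2 <= expR (T + 1) by have := expR_ge1Dx (T + 1); lra.
    have : 7 <= expR (6 * T + 6) by have := expR_ge1Dx (6 * T + 6); lra.
    nra.
  rewrite ler_wpM2l // ler_expR.
  have : - T * complex.Re s >= - T.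
    move: s1; rewrite ler_norml => /andP[r6 r6'].
    rewrite mulNr lerN2 -[leRHS]mulr1 ler_wpM2l //; lra.
  have := normr_ge0 (complex.Re s); lra.
split.
  apply: (@max_modulus R (fun s => y s / y S%:C) s 5 _ five).
    exact (entireM (entireM (@entire_id R) (entire_comp (@entire_cexp R) (entireN HE))) (@entire_cst R ((y S%:C)^-1))).
  move=> w /vb[]; rewrite cmod1 mulr1 => h1 _ _ _; apply: (le_trans h1).
  rewrite ler_expR; lra.
(* The reverse bound is the maximum principle for e^H y(S), the entire continuation of s / (y(s) /
   y(S)). The 7 in [bF] pays for |s + w| <= 7 <= e^7. *)
have k1 : cmod (cexp (H s) * y S%:C) <= expR (factor_bound T N eps s).
  apply: (@max_modulus R (fun s => cexp (H s) * y S%:C) s 5 _ five).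
    exact (entireM (entire_comp (@entire_cexp R) HE) (@entire_cst R (y S%:C))).
  move=> w w5; have [_ h1 _ _] := vb w w5; rewrite cmod1 in h1.
  have E : (cexp (H (s + w)) * y S%:C) * (y (s + w) / y S%:C) = s + w.
    move: (y S%:C) yS => q q0; rewrite /y cexpN; move: (cexp _) (cexp_neq0 (H (s + w))) => p p0.
    by field; rewrite p0 q0.
  have s7 : cmod (s + w) <= 7.
    apply: (le_trans (cmodD _ _)); rewrite w5; have := cmod_leD s; lra.
  apply: (@le_trans _ _ (7 * expR b)).
    rewrite -[leLHS]mulr1; apply: (le_trans (ler_wpM2l (cmod_ge0 _) h1)).
    rewrite mulrCA -cmodM E mulrC ler_wpM2r ?expR_ge0 //.
  apply: (@le_trans _ _ (expR (7 + b))); last by rewrite ler_expR.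
  by rewrite (expRD 7 b) ler_wpM2r ?expR_ge0 ?expR_ge_id.
have E : (cexp (H s) * y S%:C) * (y s / y S%:C) = s.
  move: (y S%:C) yS => q q0; rewrite /y cexpN; move: (cexp _) (cexp_neq0 (H s)) => p p0.
  by field; rewrite p0 q0.
have := cmodM (cexp (H s) * y S%:C) (y s / y S%:C); rewrite E => ->.
by rewrite ler_wpM2r ?cmod_ge0.
Qed.

End ElementaryFactor.

(** * The damping factor *)

Section Limits.
Variable R : realType.
Local Notation C := R[i].
Variables (u : nat -> C) (l : C).
Hypothesis ul : forall e : R, 0 < e -> exists N, forall n, (N <= n)%N -> cmod (u n - l) <= e.

Lemma lim_cmod_le (B : R) N0 : (forall n, (N0 <= n)%N -> cmod (u n) <= B) -> cmod l <= B.
Proof.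
move=> H; apply/ler_addgt0Pr => e /ul[N HN].
have := HN (maxn N N0) (leq_maxl _ _); have := H (maxn N N0) (leq_maxr _ _).
have := cmodB (u (maxn N N0)) (u (maxn N N0) - l); rewrite opprB addrC subrK; lra.
Qed.

Lemma lim_cmod_ge (B : R) N0 : (forall n, (N0 <= n)%N -> B <= cmod (u n)) -> B <= cmod l.
Proof.
move=> H; apply/ler_addgt0Pr => e /ul[N HN].
have := HN (maxn N N0) (leq_maxl _ _); have := H (maxn N N0) (leq_maxr _ _).
have := cmodD (u (maxn N N0) - l) l; rewrite subrK; lra.
Qed.

Lemma lim_Re_ge (B : R) N0 : (forall n, (N0 <= n)%N -> B <= complex.Re (u n)) -> B <= complex.Re l.
Proof.
move=> H; apply/ler_addgt0Pr => e /ul[N HN].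
have := HN (maxn N N0) (leq_maxl _ _); have := H (maxn N N0) (leq_maxr _ _).
have := Re_le_cmod (u (maxn N N0) - l); rewrite cReD cReN; lra.
Qed.
End Limits.

Section Dyadic.
Variable R : realType.
Local Notation C := R[i].

Lemma geometric_le (q : R) n : 0 <= q -> q < 1 -> \sum_(k < n) q ^+ k <= (1 - q)^-1.
Proof.
move=> q0 q1; have q1' : 0 < 1 - q by lra.
rewrite -(ler_pM2l q1') divff ?gt_eqF //.
have -> : (1 - q) * \sum_(k < n) q ^+ k = 1 - q ^+ n.
  elim: n => [|n ih]; first by rewrite big_ord0 mulr0 expr0 subrr.
  by rewrite big_ord_recr /= mulrDr ih exprS; ring.
by rewrite gerBl exprn_ge0.
Qed.

Lemma powR_exprn (x a : R) k : 0 <= x -> (x ^+ k) `^ a = (x `^ a) ^+ k.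
Proof.
move=> x0; rewrite -(powR_mulrn k x0) -(powR_mulrn k (powR_ge0 x a)) -(powRrM x k%:R) -(powRrM x a).
by rewrite [a * _]mulrC.
Qed.

Lemma powR_mul_le (a b t : R) : 0 < a -> 0 < b -> 0 <= t -> t <= 2 ->
  a `^ t * b `^ (2 - t) <= a ^+ 2 + b ^+ 2.
Proof.
move=> a0 b0 t0 t2; have t2' : 0 <= 2 - t by lra.
have sq c : 0 < c -> c `^ t * c `^ (2 - t) = c ^+ 2.
  move=> c0; rewrite -powRD; first by rewrite addrC subrK powR_mulrn // ltW.
  by rewrite (gt_eqF c0) implybT.
have [ab|ab] := leP a b.
  apply: (@le_trans _ _ (b `^ t * b `^ (2 - t))).
    by rewrite ler_wpM2r ?powR_ge0 // powR_le // ltW.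
  by rewrite sq // lerDr sqr_ge0.
apply: (@le_trans _ _ (a `^ t * a `^ (2 - t))).
  by rewrite ler_wpM2l ?powR_ge0 // powR_le // ltW.
by rewrite sq // lerDl sqr_ge0.
Qed.

Lemma one_sqr_le (p u : R) : 0 < p -> p <= 1 -> 0 <= u ->
  1 + u ^+ 2 <= expR ((1 + 2 / p) * u `^ p).
Proof.
move=> p0 p1 u0.
have [->|un] := eqVneq u 0.
  by rewrite expr0n /= addr0 powR0 ?gt_eqF // mulr0 expR0.
have up : 0 < u by rewrite lt_def un.
have [u1|u1] := leP u 1.
  apply: (le_trans (expR_ge1Dx _)); rewrite ler_expR.
  apply: (@le_trans _ _ (u `^ p)).
    by rewrite -powR_mulrn //; apply: ger_powR; rewrite ?up //; lra.
  by rewrite ler_peMl ?powR_ge0 // lerDl divr_ge0 // ltW.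
have u2 : 1 <= u ^+ 2 by rewrite expr_ge1 // ltW.
apply: (@le_trans _ _ (2 * u ^+ 2)); first by rewrite mulr2n mulrDl mul1r lerD2r.
rewrite -[leLHS](@lnK R) ?ler_expR; last by rewrite posrE mulr_gt0 // exprn_gt0.
rewrite lnM ?posrE ?exprn_gt0 // lnXn // mulrDl mul1r; apply: lerD.
  apply: (@le_trans _ _ 1); first by have := @le_ln1Dx R 1; rewrite -[1 + 1]/2; apply; lra.
  have e1 : 1 `^ p = 1 :> R by rewrite powR1.
  by rewrite -[leLHS]e1; apply: powR_le => //; exact: ltW.
rewrite -[leLHS]mulr_natl (_ : 2 / p * u `^ p = 2 * (u `^ p / p)); last by ring.
by rewrite ler_wpM2l // ln_powR_le.
Qed.

Variables (p' p'' : R).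
Hypotheses (p'0 : 0 < p') (pp : p' < p'') (p''1 : p'' < 1).

(** The multiplicity of the zeros +-2^k i. It is about 2^(k p'), so that its quotient by 2^(k p'')
    decays geometrically with ratio [q]. *)
Let m (k : nat) := (Num.truncn ((2 ^+ k : R) `^ p')).+1.
Let q : R := 2 `^ (p' - p'').

Lemma dyadic_q : 0 < q < 1.
Proof.
rewrite powR_gt0 //= /q /powR gt_eqF //.
rewrite -[ltRHS]expR0 ltr_expR nmulr_rlt0 ?subr_lt0 // ln_gt0 //; lra.
Qed.

Lemma dyadic_mult_ge k : (2 ^+ k : R) `^ p' <= (m k)%:R.
Proof. by have /andP[_ /ltW] := truncn_itv (powR_ge0 (2 ^+ k) p'). Qed.

Lemma dyadic_mult_le k : (m k)%:R <= 2 * (2 ^+ k : R) `^ p'.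
Proof.
have /andP[h _] := truncn_itv (powR_ge0 (2 ^+ k : R) p').
have : 1 <= (2 ^+ k : R) `^ p'.
  have e1 : 1 `^ p' = 1 :> R by rewrite powR1.
  by rewrite -[leLHS]e1; apply: powR_le => //; [rewrite exprn_ege1 //; lra|exact: ltW].
rewrite /m -natr1; lra.
Qed.

Lemma dyadic_mult_q k : (m k)%:R * ((2 ^+ k : R) `^ p'')^-1 <= 2 * q ^+ k.
Proof.
have k0 : 0 < (2 ^+ k : R) by rewrite exprn_gt0.
rewrite ler_pdivrMr ?powR_gt0 //; apply: (le_trans (dyadic_mult_le k)).
rewrite -mulrA ler_wpM2l // /q -powR_exprn // -powRD; last by rewrite (gt_eqF k0) implybT.
by rewrite subrK.
Qed.

Lemma dyadic_factor_sub1 (v : C) n : cmod ((1 + v) ^+ n - 1) <= expR (n%:R * cmod v) - 1.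
Proof.
have := @prod_sub1 R 'I_n (index_enum 'I_n) (fun=> 1 + v) (fun=> cmod v) (fun=> cmod_ge0 v) _.
rewrite prodr_const sumr_const card_ord mulr_natl; apply => _.
by rewrite addrC addKr; have := expR_ge1Dx (cmod v); lra.
Qed.

(** The fraction is the tangent of the argument of 1 + z^2 / 4^k at z = x + iy. The denominator is
    bounded below by half of 2^(k p'') |x|^(2 - p''), and summing over k gives a total argument
    O(|y| |x|^(p'' - 1)). *)
Lemma dyadic_tau (x y : R) k : 1 <= `|x| -> 2 * `|y| <= `|x| ->
  (m k)%:R * `|2 * x * y / (4 ^+ k + x ^+ 2 - y ^+ 2)| <= 8 * q ^+ k * (`|y| * `|x| `^ (p'' - 1)).
Proof.
move=> x1 yx.
have y2 : y ^+ 2 <= x ^+ 2 / 4.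
  have : (2 * `|y|) ^+ 2 <= `|x| ^+ 2 by rewrite lerXn2r ?nnegrE ?mulr_ge0.
  rewrite exprMn !real_normK ?num_real //; lra.
have x0 : 0 < `|x| by lra.
have k0 : 0 < (2 ^+ k : R) by rewrite exprn_gt0.
have e4 : 4 ^+ k = (2 ^+ k) ^+ 2 :> R by rewrite -exprM mulnC exprM; congr (_ ^+ _); ring.
have den : (2 ^+ k) `^ p'' * `|x| `^ (2 - p'') <= 2 * (4 ^+ k + x ^+ 2 - y ^+ 2).
  have t0 : 0 <= p'' by exact: ltW (lt_trans p'0 pp).
  have t2 : p'' <= 2 by apply: ltW; apply: (lt_trans p''1); lra.
  apply: (le_trans (powR_mul_le k0 x0 t0 t2)).
  rewrite real_normK ?num_real // -e4; have : 0 < 4 ^+ k :> R by rewrite exprn_gt0.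
  have := sqr_ge0 x; lra.
have D0 : 0 < (2 ^+ k) `^ p'' * `|x| `^ (2 - p'') by rewrite mulr_gt0 ?powR_gt0.
have den0 : 0 < 4 ^+ k + x ^+ 2 - y ^+ 2 by lra.
have inv : (4 ^+ k + x ^+ 2 - y ^+ 2)^-1 <= 2 * (((2 ^+ k) `^ p'')^-1 * (`|x| `^ (2 - p''))^-1).
  rewrite -invfM; have : (2 * (4 ^+ k + x ^+ 2 - y ^+ 2))^-1 <= ((2 ^+ k) `^ p'' * `|x| `^ (2 - p''))^-1.
    by rewrite lef_pV2 ?posrE //; exact: mulr_gt0.
  rewrite [X in X <= _]invfM; lra.
rewrite !normrM normfV (gtr0_norm den0) [`|2|]gtr0_norm //.
have xe : `|x| `^ (p'' - 1) = `|x| * (`|x| `^ (2 - p''))^-1.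
  rewrite -powRN opprB -[X in X * _](powRr1 (normr_ge0 x)) -powRD; last by rewrite (gt_eqF x0) implybT.
  by congr (_ `^ _); ring.
have h1 : (m k)%:R * (2 * `|x| * `|y| / (4 ^+ k + x ^+ 2 - y ^+ 2)) <=
   (m k)%:R * (2 * `|x| * `|y| * (2 * (((2 ^+ k) `^ p'')^-1 * (`|x| `^ (2 - p''))^-1))).
  by rewrite ler_wpM2l // ler_wpM2l // !mulr_ge0.
apply: (le_trans h1).
rewrite [leLHS](_ : _ = (m k)%:R * ((2 ^+ k) `^ p'')^-1 * (4 * (`|y| * (`|x| * (`|x| `^ (2 - p''))^-1)))); last by ring.
rewrite -xe; apply: (le_trans (ler_wpM2r _ (dyadic_mult_q k))).
  by rewrite !mulr_ge0 ?powR_ge0.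
rewrite le_eqVlt; apply/orP; left; apply/eqP; ring.
Qed.

(** G is the product of (1 + z^2 / 4^k)^(m k). Each factor is a real number at least 1 times a power
    of 1 + i t_k; where the sum of the m_k |t_k| is small, the latter multiply to a number of real
    part at least 1/2, and Re G is comparable to the real product. *)
Lemma dyadic_product : exists (G : C -> C) (A K kap B : R),
  [/\ entire G, 0 <= A, 0 < K, 0 < kap & 0 < B] /\
  [/\ forall z, cmod (G z) <= expR (A * cmod z `^ p'') &
      forall z, 1 <= `|complex.Re z| -> K * `|complex.Im z| <= `|complex.Re z| `^ (1 - p'') ->
        expR (kap * `|complex.Re z| `^ p') <= B * complex.Re (G z)].
Proof.
have p''0 : 0 < p'' := lt_trans p'0 pp.
have /andP[q0 q1] := dyadic_q.
have q1' : 0 < 1 - q by rewrite subr_gt0.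
have four k : 4 ^+ k = (2 ^+ k) ^+ 2 :> R by rewrite -exprM mulnC exprM; congr (_ ^+ _); ring.
have fk k : 0 < (4 ^+ k : R) by rewrite exprn_gt0.
pose u k (z : C) := (1 + z ^+ 2 * ((4 ^+ k)^-1)%:C) ^+ m k.
have cu k (z : C) : cmod (z ^+ 2 * ((4 ^+ k)^-1)%:C) = (cmod z / 2 ^+ k) ^+ 2.
  rewrite cmodM cmodX cmodR ger0_norm ?invr_ge0 ?(ltW (fk k)) //.
  by rewrite four expr_div_n.
have uE k : entire (u k).
  exact (@entireX R _ (m k) (entireD (@entire_cst R 1) (entireM (@entireX R _ 2 (@entire_id R)) (@entire_cst R ((4 ^+ k)^-1)%:C)))).
pose c (r : R) k := (m k)%:R * (r / 2 ^+ k) ^+ 2.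
have c0 r k : 0 <= c r k by rewrite mulr_ge0 ?sqr_ge0.
have two k : 0 < (2 ^+ k : R) by rewrite exprn_gt0.
have cle r k : c r k <= r ^+ 2 * (2 * (1 / 2) ^+ k).
  have h : (m k)%:R <= 2 * (2 ^+ k : R).
    apply: (le_trans (dyadic_mult_le k)); rewrite ler_wpM2l // ler1_powR //.
      by rewrite exprn_ege1 // ler1n.
    exact: ltW (lt_trans pp p''1).
  rewrite /c expr_div_n mulrCA ler_wpM2l ?sqr_ge0 //.
  apply: (le_trans (ler_wpM2r _ h)); first by rewrite invr_ge0 sqr_ge0.
  rewrite expr_div_n expr1n mul1r expr2 invfM !mulrA mulfK ?gt_eqF //.
have cM r : exists M, forall n, \sum_(k < n) c r k <= M.
  exists (r ^+ 2 * (2 * (1 - 1 / 2)^-1)) => n.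
  apply: (@le_trans _ _ (\sum_(k < n) r ^+ 2 * (2 * (1 / 2) ^+ k))).
    by apply: ler_sum => k _; exact: cle.
  rewrite -mulr_sumr ler_wpM2l ?sqr_ge0 // -mulr_sumr ler_wpM2l // geometric_le //; lra.
have usub r k z : cmod z <= r -> cmod (u k z - 1) <= expR (c r k) - 1.
  move=> zr; apply: (le_trans (dyadic_factor_sub1 _ _)); rewrite lerB // ler_expR cu.
  rewrite ler_wpM2l // lerXn2r ?nnegrE ?divr_ge0 ?cmod_ge0 ?(ltW (two k)) //.
    exact: le_trans (cmod_ge0 z) zr.
  by rewrite ler_wpM2r // invr_ge0 ltW.
have [G [GE Glim _]] := infinite_product uE c0 cM usub.
pose a := 1 + 2 / p''; have a0 : 0 <= a by rewrite addr_ge0 // divr_ge0 // ltW.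
pose A := a * (2 * (1 - q)^-1).
pose d0 := ln (1 + 1 / 2 : R); have d00 : 0 < d0 by rewrite ln_gt0 // ltrDl.
(* The 2 gives 2 |y| <= |x|; the other term keeps the sum of the m_k |t_k| below ln (3/2). *)
pose K := Num.max 2 (8 * (1 - q)^-1 / d0).
(* The 4 comes from |x| / 4 < 2^k for the dyadic index of |x| / 2, and the 1/2 from e^(1/2) <= 2. *)
pose kap := (1 / 2) * (4^-1) `^ p'.
have k0 : 0 < kap by rewrite mulr_gt0 ?powR_gt0 ?invr_gt0.
(* For |x| < 2 only Re G >= 1/2 is available; this factor covers that case. *)
pose B := 2 * expR 1 : R; have B0 : 0 < B by rewrite mulr_gt0 ?expR_gt0.
exists G, A, K, kap, B; split; first split=> //.
- by rewrite !mulr_ge0 // invr_ge0 ltW.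
- by rewrite lt_max ltr0n.
split.
- move=> z; apply: (lim_cmod_le (Glim z) (N0 := 0%N)) => n _.
  rewrite cmod_prod; apply: (@le_trans _ _ (\prod_(k < n) expR (a * cmod z `^ p'' * (2 * q ^+ k)))).
    apply: ler_prod => k _; rewrite cmod_ge0 /= cmodX.
    apply: (@le_trans _ _ (expR (a * (cmod z / 2 ^+ k) `^ p'') ^+ m k)).
      apply: lerXn2r; rewrite ?nnegrE ?cmod_ge0 ?expR_ge0 //.
      apply: (le_trans (cmodD _ _)); rewrite cmod1 cu.
      by apply: one_sqr_le; rewrite ?(ltW p''1) // divr_ge0 ?cmod_ge0 // ltW.
    rewrite -expRM_natl ler_expR mulrCA -mulrA ler_wpM2l //.
    rewrite powRM ?cmod_ge0 ?invr_ge0 ?(ltW (two k)) // mulrCA ler_wpM2l ?powR_ge0 //.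
    have -> : (2 ^+ k)^-1 `^ p'' = ((2 ^+ k : R) `^ p'')^-1.
      by rewrite -(powR_inv1 (ltW (two k))) -powRrM mulN1r powRN.
    exact: dyadic_mult_q.
  rewrite -expR_sum ler_expR (_ : A * _ = a * cmod z `^ p'' * (2 * (1 - q)^-1)); last by rewrite /A; ring.
  rewrite -mulr_sumr ler_wpM2l ?mulr_ge0 ?powR_ge0 //.
  rewrite -mulr_sumr ler_wpM2l // geometric_le // ltW //.
move=> z x1 yx; set x := complex.Re z in x1 yx *; set y := complex.Im z in yx *.
have x0 : 0 < `|x| by lra.
have x1p : `|x| `^ (1 - p'') <= `|x| by apply: ler1_powR => //; rewrite gerBl ltW.
have y2x : 2 * `|y| <= `|x|.
  apply: le_trans x1p; apply: le_trans yx; by rewrite ler_wpM2r // le_max lexx.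
have y2 : y ^+ 2 <= x ^+ 2 / 4.
  have : (2 * `|y|) ^+ 2 <= `|x| ^+ 2 by rewrite lerXn2r ?nnegrE ?mulr_ge0.
  rewrite exprMn !real_normK ?num_real //; lra.
have den0 k : 0 < 4 ^+ k + x ^+ 2 - y ^+ 2 by have := fk k; have := sqr_ge0 x; lra.
pose a_ k : R := (4 ^+ k + x ^+ 2 - y ^+ 2) / 4 ^+ k.
pose t_ k : R := 2 * x * y / (4 ^+ k + x ^+ 2 - y ^+ 2).
have uE2 k : u k z = ((a_ k) ^+ m k)%:C * (1 + 'i * (t_ k)%:C) ^+ m k.
  rewrite rmorphXn -exprMn; congr (_ ^+ _); apply: complex_eqP.
    rewrite expr2 !ReImE -/x -/y; rewrite /a_ /t_ /=; field.
    by rewrite !gt_eqF ?den0 // -?mulrnDr.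
  rewrite expr2 !ReImE -/x -/y /a_ /t_ /=; field.
  by rewrite !gt_eqF ?den0.
have a1 k : 1 <= a_ k.
  rewrite /a_ ler_pdivlMr // mul1r; have := sqr_ge0 x; lra.
have sumt n : \sum_(k < n) (m k)%:R * `|t_ k| <= d0.
  apply: (@le_trans _ _ (\sum_(k < n) 8 * q ^+ k * (`|y| * `|x| `^ (p'' - 1)))).
    by apply: ler_sum => k _; exact: dyadic_tau.
  rewrite -mulr_suml -mulr_sumr.
  have K0 : 0 < K by rewrite lt_max ltr0n.
  have yK : `|y| * `|x| `^ (p'' - 1) <= K^-1.
    rewrite -opprB powRN ler_pdivrMr ?powR_gt0 // -ler_pdivrMl ?invr_gt0 // invrK //.
  apply: (@le_trans _ _ (8 * (1 - q)^-1 * K^-1)).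
    apply: ler_pM => //.
      by rewrite mulr_ge0 // sumr_ge0 // => k _; rewrite exprn_ge0 // ltW.
    by rewrite ler_wpM2l // geometric_le // ltW.
  by rewrite ler_pdivrMr // [leRHS]mulrC -ler_pdivrMr // /K le_max lexx orbT.
have ReW n : 1 / 2 <= complex.Re (\prod_(k < n) (1 + 'i * (t_ k)%:C) ^+ m k).
  have := @prod_sub1 R _ (index_enum 'I_n) (fun k : 'I_n => (1 + 'i * (t_ k)%:C) ^+ m k) (fun k => (m k)%:R * `|t_ k|) _ _.
  have h1 (k : 'I_n) : 0 <= (m k)%:R * `|t_ k| by rewrite mulr_ge0.
  have h2 (k : 'I_n) : cmod ((1 + 'i * (t_ k)%:C) ^+ m k - 1) <= expR ((m k)%:R * `|t_ k|) - 1.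
    by apply: (le_trans (dyadic_factor_sub1 _ _)); rewrite cmodM cmod_i mul1r cmodR.
  move=> /(_ h1 h2); set W := \prod_(k < n) _ => hW.
  have e1 : expR (\sum_(k < n) (m k)%:R * `|t_ k|) <= 1 + 1 / 2.
    by rewrite -[leRHS](@lnK R) ?ler_expR ?sumt // posrE; lra.
  have := Re_le_cmod (- (W - 1)); rewrite cmodN cReN cReD cReN.
  have -> : complex.Re (1 : C) = 1 by [].
  lra.
have lower (L : R) N0 : 0 <= L -> (forall n, (N0 <= n)%N -> L <= \prod_(k < n) (a_ k) ^+ m k) ->
    L / 2 <= complex.Re (G z).
  move=> L0 HL; apply: (lim_Re_ge (Glim z) (N0 := N0)) => n Nn.
  rewrite (eq_bigr (fun k : 'I_n => ((a_ k) ^+ m k)%:C * (1 + 'i * (t_ k)%:C) ^+ m k)); last by move=> k _; exact: uE2.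
  rewrite big_split /= -rmorph_prod cReM cReC cImC mul0r subr0.
  have h1 := HL n Nn; have h2 := ReW n.
  by rewrite -[2^-1]mul1r; apply: ler_pM => //; lra.
have kE : kap * `|x| `^ p' = 1 / 2 * (`|x| / 4) `^ p'.
  by rewrite /kap -mulrA -powRM ?invr_ge0 // mulrC [_^-1 * _]mulrC mulrC.
rewrite kE; have [x2|x2] := leP 2 `|x|; last first.
  have l1 : 1 / 2 <= complex.Re (G z).
    apply: (lower 1 0%N) => // n _; elim/big_rec: _ => // k w _ w1.
    by rewrite -[leLHS]mulr1; apply: ler_pM => //; exact: exprn_ege1.
  have e1 : expR (1 / 2 * (`|x| / 4) `^ p') <= expR 1.
    rewrite ler_expR; have : (`|x| / 4) `^ p' <= 1 `^ p' by apply: powR_le; [rewrite divr_ge0|lra|exact: ltW].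
    rewrite powR1; lra.
  have := expR_gt0 (1 : R); rewrite /B; nra.
(* The single factor of this index suffices: its real part is at least 2^(m k) with m k >= (|x| /
   4)^p', and all the others are at least 1. *)
have [k kx1 kx2] : exists2 k : nat, (2 ^+ k : R) <= `|x| / 2 & `|x| / 2 < 2 ^+ k.+1.
  pose n := Num.truncn (`|x| / 2).
  have x20 : 0 <= `|x| / 2 by lra.
  have /andP[n1 n2] := truncn_itv x20.
  have n0 : (0 < n)%N by rewrite truncn_gt0; lra.
  have /andP[t1 t2] := trunc_log_bounds (isT : (1 < 2)%N) n0.
  exists (trunc_log 2 n).
    by apply: le_trans n1; rewrite -natrX ler_nat.
  by apply: (lt_le_trans n2); rewrite -natrX ler_nat.
have ak : 2 <= a_ k.
  rewrite /a_ ler_pdivlMr // four.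
  have : (2 ^+ k) ^+ 2 <= (`|x| / 2) ^+ 2 by rewrite lerXn2r ?nnegrE ?divr_ge0 ?(ltW (two k)).
  rewrite expr_div_n real_normK ?num_real // => h; have := sqr_ge0 x; lra.
have l1 : expR (1 / 2 * (`|x| / 4) `^ p') / 2 <= complex.Re (G z).
  apply: (lower _ k.+1); first exact: expR_ge0.
  move=> n kn; rewrite (bigD1 (Ordinal kn)) //= -[leLHS]mulr1; apply: ler_pM; rewrite ?expR_ge0 //.
    apply: (@le_trans _ _ (2 ^+ m k)); last by apply: lerXn2r; rewrite ?nnegrE //; lra.
    have h2 : expR (1 / 2) <= 2 :> R.
      have h3 : 0 < 1 - 1 / 2 :> R by lra.
      have := expR_ge1Dx (- (1 / 2) : R); rewrite expRN => h4.
      rewrite -[leLHS]invrK -[leRHS](_ : (1 - 1 / 2)^-1 = 2); last by field.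
      by rewrite lef_pV2 ?posrE ?invr_gt0 ?expR_gt0.
    apply: (@le_trans _ _ (expR (1 / 2) ^+ m k)); last first.
      by apply: lerXn2r; rewrite ?nnegrE ?expR_ge0.
    rewrite -expRM_natl ler_expR mulrC ler_wpM2r //.
    apply: le_trans (dyadic_mult_ge k); apply: powR_le; rewrite ?divr_ge0 ?(ltW p'0) //.
    by move: kx2; rewrite exprS; lra.
  elim/big_rec: _ => // j w _ w1.
  by rewrite -[leLHS]mulr1; apply: ler_pM => //; exact: exprn_ege1.
have e1 : 1 <= expR 1 :> R by rewrite -expR0 ler_expR.
have := expR_gt0 (1 / 2 * (`|x| / 4) `^ p'); rewrite /B; nra.
Qed.

End Dyadic.

(** * Canonical products *)

Section ProductZero.
Variable R : realType.
Local Notation C := R[i].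

(** The factor of index n0 is replaced by its zero-free part v. The modified product converges as
    before, does not vanish at z0, and differs from P by the power of w - z0. *)
Lemma product_zero (u : nat -> C -> C) (c : R -> nat -> R) (P : C -> C) (n0 : nat) (z0 : C) (m : nat) (v : C -> C) :
  (forall n, entire (u n)) -> (forall r n, 0 <= c r n) ->
  (forall r, exists M, forall n, \sum_(k < n) c r k <= M) ->
  (forall r n z, cmod z <= r -> cmod (u n z - 1) <= expR (c r n) - 1) ->
  (forall z (e : R), 0 < e -> exists N, forall n, (N <= n)%N -> cmod (\prod_(k < n) u k z - P z) <= e) ->
  entire v -> (forall z, u n0 z = (z - z0) ^+ m * v z) -> v z0 != 0 ->
  (forall n, n != n0 -> u n z0 != 0) -> zero_of_order P z0 m.
Proof.
move=> uE c0 cM uc Plim vE uv v0 un0.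
pose u' n := if n == n0 then v else u n.
have [M HM] : exists M : R -> R, forall r, 0 <= M r /\ forall z, cmod z <= r -> cmod (v z) <= M r.
  have /choice[M HM] : forall r : R, exists M : R, 0 <= M /\ forall z, cmod z <= r -> cmod (v z) <= M.
    by move=> r; have [M M0 HM] := ccont_bounded r (entire_cont vE); exists M.
  by exists M.
(* |v - 1| <= M r + 1 = e^(ln (M r + 2)) - 1; since one index changes, the sums remain bounded. *)
pose c' r n := if n == n0 then ln (M r + 2) else c r n.
have l0 r : 0 <= ln (M r + 2) by rewrite ln_ge0 //; have [h _] := HM r; lra.
have [||||P' [P'E P'lim P'0]] := @infinite_product R u' c'.
- by move=> n; rewrite /u'; case: ifP => _; [exact vE|exact (uE n)].
- by move=> r n; rewrite /c'; case: ifP.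
- move=> r; have [B HB] := cM r; exists (B + ln (M r + 2)) => n.
  apply: (@le_trans _ _ (\sum_(k < n) (c r k + (if k == n0 :> nat then ln (M r + 2) else 0)))).
    by apply: ler_sum => k _; rewrite /c'; case: ifP => _; rewrite ?addr0 // lerDr.
  rewrite big_split /=; apply: lerD; first exact: HB.
  have [n0n|n0n] := ltnP n0 n.
    rewrite (bigD1 (Ordinal n0n)) //= eqxx big1 ?addr0 // => i.
    by rewrite -val_eqE /= => /negbTE ->.
  rewrite big1 // => i _; rewrite ifF //.
  by apply/negbTE; rewrite neq_ltn (leq_trans (ltn_ord i) n0n).
- move=> r n z zr; rewrite /u' /c'; case: ifP => _; last exact: uc.
  have [M0 HMr] := HM r; rewrite lnK ?posrE; last by lra.
  by apply: (le_trans (cmodB _ _)); rewrite cmod1; have := HMr z zr; lra.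
exists P'; split; first exact P'E.
- by apply: P'0 => n; rewrite /u'; case: ifPn => [_|/un0].
move=> w; apply/eqP; rewrite -subr_eq0 -cmod_eq0 eq_le cmod_ge0 andbT.
apply/ler_addgt0Pr => e e0; rewrite add0r.
have e2 : 0 < e / 2 by lra.
pose K := cmod ((w - z0) ^+ m) + 1; have K0 : 0 < K by rewrite ltr_wpDl ?cmod_ge0.
have [N HN] := Plim w _ e2; have [N' HN'] := P'lim w _ (divr_gt0 e2 K0).
pose n := maxn n0.+1 (maxn N N').
have n0n : (n0 < n)%N by rewrite leq_maxl.
have h1 : cmod (\prod_(k < n) u k w - P w) <= e / 2 by apply: HN; rewrite !leq_max leqnn orbT.
have h2 : cmod (\prod_(k < n) u' k w - P' w) <= e / 2 / K by apply: HN'; rewrite !leq_max leqnn !orbT.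
have E : \prod_(k < n) u k w = (w - z0) ^+ m * \prod_(k < n) u' k w.
  rewrite (bigD1 (Ordinal n0n)) //= uv [in RHS](bigD1 (Ordinal n0n)) //= /u' eqxx mulrA.
  congr (_ * _); apply: eq_bigr => i; rewrite -val_eqE /= => /negbTE ->.
  by [].
rewrite (_ : _ - _ = (w - z0) ^+ m * (\prod_(k < n) u' k w - P' w) - (\prod_(k < n) u k w - P w)); last first.
  by rewrite E; ring.
apply: (le_trans (cmodB _ _)); rewrite cmodM.
have : cmod ((w - z0) ^+ m) * cmod (\prod_(k < n) u' k w - P' w) <= K * (e / 2 / K).
  by apply: ler_pM; rewrite ?cmod_ge0 // /K lerDl.
rewrite [K * _]mulrC divfK ?gt_eqF //; lra.
Qed.

End ProductZero.

Section CanonicalProduct.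
Variable R : realType.
Local Notation C := R[i].
Variables (D : divisor R) (f : C -> nat) (w W : C -> R) (g : C -> C -> C) (S : R).

Definition far (z a : C) : Prop :=
  1 <= `|complex.Re (z - a)| \/ 1 <= `|complex.Im (z - a)|.
Definition nearp (z a : C) : bool :=
  (`|complex.Re (z - a)| < 1) && (`|complex.Im (z - a)| < 1).

Lemma nearPn z a : ~~ nearp z a -> far z a.
Proof. by rewrite negb_and -!leNgt => /orP[]; [left|right]. Qed.

Lemma near_dist z a : nearp z a -> cmod (z - a) <= 2.
Proof. by move=> /andP[h1 h2]; apply: (le_trans (cmod_leD _)); lra. Qed.

Hypothesis finj : forall a b, D a != 0%N -> D b != 0%N -> f a = f b -> a = b.
Hypothesis w_ge0 : forall a, 0 <= w a.
Hypothesis W_ge0 : forall z, 0 <= W z.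
Hypothesis W_bnd : forall r, exists2 M : R, 0 <= M & forall z, cmod z <= r -> W z <= M.
Hypothesis gE : forall a, entire (g a).
Hypothesis g_neq0 : forall a z, g a z != 0.
Hypothesis g_far : forall a z, far z a -> logclose (W z * w a) ((z - a) * g a z) 1.
Hypothesis g_near : forall a z, nearp z a ->
  cmod ((z - a) * g a z) <= expR (W z * w a) /\
  cmod (z - a) <= expR (W z * w a) * cmod ((z - a) * g a z).
Hypothesis w_sum : forall L : seq C, uniq L -> \sum_(a <- L) (D a)%:R * w a <= S.
Hypothesis near_sum : forall r : R, exists K : R, forall L : seq C, uniq L ->
  (forall a, a \in L -> cmod a <= r) -> (\sum_(a <- L) D a)%N%:R <= K.

(** The injection f numbers the support. An index that is not attained gets the dummy point 0 with
    multiplicity 0, hence the factor 1. *)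
Let A n := [set a | D a != 0%N /\ f a = n].
Let p n : C := xget 0 (A n).
Let hasp n : bool := `[< A n !=set0 >].
Let mult_ n : nat := if hasp n then D (p n) else 0%N.
Let fac (a z : C) := (z - a) * g a z.
Let u n z := fac (p n) z ^+ mult_ n.

Lemma hasp_p n : hasp n -> D (p n) != 0%N /\ f (p n) = n.
Proof. by move=> /asboolP[a Aa]; rewrite /p; case: xgetP => [_ _ []//|/(_ a)]. Qed.

Lemma p_f a : D a != 0%N -> hasp (f a) /\ p (f a) = a.
Proof.
move=> Da; have h : hasp (f a) by apply/asboolP; exists a.
by split=> //; have [h1 h2] := hasp_p h; exact: finj.
Qed.

Let pts n := [seq p k | k <- [seq k <- iota 0 n | hasp k]].

Lemma pts_uniq n : uniq (pts n).
Proof.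
rewrite map_inj_in_uniq ?filter_uniq ?iota_uniq // => i j.
rewrite !mem_filter => /andP[/hasp_p[_ hi] _] /andP[/hasp_p[_ hj] _] pij.
by rewrite -hi -hj pij.
Qed.

Lemma sum_pts n (F : C -> R) (Q : pred C) :
  \sum_(k < n) (if Q (p k) then (mult_ k)%:R * F (p k) else 0) = \sum_(a <- [seq a <- pts n | Q a]) (D a)%:R * F a.
Proof.
rewrite big_filter /pts big_map big_filter_cond -big_mkcond /=.
rewrite -(big_mkord (fun k => Q (p k)) (fun k => (mult_ k)%:R * F (p k))) /index_iota subn0.
rewrite [in RHS](eq_bigl (fun k => Q (p k) && hasp k)); last by move=> k; rewrite andbC.
rewrite [in RHS]big_mkcondr /=; apply: eq_bigr => k _.
by rewrite /mult_; case: ifP; rewrite ?mul0r.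
Qed.

Lemma prod_pts n z : \prod_(k < n) u k z = \prod_(a <- pts n) fac a z ^+ D a.
Proof.
rewrite /pts big_map big_filter [in RHS]big_mkcond /= -(big_mkord xpredT (fun k => u k z)) /index_iota subn0.
by apply: eq_bigr => k _; rewrite /u /mult_; case: ifP.
Qed.

Lemma sum_nat_filter (L : seq C) (Q : pred C) :
  \sum_(a <- L) (D a)%:R * (Q a)%:R = (\sum_(a <- [seq a <- L | Q a]) D a)%N%:R :> R.
Proof.
rewrite natr_sum big_filter [in RHS]big_mkcond /=; apply: eq_bigr => a _.
by case: (Q a); rewrite ?mulr1 ?mulr0.
Qed.

(** The bound of each factor separates as W z times w a, so summing over the divisor only involves
    the weights. From below, a far factor loses no more than this bound, and a near one loses in
    addition |z - a| >= del. *)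
Lemma canonical_product : exists P : C -> C,
  [/\ entire P, forall z, cmod (P z) <= expR (W z * S),
      forall z, zero_of_order P z (D z) &
      forall z (del : R) (n : nat), 0 < del <= 1 ->
        (forall a, D a != 0%N -> nearp z a -> del <= cmod (z - a)) ->
        (forall L : seq C, uniq L -> (forall a, a \in L -> D a != 0%N /\ nearp z a) -> (\sum_(a <- L) D a <= n)%N) ->
        expR (- (W z * S)) * del ^+ n <= cmod (P z)].
Proof.
have uE n : entire (u n).
  exact (@entireX R _ (mult_ n) (entireM (entireB (@entire_id R) (@entire_cst R (p n))) (@gE (p n)))).
have /choice[Wr HWr] : forall r : R, exists M : R, 0 <= M /\ forall z, cmod z <= r -> W z <= M.
  by move=> r; have [M M0 HM] := W_bnd r; exists M.
(* The term 2 serves the points near the disc, where the factor itself is bounded but not close to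
   1; by [near_sum] their total multiplicity is finite. *)
pose c r n := (mult_ n)%:R * (Wr r * w (p n) + 2 * (cmod (p n) <= r + 2)%R%:R).
have c0 r n : 0 <= c r n.
  by rewrite mulr_ge0 // addr_ge0 ?mulr_ge0 //; have [] := HWr r.
have cM r : exists M, forall n, \sum_(k < n) c r k <= M.
  have [K HK] := near_sum (r + 2); exists (Wr r * S + 2 * K) => n.
  have := sum_pts n (fun a => Wr r * w a + 2 * (cmod a <= r + 2)%R%:R) xpredT.
  rewrite filter_predT /= => ->.
  rewrite (eq_bigr (fun a => Wr r * ((D a)%:R * w a) + 2 * ((D a)%:R * (cmod a <= r + 2)%R%:R))); last by move=> a _; ring.
  rewrite big_split /= -!mulr_sumr; apply: lerD.
    by rewrite ler_wpM2l ?w_sum ?pts_uniq //; have [] := HWr r.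
  rewrite ler_wpM2l // sum_nat_filter; apply: HK; first by rewrite filter_uniq ?pts_uniq.
  by move=> a; rewrite mem_filter => /andP[].
have usub r n z : cmod z <= r -> cmod (u n z - 1) <= expR (c r n) - 1.
  move=> zr; rewrite /u /c.
  have [W0 HW] := HWr r.
  set b := Wr r * w (p n) + _.
  have b0 : 0 <= b by rewrite addr_ge0 ?mulr_ge0.
  have Wb : W z * w (p n) <= Wr r * w (p n) by rewrite ler_wpM2r ?HW.
  have key : cmod (fac (p n) z - 1) <= expR b - 1.
    have [nz|/nearPn fz] := boolP (nearp z (p n)); last first.
      have [_ _ h _] := g_far fz; move: h; rewrite cmod1 mulr1 => h.
      by apply: (le_trans h); rewrite lerB // ler_expR (le_trans Wb) // lerDl mulr_ge0.
    have [h _] := g_near nz.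
    have pr : cmod (p n) <= r + 2.
      have := cmodB z (z - p n); rewrite opprB addrC subrK; have := near_dist nz; lra.
    apply: (le_trans (cmodB _ _)); rewrite cmod1.
    have e1 : expR (W z * w (p n)) <= expR (Wr r * w (p n)) by rewrite ler_expR.
    have e2 : 1 <= expR (Wr r * w (p n)) by rewrite -expR0 ler_expR mulr_ge0.
    have e3 : 3 <= expR (2 : R) by have := expR_ge1Dx (2 : R); lra.
    rewrite /b pr mulr1 expRD; nra.
  have := @prod_sub1 R 'I_(mult_ n) (index_enum 'I_(mult_ n)) (fun=> fac (p n) z) (fun=> b) (fun=> b0) (fun=> key).
  by rewrite prodr_const sumr_const card_ord mulr_natl.
have [P [PE Plim P0]] := infinite_product uE c0 cM usub.
have fac0 a z : fac a z != 0 -> True by [].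
have u0 n z : p n != z \/ ~~ hasp n -> u n z != 0.
  rewrite /u /mult_; case: ifPn => hn; last by rewrite expr0 oner_neq0.
  move=> [pz|//]; rewrite expf_neq0 // mulf_neq0 // subr_eq0 eq_sym //.
exists P; split; first exact PE.
- move=> z; apply: (lim_cmod_le (Plim z) (N0 := 0%N)) => n _.
  rewrite prod_pts cmod_prod.
  apply: (@le_trans _ _ (\prod_(a <- pts n) expR (W z * ((D a)%:R * w a)))).
    apply: ler_prod => a _; rewrite cmod_ge0 /= cmodX mulrCA expRM_natl.
    apply: lerXn2r; rewrite ?nnegrE ?cmod_ge0 ?expR_ge0 //.
    have [nz|/nearPn fz] := boolP (nearp z a); first by have [] := g_near nz.
    by have [h _ _ _] := g_far fz; rewrite cmod1 mulr1 in h.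
  rewrite -expR_sum ler_expR -mulr_sumr ler_wpM2l // w_sum //; exact: pts_uniq.
- move=> z0; have [D0|D0] := eqVneq (D z0) 0%N.
    rewrite D0; exists P; split; first exact PE.
      apply: P0 => n; apply: u0; have [hn|hn] := boolP (hasp n); last by right.
      by left; apply/eqP => pz; have [] := hasp_p hn; rewrite pz D0.
    by move=> v; rewrite expr0 mul1r.
  have [hf pf] := p_f D0.
  have mf : mult_ (f z0) = D z0 by rewrite /mult_ hf pf.
  have vE : entire (fun z => g z0 z ^+ D z0) by exact (@entireX R _ (D z0) (@gE z0)).
  have uv z : u (f z0) z = (z - z0) ^+ D z0 * g z0 z ^+ D z0 by rewrite /u mf pf /fac exprMn.
  have v0 : g z0 z0 ^+ D z0 != 0 by rewrite expf_neq0.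
  have un0 n : n != f z0 -> u n z0 != 0.
    move=> nf; apply: u0; have [hn|hn] := boolP (hasp n); last by right.
    by left; apply: contraNneq nf => <-; have [_ ->] := hasp_p hn.
  exact: (product_zero uE c0 cM usub Plim vE uv v0 un0).
move=> z del N /andP[del0 del1] Hdel HN.
apply: (lim_cmod_ge (Plim z) (N0 := 0%N)) => n _.
rewrite prod_pts cmod_prod.
apply: (@le_trans _ _ (\prod_(a <- pts n) (expR (- (W z * ((D a)%:R * w a))) * del ^+ (D a * nearp z a)))).
  rewrite big_split /= -expR_sum; apply: ler_pM; rewrite ?expR_ge0 ?exprn_ge0 ?(ltW del0) //.
    rewrite ler_expR sumrN lerN2 -mulr_sumr ler_wpM2l // w_sum //; exact: pts_uniq.
  rewrite -expr_sum; apply: ler_wiXn2l => //; first exact: ltW.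
  rewrite (eq_bigr (fun a => if nearp z a then D a else 0%N)); last first.
    by move=> a _; case: (nearp z a); rewrite ?muln1 ?muln0.
  rewrite -big_mkcond -big_filter /=; apply: HN; first by rewrite filter_uniq ?pts_uniq.
  move=> a; rewrite mem_filter => /andP[na /mapP[k]]; rewrite mem_filter => /andP[hk _] ak.
  by split=> //; rewrite ak; have [] := hasp_p hk.
rewrite big_seq [leRHS]big_seq; apply: ler_prod => a apts.
rewrite mulr_ge0 ?expR_ge0 ?exprn_ge0 ?(ltW del0) //= cmodX mulrCA -mulrN expRM_natl mulnC exprM -exprMn.
apply: lerXn2r; rewrite ?nnegrE ?cmod_ge0 ?mulr_ge0 ?expR_ge0 ?exprn_ge0 ?(ltW del0) //.
have [nz|/nearPn fz] := boolP (nearp z a); rewrite ?expr1 ?expr0.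
  have [_ h] := g_near nz; rewrite expRN mulrC ler_pdivrMr ?expR_gt0 // [leRHS]mulrC.
  apply: le_trans h; apply: Hdel => //.
  by move: apts => /mapP[k]; rewrite mem_filter => /andP[hk _] ->; have [] := hasp_p hk.
have [_ h _ _] := g_far fz; rewrite cmod1 in h.
by rewrite mulr1 expRN -[(expR _)^-1]mul1r ler_pdivrMr ?expR_gt0 // mulrC.
Qed.

End CanonicalProduct.

(** * Tangent lines of the growth function and horizontal decay *)

Section Weights.
Variable R : realType.
Implicit Types (rho sigma h e p x : R).

(* The factor of a point at height about l is controlled at height h by
   expR (T l * (h - l)) = expR (- phi l) * expR (phi l + T l * (h - l)).  The
   first term is the weight of the point; Phi is the supremum of the lines in
   the second, which by convexity stay below (sigma + o(1)) h^rho. *)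
Lemma weights_exist rho sigma (s : R -> R) : 1 < rho -> 0 <= sigma ->
  s t @[t --> +oo] --> sigma ->
  exists (h0 : R) (phi T : nat -> R) (Phi : R -> R),
    [/\ 0 < h0, forall l, 1 <= T l,
        forall l, s (l%:R + 1 + h0) * (l%:R + 1 + h0) `^ rho + 3 * l%:R <= phi l &
        [/\ forall l h, 0 <= h -> phi l + T l * (h - l%:R) <= Phi h,
            forall h h', 0 <= h -> h <= h' -> Phi h <= Phi h',
            forall h, 0 <= h -> 0 <= Phi h &
            forall e, 0 < e -> evt (fun h => Phi h <= (sigma + e) * h `^ rho)]].
Proof.
move=> r1 sig0 s_lim.
have s_evt e : 0 < e -> evt (fun t => `|sigma - s t| <= e).
  by move=> e0; apply: evt_pinfty; move/cvgrPdist_le : s_lim; apply.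
have [h0 h00 Hh0] := s_evt 1 ltr01.
(* Points with l <= |Im a| < l + 1 lie below this height, and adding [h0] reaches the range where s
   is within 1 of sigma. *)
pose t_ (l : nat) : R := l%:R + 1 + h0.
have t1 l : 0 < t_ l by rewrite addr_gt0 // ltr_wpDl.
pose c_ l := Num.max (s (t_ l) - sigma) 0.
have c0 l : 0 <= c_ l by rewrite le_max lexx orbT.
have c1 l : c_ l <= 1.
  rewrite ge_max ler01 andbT; have : h0 <= t_ l by rewrite lerDr addr_ge0.
  by move=> /Hh0; rewrite ler_norml => /andP[]; lra.
(* The value at [t_ l] of (sigma + c_ l) u^rho, whose tangent slope goes into [T]. The terms 3 l
   here and 3 in [T] add just 3 h to each line and make later sums over l converge. *)
pose phi l := (sigma + c_ l) * t_ l `^ rho + 3 * l%:R.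
pose T l := rho * (sigma + c_ l) * t_ l `^ (rho - 1) + 3.
have T3 l : 3 <= T l.
  by rewrite lerDr !mulr_ge0 ?powR_ge0 ?addr_ge0 //; lra.
have tangent l h : 0 <= h -> phi l + T l * (h - l%:R) <= (sigma + c_ l) * (h + (1 + h0)) `^ rho + 3 * h.
  move=> hh; have H0 : 0 <= h + (1 + h0) by lra.
  have sc : 0 <= sigma + c_ l by rewrite addr_ge0.
  have := ler_wpM2l sc (powR_tangent r1 (t1 l) H0).
  rewrite (_ : h + (1 + h0) - t_ l = h - l%:R); last by rewrite /t_; ring.
  rewrite /phi /T; lra.
pose V h := [set phi l + T l * (h - l%:R) | l in [set: nat]].
have Vub h : 0 <= h -> ubound (V h) ((sigma + 1) * (h + (1 + h0)) `^ rho + 3 * h).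
  move=> hh _ [l _ <-]; apply: (le_trans (tangent l h hh)); rewrite lerD2r ler_wpM2r ?powR_ge0 //.
  by rewrite lerD2l.
have Vsup h : 0 <= h -> has_sup (V h).
  by move=> hh; split; [exists (phi 0%N + T 0%N * (h - 0%:R)), 0%N|eexists; exact: Vub].
exists h0, phi, T, (fun h => sup (V h)); split=> //.
- by move=> l; have := T3 l; lra.
- move=> l; rewrite lerD2r ler_wpM2r ?powR_ge0 // -/(t_ l).
  have : s (t_ l) - sigma <= c_ l by rewrite le_max lexx.
  lra.
have sup_ge l h : 0 <= h -> phi l + T l * (h - l%:R) <= sup (V h).
  by move=> hh; apply: ub_le_sup; [exact: (Vsup h hh).2|exists l].
split=> //.
- move=> h h' hh hh'; apply: ge_sup; first exact: (Vsup h hh).1.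
  move=> _ [l _ <-]; apply: le_trans (sup_ge l h' (le_trans hh hh')).
  rewrite lerD2l ler_wpM2l //; [have := T3 l; lra|lra].
- move=> h hh; apply: le_trans (sup_ge 0%N h hh).
  rewrite addr_ge0 //.
    by rewrite addr_ge0 ?mulr_ge0 ?powR_ge0 ?addr_ge0.
  by rewrite subr0 mulr_ge0 //; have := T3 0%N; lra.
move=> e e0; have e4 : 0 < e / 4 by lra.
(* From [L] on the error [c_ l] is below e / 4. The first [L] lines are at most M (h + 1),
   negligible since rho > 1. *)
have [L HL] : exists L, forall l, (L <= l)%N -> c_ l <= e / 4.
  have [a a0 Ha] := s_evt _ e4; exists (Num.truncn a).+1 => l Ll.
  rewrite ge_max (ltW e4) andbT.
  have : a <= t_ l.
    have /andP[_ h1] := truncn_itv (ltW a0).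
    have h2 : (Num.truncn a).+1%:R <= l%:R :> R by rewrite ler_nat.
    rewrite /t_; lra.
  by move=> /Ha; rewrite ler_norml => /andP[]; lra.
pose M := \sum_(l < L) (phi l + T l).
have phi0 l : 0 <= phi l by rewrite addr_ge0 ?mulr_ge0 ?powR_ge0 ?addr_ge0.
have T0 l : 0 <= T l by have := T3 l; lra.
have M0 : 0 <= M by apply: sumr_ge0 => l _; rewrite addr_ge0.
have rho0 : 0 < rho by lra.
have d0 : 0 < e / 4 / (sigma + e / 4) by rewrite divr_gt0 //; lra.
have c10 : 0 <= 1 + h0 by lra.
have E1 := evt_powR_shift rho0 c10 d0.
have E2 := evt_powR_small (ler01 : 0 <= (1 : R)) r1 (ler0n R 3) (lexx 0) e4.
have E3 := evt_powR_small (ler01 : 0 <= (1 : R)) r1 M0 (ler01 : 0 <= (1 : R)) e4.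
apply: evt_mono (evt_and (evt_and E1 E2) E3) => h hh [[]].
rewrite addr0 !powRr1; [|lra|lra] => k1 k2 k3.
apply: ge_sup; first exact: (Vsup h (ltW hh)).1.
move=> _ [l _ <-].
have hr : 0 <= h `^ rho := powR_ge0 _ _.
have eh : 0 <= e * h `^ rho by rewrite mulr_ge0 // ltW.
have sh : 0 <= sigma * h `^ rho by rewrite mulr_ge0.
have [Ll|Ll] := leqP L l.
  apply: (le_trans (tangent l h (ltW hh))).
  have se : 0 < sigma + e / 4 by lra.
  have q1 : (sigma + c_ l) * (h + (1 + h0)) `^ rho <= (sigma + e / 4) * (h + (1 + h0)) `^ rho.
    by rewrite ler_wpM2r ?powR_ge0 // lerD2l HL.
  have q2 : (sigma + e / 4) * (h + (1 + h0)) `^ rho <= (sigma + e / 4 + e / 4) * h `^ rho.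
    apply: (le_trans (ler_wpM2l (ltW se) k1)); rewrite mulrA.
    rewrite (_ : (sigma + e / 4) * (1 + e / 4 / (sigma + e / 4)) = sigma + e / 4 + e / 4) //.
    by rewrite mulrDr mulr1 [_ * (_ / _ / _)]mulrC divfK // gt_eqF.
  lra.
have lM : phi l + T l <= M.
  by rewrite /M (bigD1 (Ordinal Ll)) //= lerDl sumr_ge0 // => i _; rewrite addr_ge0.
have h1 : phi l + T l * (h - l%:R) <= M * (h + 1).
  have := phi0 l; have := T0 l; have ln := ler0n R l.
  have t2 : 0 <= T l * l%:R by rewrite mulr_ge0.
  have t3 : (phi l + T l) * (h + 1) <= M * (h + 1) by rewrite ler_wpM2r //; lra.
  have t4 : 0 <= phi l * h by rewrite mulr_ge0 // ltW.
  lra.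
lra.
Qed.

(** Let Q be the subtracted exponent, so that N is about Q. If |x - al| >= 2 e N, then kappa <=
    e^(-N) <= e^(-Q). Otherwise |al| <= |x| + O(1 + |al|^p), hence |al| <= 2 |x| + O(1); then Q is
    at most A |x|^p + B, and kappa <= 1 suffices. *)
Lemma kappa_decay p kap : 0 < p -> p < 1 -> 0 <= kap -> exists A B : R,
  [/\ 0 <= A, 0 <= B & forall x al : R,
    kappa (Num.truncn (kap * (1 + (Num.truncn `|al|)%:R) `^ p)).+1 `|x - al| <=
      expR (A * `|x| `^ p + B - kap * (1 + (Num.truncn `|al|)%:R) `^ p)].
Proof.
move=> p0 p1 kap0; pose E := 2 * expR 1 : R.
have E0 : 0 < E by rewrite mulr_gt0 // expR_gt0.
have Ek0 : 0 <= E * kap by rewrite mulr_ge0 // ltW.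
have h2 : 0 < 1 / 2 :> R by lra.
have [C C0 HC] := powR_dominated p0 p1 Ek0 h2.
have {}HC u : 0 <= u -> E * kap * u `^ p <= 1 / 2 * u + C.
  by move=> u0; have := HC u u0; rewrite powRr1.
pose B1 := 2 * (1 + E + C).
have B10 : 0 <= B1 by rewrite /B1; lra.
exists (2 * kap), (kap * B1 `^ p); split; rewrite ?mulr_ge0 ?powR_ge0 // => x al.
set j := Num.truncn `|al|; set J := 1 + j%:R; set Q := kap * J `^ p; set N := (Num.truncn Q).+1.
have J1 : 1 <= J by rewrite /J lerDl.
have Q0 : 0 <= Q by rewrite mulr_ge0 ?powR_ge0.
have QN : Q <= N%:R by have /andP[_ /ltW] := truncn_itv Q0.
have NQ : N%:R <= Q + 1 by have /andP[h _] := truncn_itv Q0; rewrite /N -[X in X <= _]natr1; lra.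
have NN : (0 < N)%N by [].
have [big|small] := leP (E * N%:R) `|x - al|.
  have N0 : 0 < N%:R :> R by rewrite ltr0n.
  have b0 : 0 < `|x - al| by apply: lt_le_trans big; rewrite mulr_gt0.
  have fr : N.*2%:R / Num.max N.*2%:R `|x - al| <= expR (- 1) :> R.
    have := kappa_base NN `|x - al| => m0.
    rewrite ler_pdivrMr // expRN.
    rewrite -ler_pdivrMl ?invr_gt0 ?expR_gt0 // invrK.
    rewrite le_max; apply/orP; right; apply: le_trans big.
    by rewrite -muln2 natrM /E; lra.
  apply: (@le_trans _ _ (expR (- 1) ^+ N)).
    apply: lerXn2r fr; rewrite nnegrE; last exact: expR_ge0.
    by have /andP[] := kappa_frac NN `|x - al|.
  rewrite -expRM_natl ler_expR mulrN1.
  have : 0 <= 2 * kap * `|x| `^ p by rewrite !mulr_ge0 ?powR_ge0.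
  have : 0 <= kap * B1 `^ p by rewrite mulr_ge0 ?powR_ge0.
  lra.
apply: (le_trans (kappa_le1 NN _)); rewrite -[X in X <= _]expR0 ler_expR.
have al_le : `|al| <= `|x| + E * N%:R.
  have := ler_normB x (x - al); rewrite (_ : x - (x - al) = al); last by ring.
  lra.
have jal : j%:R <= `|al| by have /andP[] := truncn_itv (normr_ge0 al).
have EN : E * N%:R <= E * kap * J `^ p + E.
  have := ler_wpM2l (ltW E0) NQ; rewrite /Q; lra.
have J_ge0 : 0 <= J by lra.
have HJ := HC J J_ge0.
have JE : J = 1 + j%:R by [].
have JJ : J <= 2 * `|x| + B1.
  have k1 := le_trans EN (lerD HJ (lexx E)).
  have k2 := le_trans jal (le_trans al_le (lerD (lexx `|x|) k1)).
  by rewrite /B1; clear -k2 JE; clearbody E J; lra.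
have x2 : 0 <= 2 * `|x| by rewrite mulr_ge0.
have Jp : J `^ p <= 2 * `|x| `^ p + B1 `^ p.
  apply: (@le_trans _ _ ((2 * `|x| + B1) `^ p)); first by apply: powR_le => //; exact: ltW.
  apply: (le_trans (powR_subadd x2 B10 p0 (ltW p1))); rewrite lerD2r powRM //.
  rewrite ler_wpM2r ?powR_ge0 // ler1_powR //; [lra|exact: ltW].
have := ler_wpM2l kap0 Jp; rewrite /Q; lra.
Qed.

Lemma inv_sqr_sum n : \sum_(j < n) ((1 + j%:R) ^+ 2)^-1 <= 2 :> R.
Proof.
suff H k : \sum_(j < k.+1) ((1 + j%:R) ^+ 2)^-1 <= 2 - (1 + k%:R)^-1 :> R.
  case: n => [|n]; first by rewrite big_ord0.
  by apply: (le_trans (H n)); rewrite gerBl invr_ge0 addr_ge0.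
elim: k => [|k ih]; first by rewrite big_ord_recl big_ord0 /= !addr0 expr1n invr1; lra.
rewrite big_ord_recr /=; set t : R := 1 + k%:R.
have t1 : 1 <= t by rewrite lerDl.
have -> : 1 + k.+1%:R = t + 1 :> R by rewrite -[k.+1%:R]natr1 /t; ring.
have : ((t + 1) ^+ 2)^-1 <= t^-1 - (t + 1)^-1.
  have -> : t^-1 - (t + 1)^-1 = (t * (t + 1))^-1 by field; apply/andP; split; lra.
  have tt : 0 < t * (t + 1) by apply: mulr_gt0; lra.
  have le : t * (t + 1) <= (t + 1) ^+ 2 by rewrite expr2; nra.
  by rewrite lef_pV2 // posrE; apply: lt_le_trans le.
move: ih; rewrite -/t; lra.
Qed.

End Weights.

(** * The product over the divisor *)

Section DivisorCounting.
Variable R : realType.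
Local Notation C := R[i].
Variable D : divisor R.
Implicit Types (L : seq C) (x r h : R).

Lemma count_le x r h E L : (lne (n_ D x r h) <= E%:E)%E -> uniq L ->
  (forall z, z \in L -> inbox x r h z) -> (\sum_(z <- L) D z)%N%:R <= expR E.
Proof.
move=> HE uL HL; set u : R := _%:R.
have [u0|u0] := leP u 0; first by rewrite (le_trans u0) // expR_ge0.
have un := seq_le_n D uL HL.
have lu : (lne u%:E <= lne (n_ D x r h))%E.
  rewrite lee_lne // in_itv /= ?leey andbT; first by rewrite lee_fin ltW.
  by apply: le_trans un; rewrite lee_fin ltW.
have := le_trans lu HE; rewrite lne_EFin // lee_fin => h1.
by rewrite -[u](@lnK R) ?posrE // ler_expR.
Qed.

(** Each point of the support counts at least once, so the support is finite in every disc and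
    therefore countable. *)
Lemma support_injection :
  (forall r, exists K : R, forall L, uniq L -> (forall a, a \in L -> cmod a <= r) ->
     (\sum_(a <- L) D a)%N%:R <= K) ->
  exists f : C -> nat, forall a b, D a != 0%N -> D b != 0%N -> f a = f b -> a = b.
Proof.
move=> H.
have /countable_injP[f fi] : countable [set a | D a != 0%N].
  have -> : [set a | D a != 0%N] =
      \bigcup_(n in [set: nat]) [set a | D a != 0%N /\ cmod a <= n%:R].
    apply/seteqP; split=> [a /= Da|a [n _ [] //]].
    exists (Num.truncn (cmod a)).+1 => //; split=> //.
    by have /andP[_ /ltW] := truncn_itv (cmod_ge0 a).
  apply: bigcup_countable => // n _; apply: finite_set_countable.
  apply: contrapT => inf; have [K HK] := H n%:R.
  have [B BS Bn] := infinite_set_fset (Num.truncn `|K|).+1 inf.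
  have := HK (finmap.enum_fset B) (finmap.fset_uniq B) (fun a aB => (BS a aB).2).
  apply/negP; rewrite -ltNge.
  have /andP[_ k1] := truncn_itv (normr_ge0 K).
  apply: (le_lt_trans (ler_norm K)); apply: (lt_le_trans k1).
  rewrite ler_nat; apply: (leq_trans Bn).
  rewrite -sum1_size big_seq [leqRHS]big_seq; apply: leq_sum => a aB.
  by rewrite lt0n; have [] := BS a aB.
by exists f => a b Da Db; apply: fi; rewrite inE.
Qed.

(** The weight depends on the cell only, so product bounds on the cells sum to a product of sums. A
    finite list meets cells with indices at most [n] only, which makes the double sum finite. *)
Lemma cell_sum (c : C -> nat * nat) (wt : nat -> nat -> R) (K U V : R) (u v : nat -> R) :
  0 <= K -> (forall j, 0 <= u j) -> (forall l, 0 <= v l) ->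
  (forall n, \sum_(j < n) u j <= U) -> (forall n, \sum_(l < n) v l <= V) ->
  (forall j l L, uniq L -> (forall a, a \in L -> c a = (j, l)) ->
     (\sum_(a <- L) D a)%N%:R * wt j l <= K * (u j * v l)) ->
  forall L, uniq L -> \sum_(a <- L) (D a)%:R * wt (c a).1 (c a).2 <= K * (U * V).
Proof.
move=> K0 u0 v0 HU HV H L uL.
pose n := (\sum_(a <- L) ((c a).1 + (c a).2))%N.
have cn a : a \in L -> ((c a).1 < n.+1)%N /\ ((c a).2 < n.+1)%N.
  move=> aL; rewrite !ltnS /n (big_rem a aL) /=.
  by split; rewrite -!addnA; [rewrite leq_addr|rewrite addnCA leq_addr].
pose k a : 'I_n.+1 * 'I_n.+1 := (inord (c a).1, inord (c a).2).
rewrite (partition_big k xpredT) //=.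
apply: (@le_trans _ _ (\sum_(q : 'I_n.+1 * 'I_n.+1) K * (u q.1 * v q.2))).
  apply: ler_sum => -[j l] _ /=.
  rewrite -big_filter big_seq (eq_bigr (fun a => (D a)%:R * wt j l)); last first.
    move=> a; rewrite mem_filter => /andP[/eqP[<- <-] /cn[h1 h2]].
    by rewrite !inordK.
  rewrite -big_seq -mulr_suml -natr_sum; apply: H; first by rewrite filter_uniq.
  move=> a; rewrite mem_filter => /andP[/eqP[<- <-] /cn[h1 h2]].
  by rewrite !inordK // -surjective_pairing.
rewrite -mulr_sumr ler_wpM2l // -(pair_bigA _ (fun j l : 'I_n.+1 => u j * v l)) /=.
rewrite (eq_bigr (fun j : 'I_n.+1 => u j * \sum_(l < n.+1) v l)); last by move=> j _; rewrite mulr_sumr.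
rewrite -mulr_suml; apply: ler_pM; [exact: sumr_ge0|exact: sumr_ge0|exact: HU|exact: HV].
Qed.

End DivisorCounting.

Section DivisorProduct.
Variable R : realType.
Local Notation C := R[i].
Implicit Types (L : seq C) (x r h : R).

(* The factor of a decays where Re (rot a * (z - a)) is large, that is, on the
   side of the line Im z = Im a that contains the real axis. *)
Definition rot (a : C) : C := if 0 <= complex.Im a then 'i else - 'i.

Lemma cmod_rot (a z : C) : cmod (rot a * z) = cmod z.
Proof. by rewrite cmodM /rot; case: ifP => _; rewrite ?cmodN cmod_i mul1r. Qed.

Lemma Re_rot (a z : C) : complex.Re (rot a * z) = - complex.Im z \/ complex.Re (rot a * z) = complex.Im z.
Proof.
rewrite /rot; case: ifP => _; [left|right]; rewrite cReM ?cReN ?cImN cRe_i cIm_i; ring.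
Qed.

Lemma normRe_rot (a z : C) : `|complex.Re (rot a * z)| = `|complex.Im z|.
Proof. by case: (Re_rot a z) => ->; rewrite ?normrN. Qed.

Lemma normIm_rot (a z : C) : `|complex.Im (rot a * z)| = `|complex.Re z|.
Proof.
rewrite /rot; case: ifP => _; rewrite cImM ?cReN ?cImN cRe_i cIm_i.
  by congr `|_|; ring.
by rewrite -normrN; congr `|_|; ring.
Qed.

(** Points above and below the axis are treated alike: the exponent -T Re s of a factor becomes at
    most T (|Im z| - |Im a|). *)
Lemma Re_rot_sub (a z : C) : `|complex.Im a| - `|complex.Im z| <= complex.Re (rot a * (z - a)).
Proof.
rewrite /rot; case: ifPn => [h|]; rewrite cReM ?cReN ?cImN cRe_i cIm_i cReD cImD cReN cImN.
  have := ler_norm (complex.Im z); rewrite (ger0_norm h); lra.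
rewrite -ltNge => h; have := ler_norm (- complex.Im z); rewrite normrN (ltr0_norm h); lra.
Qed.

(** A cell prescribes |Re a|, hence two boxes, one at x and one at -x. *)
Lemma cell_count (D : divisor R) (x h E : R) L : 0 <= x ->
  (lne (n_ D x 1 h) <= E%:E)%E -> (lne (n_ D (- x) 1 h) <= E%:E)%E ->
  uniq L -> (forall a, a \in L -> `|complex.Im a| <= h /\ x <= `|complex.Re a| <= x + 1) ->
  (\sum_(a <- L) D a)%N%:R <= 2 * expR E.
Proof.
move=> x0 h1 h2 uL HL.
rewrite (bigID (fun a : C => 0 <= complex.Re a)) /=.
have -> : 2 * expR E = expR E + expR E by ring.
rewrite [X in X <= _]natrD; apply: lerD; rewrite -big_filter.
  apply: (count_le h1); first exact: filter_uniq.
  move=> a; rewrite mem_filter => /andP[a0 /HL[ha]]; rewrite (ger0_norm a0) => /andP[k1 k2].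
  by split=> //; rewrite ger0_norm; lra.
apply: (count_le h2); first exact: filter_uniq.
move=> a; rewrite mem_filter -ltNge => /andP[a0 /HL[ha]]; rewrite (ltr0_norm a0) => /andP[k1 k2].
by split=> //; rewrite ler_norml; lra.
Qed.

Lemma expR_inv_sqr (p u : R) : 0 < p -> 0 < u -> expR (- (2 / p * u `^ p)) <= (u ^+ 2)^-1.
Proof.
move=> p0 u0; rewrite -[u ^+ 2](@lnK R) ?posrE ?exprn_gt0 // -expRN ler_expR lerN2.
rewrite lnXn // mulr2n; have := ln_powR_le p0 u0; rewrite [_ * u `^ p](_ : _ = u `^ p / p + u `^ p / p).
  by move=> k; apply: lerD.
by field; rewrite gt_eqF.
Qed.

Lemma divisor_product (D : divisor R) (rho sigma p c : R) (s : R -> R) :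
  1 < rho -> 0 <= sigma -> 0 < p -> p < 1 -> 0 <= c -> s t @[t --> +oo] --> sigma ->
  (forall x r h, 0 < r -> 0 < h ->
    (lne (n_ D x r h) <= (c + r + s h * h `^ rho + c * `|x| `^ p)%:E)%E) ->
  exists (P : C -> C) (Phi : R -> R) (A B : R) (E := fun z : C =>
      expR (Phi (`|complex.Im z| + 8) + `|complex.Im z| + A * `|complex.Re z| `^ p + B)),
  [/\ entire P, 0 <= A, 0 <= B & forall z, zero_of_order P z (D z)] /\
  [/\ forall h h', 0 <= h -> h <= h' -> Phi h <= Phi h',
      forall h, 0 <= h -> 0 <= Phi h,
      forall e, 0 < e -> evt (fun h => Phi h <= (sigma + e) * h `^ rho),
      forall z, cmod (P z) <= expR (E z) &
      forall z (del : R) (n : nat), 0 < del <= 1 ->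
        (forall a, D a != 0%N -> nearp z a -> del <= cmod (z - a)) ->
        (forall L, uniq L -> (forall a, a \in L -> D a != 0%N /\ nearp z a) ->
           (\sum_(a <- L) D a <= n)%N) ->
        expR (- E z) * del ^+ n <= cmod (P z)].
Proof.
move=> r1 sig0 p0 p1 c0 s_lim Hn.
have [h0 [phi [T [Phi [h00 T1 Hphi [Phi_ge Phi_mono Phi0 Phi_evt]]]]]] := weights_exist r1 sig0 s_lim.
(* The [c] cancels the growth of the number of points in |Re a|; the 2 / p leaves the summable (1 +
   j)^(-2) by [expR_inv_sqr]. *)
pose kap := c + 2 / p.
have kap0 : 0 <= kap by rewrite addr_ge0 // divr_ge0 // ltW.
have [A [B [A0 B0 Hk]]] := kappa_decay p0 p1 kap0.
pose cell (a : C) := (Num.truncn `|complex.Re a|, Num.truncn `|complex.Im a|).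
pose Q j : R := kap * (1 + j%:R) `^ p.
(* The term l pays for the [|complex.Re s|] of [factor_bound], here |Im z - Im a| <= |Im z| + l + 1.
   The 3 l contained in [phi] then still leaves e^(-2 l). *)
pose wt j l : R := expR (- phi l + l%:R - Q j).
pose w a := wt (cell a).1 (cell a).2.
pose N a := (Num.truncn (Q (cell a).1)).+1.
have wt0 j l : 0 < wt j l := expR_gt0 _.
(* The additive error of each factor is its own weight, so that the errors are summed along with the
   main terms. *)
have /choice[G HG] : forall a : C, exists g : C -> C, [/\ entire g, forall s, g s != 0,
    forall s, 1 <= `|complex.Re s| \/ 1 <= `|complex.Im s| ->
      logclose (factor_bound (T (cell a).2) (N a) (w a) s) (s * g s) 1 &
    forall s, `|complex.Re s| <= 1 -> `|complex.Im s| <= 1 ->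
      cmod (s * g s) <= expR (factor_bound (T (cell a).2) (N a) (w a) s) /\
      cmod s <= expR (factor_bound (T (cell a).2) (N a) (w a) s) * cmod (s * g s)].
  by move=> a; apply: factor_exists => //; exact: wt0.
pose g a z := rot a * G a (rot a * (z - a)).
have gm a z : (z - a) * g a z = rot a * (z - a) * G a (rot a * (z - a)) by rewrite /g; ring.
(* 5 = 4 + 1 collects the main term and the additive error. The 8 T of [factor_bound] moves the
   height from |Im z| to |Im z| + 8, and 9 is 8 plus the height 1 of a cell. *)
pose W (z : C) := 5 * expR (Phi (`|complex.Im z| + 8) + `|complex.Im z| + 9 + B + A * `|complex.Re z| `^ p).
have fb a z : factor_bound (T (cell a).2) (N a) (w a) (rot a * (z - a)) <= W z * w a.
  rewrite /factor_bound normIm_rot normRe_rot cReD cReN cImD cImN.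
  set y := complex.Im z; set x := complex.Re z.
  set l := (cell a).2; set j := (cell a).1; set Rs := complex.Re (rot a * _).
  have y8 : 0 <= `|y| + 8 by rewrite addr_ge0.
  have hk : kappa (N a) `|x - complex.Re a| <= expR (A * `|x| `^ p + B - Q j) := Hk x _.
  have lb : l%:R <= `|complex.Im a| < l%:R + 1.
    by rewrite natr1; exact: truncn_itv.
  have e1 : - T l * Rs + `|y - complex.Im a| + 8 * T l + 8 <= Phi (`|y| + 8) - phi l + `|y| + l%:R + 9.
    have k1 := Re_rot_sub a z; rewrite -/Rs -/y in k1.
    have k2 := ler_normB y (complex.Im a).
    have k3 := Phi_ge l _ y8.
    have k4 : - T l * Rs <= T l * (`|y| - l%:R).
      rewrite mulNr -mulrN; apply: ler_wpM2l; first by have := T1 l; lra.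
      by move: k1 lb => + /andP[? ?]; lra.
    move: k2 k3 k4 lb => + + + /andP[_ ?]; lra.
  have W1 : 1 <= expR (Phi (`|y| + 8) + `|y| + 9 + B + A * `|x| `^ p).
    rewrite -[X in X <= _]expR0 ler_expR.
    have := Phi0 _ y8; have : 0 <= A * `|x| `^ p by rewrite mulr_ge0 ?powR_ge0.
    have := normr_ge0 y; lra.
  have main : 4 * kappa (N a) `|x - complex.Re a| *
      expR (- T l * Rs + `|y - complex.Im a| + 8 * T l + 8) <=
      4 * (expR (Phi (`|y| + 8) + `|y| + 9 + B + A * `|x| `^ p) * w a).
    rewrite -mulrA ler_pM2l //.
    apply: (@le_trans _ _ (expR (A * `|x| `^ p + B - Q j) * expR (Phi (`|y| + 8) - phi l + `|y| + l%:R + 9))).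
      by apply: ler_pM; rewrite ?expR_ge0 ?kappa_ge0 // ler_expR.
    rewrite -!expRD ler_expR /w /wt -/l -/j; lra.
  have : w a <= expR (Phi (`|y| + 8) + `|y| + 9 + B + A * `|x| `^ p) * w a.
    by rewrite ler_peMl // ltW //; exact: wt0.
  rewrite /W -/y -/x -mulrA; lra.
have W0 z : 0 <= W z by rewrite mulr_ge0 // expR_ge0.
have c1 : 0 < 1 - expR (- 2) :> R by rewrite subr_gt0 -[X in _ < X]expR0 ltr_expR; lra.
pose S : R := 2 * expR (c + 1) * (2 * (1 - expR (- 2))^-1).
have S0 : 0 < S by rewrite /S; do ![apply: mulr_gt0]; rewrite ?expR_gt0 ?invr_gt0.
have ws L : uniq L -> \sum_(a <- L) (D a)%:R * w a <= S.
  apply: (@cell_sum _ _ cell wt _ _ _ (fun j => ((1 + j%:R) ^+ 2)^-1) (fun l => expR (- 2) ^+ l)).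
  - by rewrite mulr_ge0 // expR_ge0.
  - by move=> j; rewrite invr_ge0 exprn_ge0 // addr_ge0.
  - by move=> l; rewrite exprn_ge0 // expR_ge0.
  - exact: inv_sqr_sum.
  - move=> n; apply: geometric_le; first exact: expR_ge0.
    by rewrite -[X in _ < X]expR0 ltr_expR; lra.
  move=> j l L' uL' HL'.
  (* The height at which [Hphi] compares [phi] with s; the two boxes of this height contain the
     cell. *)
  pose t : R := l%:R + 1 + h0.
  have t0 : 0 < t by rewrite /t; have := ler0n R l; lra.
  have j0 := ler0n R j.
  pose E := c + 1 + s t * t `^ rho + c * j%:R `^ p.
  have H1 := Hn j%:R 1 t ltr01 t0; have H2 := Hn (- j%:R) 1 t ltr01 t0.
  rewrite normrN in H2; rewrite (ger0_norm j0) -/E in H1 H2.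
  have cnt : (\sum_(a <- L') D a)%N%:R <= 2 * expR E.
    apply: (cell_count j0 H1 H2 uL') => a /HL'[ja la].
    have /andP[k1 k2] := truncn_itv (normr_ge0 (complex.Re a)).
    have /andP[k3 k4] := truncn_itv (normr_ge0 (complex.Im a)).
    rewrite -natr1 ja in k2; rewrite -natr1 la in k4; rewrite ja in k1.
    by split; [rewrite /t; lra|rewrite k1 ltW].
  apply: (@le_trans _ _ (2 * expR E * wt j l)); first by rewrite ler_wpM2r // ltW.
  rewrite -!mulrA ler_pM2l // /wt -expRD.
  have J0 : 0 < 1 + j%:R :> R by lra.
  rewrite -expRM_natl.
  apply: (@le_trans _ _ (expR (c + 1) * (expR (- (2 / p * (1 + j%:R) `^ p)) * expR (l%:R * - 2)))); last first.
    rewrite ler_pM2l ?expR_gt0 // ler_pM2r ?expR_gt0 //; exact: expR_inv_sqr.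
  rewrite -!expRD ler_expR /E /Q /kap.
  have := Hphi l; rewrite -/t.
  have : c * j%:R `^ p <= c * (1 + j%:R) `^ p.
    by rewrite ler_wpM2l // powR_le //; [lra|exact: ltW].
  lra.
have ns r : exists K : R, forall L, uniq L -> (forall a, a \in L -> cmod a <= r) ->
    (\sum_(a <- L) D a)%N%:R <= K.
  pose r' := Num.max r 1; have r'0 : 0 < r' by rewrite lt_max ltr01 orbT.
  exists (expR (c + r' + s r' * r' `^ rho + c * `|0 : R| `^ p)) => L uL HL.
  apply: (count_le (Hn 0 r' r' r'0 r'0) uL) => z /HL zr.
  have rr : r <= r' by rewrite le_max lexx.
  split; rewrite ?subr0; [apply: le_trans (normRe_le z) _|apply: le_trans (normIm_le z) _]; exact: le_trans zr rr.
have [f finj] := support_injection ns.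
have [|||||P [PE Pub Pz Plb]] := @canonical_product R D f w W g S finj
  (fun a => ltW (wt0 _ _)) W0 _ _ _ _ _ ws ns.
- move=> r.
  pose r' := `|r|.
  exists (5 * expR (Phi (r' + 8) + r' + 9 + B + A * r' `^ p)); first by rewrite mulr_ge0 ?expR_ge0.
  move=> z zr; have rr : r <= r' := ler_norm r.
  have k1 : `|complex.Im z| <= r' := le_trans (normIm_le z) (le_trans zr rr).
  have k2 : `|complex.Re z| <= r' := le_trans (normRe_le z) (le_trans zr rr).
  apply: ler_wpM2l; rewrite ?ler_expR //.
  have : Phi (`|complex.Im z| + 8) <= Phi (r' + 8).
    by apply: Phi_mono; [rewrite addr_ge0|rewrite lerD2r].
  have : A * `|complex.Re z| `^ p <= A * r' `^ p.
    by rewrite ler_wpM2l // powR_le // ltW.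
  lra.
- move=> a; have [GE _ _ _] := HG a.
  exact (@entireZ R (rot a) _ (entire_comp GE (@entireZ R (rot a) _ (entireB (@entire_id R) (@entire_cst R a))))).
- move=> a z; have [_ G0 _ _] := HG a.
  by rewrite /g mulf_neq0 // /rot; case: ifP => _; rewrite ?oppr_eq0 -cmod_gt0 cmod_i.
- move=> a z faz; have [_ _ Hfar _] := HG a.
  rewrite gm; apply: logclose_le (fb a z) _; apply: Hfar.
  by rewrite normRe_rot normIm_rot; case: faz; [right|left].
- move=> a z /andP[n1 n2]; have [_ _ _ Hnear] := HG a.
  have [] := Hnear (rot a * (z - a)); rewrite ?normRe_rot ?normIm_rot ?(ltW n1) ?(ltW n2) //.
  rewrite -gm cmod_rot => b1 b2; split.
    by apply: (le_trans b1); rewrite ler_expR fb.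
  apply: (le_trans b2); apply: ler_wpM2r; first exact: cmod_ge0.
  by rewrite ler_expR; exact: fb.
(* The factor 5 S moves into the exponent as its logarithm; the absolute value keeps the constant
   nonnegative. *)
exists P, Phi, A, `|9 + B + ln (5 * S)|; move=> E.
have WE z : W z * S <= E z.
  have S5 : 5 * S = expR (ln (5 * S)) by rewrite lnK // posrE mulr_gt0.
  rewrite /W (mulrAC 5 _ S) S5 -(expRD (ln (5 * S))) ler_expR.
  have := ler_norm (9 + B + ln (5 * S)); lra.
split; first by split.
split=> //.
  by move=> z; apply: (le_trans (Pub z)); rewrite ler_expR.
move=> z del n d01 Hd Hc; apply: le_trans (Plb z del n d01 Hd Hc).
rewrite ler_wpM2r ?ler_expR ?lerN2 //.
by rewrite exprn_ge0 //; move: d01 => /andP[/ltW].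
Qed.
End DivisorProduct.

(** * Growth and lower bound *)

Section UpperBound.
Variable R : realType.
Variables (rho sigma p p' p'' m K kap BG AG A B k0 : R) (Phi : R -> R).
Implicit Types (e h x y v u q : R).

Lemma shifted_evt (r1 : 1 < rho) (sig0 : 0 <= sigma) (Phi_evt : forall e, 0 < e -> evt (fun h => Phi h <= (sigma + e) * h `^ rho)) e : 0 < e -> evt (fun h => Phi (h + 8) + h + B <= (sigma + e) * h `^ rho).
Proof.
move=> e0; have e4 : 0 < e / 4 by lra.
have se : 0 < sigma + e / 4 by lra.
have d0 : 0 < e / 4 / (sigma + e / 4) by rewrite divr_gt0.
have r0 : 0 < rho by lra.
have E1 := evt_shift (ler0n R 8) (Phi_evt _ e4).
have E2 := evt_powR_shift r0 (ler0n R 8) d0.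
have E3 := evt_powR_small (ler01 : 0 <= (1 : R)) r1 (ler01 : 0 <= (1 : R)) (lexx 0) e4.
have E4 := evt_cst_small B r0 e4.
apply: evt_mono (evt_and (evt_and E1 E2) (evt_and E3 E4)) => h h0 [[a1 a2] [a3 a4]].
rewrite addr0 mul1r powRr1 in a3; last exact: ltW.
have : (sigma + e / 4) * (h + 8) `^ rho <= (sigma + e / 4 + e / 4) * h `^ rho.
  apply: (le_trans (ler_wpM2l (ltW se) a2)); rewrite mulrA ler_wpM2r ?powR_ge0 //.
  by rewrite mulrDr mulr1 [_ * (_ / _ / _)]mulrC divfK // gt_eqF.
lra.
Qed.

Lemma powR_m (m1 : (1 - p'') * m = 1) u q : 0 <= u -> (u `^ (1 - p'')) `^ (m * q) = u `^ q.
Proof. by move=> u0; rewrite -powRrM mulrA m1 mul1r. Qed.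

Lemma sum_norm_ge (a b c d : R) (S := `|a| + `|b| + `|c| + `|d| + 2) :
  [/\ a <= S, b <= S, c <= S, d <= S & 2 <= S].
Proof.
have := ler_norm a; have := ler_norm b; have := ler_norm c; have := ler_norm d.
have := normr_ge0 a; have := normr_ge0 b; have := normr_ge0 c; have := normr_ge0 d.
by rewrite /S => *; split; lra.
Qed.

Lemma exponent_aux (a b c s t H : R) : a <= (s + t / 4) * H -> b <= t / 4 * H + c ->
  c <= t / 16 * H -> 0 <= t * H -> a + b <= (s + 3 / 4 * t) * H.
Proof. lra. Qed.

(** Since 3 <= e^2, a gap of 2 between the exponents absorbs a sum of three terms. *)
Lemma three_expR_le (k X Y E w : R) : k <= 1 + X -> 2 + X <= Y ->
  E <= expR X -> w <= expR X -> k + E + w <= expR Y.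
Proof.
move=> kX XY EX wX.
have k3 : k <= expR X by apply: le_trans kX (expR_ge1Dx _).
have e23 : 3 <= expR 2 :> R by have := expR_ge1Dx (2 : R); lra.
have le3 : 3 * expR X <= expR Y.
  apply: (@le_trans _ _ (expR 2 * expR X)); first by rewrite ler_wpM2r ?expR_ge0.
  by rewrite -expRD ler_expR.
by apply: le_trans le3; lra.
Qed.

Lemma exponent_room (s e H : R) : 0 <= s * H -> 0 <= e * H ->
  [/\ e / 16 * H <= e / 4 * H, e / 16 * H + e / 8 * H <= (s + 3 / 4 * e) * H,
      2 <= e / 16 * H -> 2 + (s + 3 / 4 * e) * H <= (s + e) * H &
      forall k, k <= e / 16 * H -> k <= 1 + (s + 3 / 4 * e) * H].
Proof. by move=> *; split=> [||?|k ?]; lra. Qed.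

(** Here a = A |x|^p, u = |x|^p' and c is the rate of damping. Either u is large against H1 and
    damping wins, or u is bounded by a multiple of H1 and a is then only a small fraction d of H1,
    up to constants. *)
Lemma far_dichotomy (a u H1 C1 Cd d c : R) : 0 <= d ->
  a <= c / 2 * u + C1 -> a <= c / 2 * d * u + Cd ->
  H1 + a <= c * u \/ a <= d * (H1 + C1) + Cd.
Proof.
move=> d0 h1 h2; have [big|small] := leP (H1 + C1) (c / 2 * u); [left; lra|right].
apply: (le_trans h2); rewrite lerD2r (_ : c / 2 * d * u = d * (c / 2 * u)); last by ring.
by rewrite ler_wpM2l // ltW.
Qed.

(** v stands for BG Re G at x + iy. In the damped region [far_dichotomy] decides between
    cancellation and a negligible A |x|^p. Elsewhere |x| < 1 or |x| < (K h)^m, and m p < m p'' < rho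
    makes |x|^p and |x|^p'' negligible against h^rho, the latter in the upper bound of -v. *)
Lemma growth_real (r1 : 1 < rho) (sig0 : 0 <= sigma) (p0 : 0 < p) (pp' : p < p') (pp'' : p' < p'') (p''1 : p'' < 1) (m0 : 0 < m) (m1 : (1 - p'') * m = 1) (mpr'' : m * p'' < rho) (K0 : 0 < K) (kap0 : 0 < kap) (BG0 : 0 < BG) (AG0 : 0 <= AG) (A0 : 0 <= A) (B0 : 0 <= B) (k00 : 0 <= k0) (Phi_mono : forall h h' : R, 0 <= h -> h <= h' -> Phi h <= Phi h') (Phi0 : forall h, 0 <= h -> 0 <= Phi h) (Phi_evt : forall e, 0 < e -> evt (fun h => Phi h <= (sigma + e) * h `^ rho)) e : 0 < e -> evt (fun h => forall x y v : R, `|y| <= h ->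
  (1 <= `|x| -> K * `|y| <= `|x| `^ (1 - p'') -> expR (kap * `|x| `^ p') <= v) ->
  - v <= BG * expR (AG * (`|x| + `|y|) `^ p'') ->
  k0 + expR (Phi (`|y| + 8) + `|y| + A * `|x| `^ p + B) - v <= expR ((sigma + e) * h `^ rho)).
Proof.
move=> e0; have e4 : 0 < e / 4 by lra.
have r0 : 0 < rho by lra.
have se : 0 < sigma + e / 4 by lra.
have k2 : 0 < kap / 2 by lra.
have [C1 C10 HC1] := powR_dominated p0 pp' A0 k2.
(* d times (sigma + e / 4) h^rho is e / 4 h^rho, the part of the error reserved for A |x|^p. *)
pose d := e / 4 / (sigma + e / 4).
have d0 : 0 < d by rewrite divr_gt0.
have dk : 0 < kap / 2 * d by rewrite mulr_gt0.
have [Cd Cd0 HCd] := powR_dominated p0 pp' A0 dk.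
have p''0 : 0 < p'' by rewrite (lt_trans p0) // (lt_trans pp').
have mpr : m * p < rho.
  by apply: lt_trans mpr''; rewrite ltr_pM2l // (lt_trans pp').
have q1 : 0 <= A * K `^ (m * p) by rewrite mulr_ge0 ?powR_ge0.
have q2 : 0 <= AG * K `^ (m * p'') by rewrite mulr_ge0 ?powR_ge0.
have e16 : 0 < e / 16 by lra.
have mp0 : 0 <= m * p by rewrite mulr_ge0 // ltW.
have mp''0 : 0 <= m * p'' by rewrite mulr_ge0 // ltW.
have F1 := shifted_evt r1 sig0 Phi_evt e4.
have F2 := evt_cst_small (k0 + d * C1 + Cd + A + ln BG + AG + 2) r0 e16.
have F3 := evt_powR_small mp0 mpr q1 (lexx 0) e16.
have F4 := evt_powR_small mp''0 mpr'' q2 (lexx 0) e16.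
have F5 := evt_powR_small (ltW p''0) (lt_trans p''1 r1) AG0 (lexx 0) e16.
(* The sum of absolute values dominates each of these constants at once, through [sum_norm_ge]. *)
have F6 := evt_cst_small (`|k0| + `|d * C1 + Cd| + `|A| + `|ln BG + AG| + 2) r0 e16.
have F := evt_and (evt_and F1 F6) (evt_and F3 (evt_and F4 F5)).
apply: evt_mono F => h h0 [[a1 a2] [a3 [a4 a5]]] x y v yh Hv Hv'.
rewrite !addr0 in a3 a4 a5.
set H := h `^ rho in a1 a2 a3 a4 a5 *.
have H0 : 0 <= H := powR_ge0 _ _.
have sH : 0 <= sigma * H by rewrite mulr_ge0.
have eH : 0 <= e * H by rewrite mulr_ge0 // ltW.
have [eH16 eH8 room2 room1] := exponent_room sH eH.
set H1 := Phi (h + 8) + h + B in a1.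
have H1_ge : Phi (`|y| + 8) + `|y| + B <= H1.
  by rewrite /H1 lerD2r lerD // Phi_mono ?addr_ge0 // lerD2r.
set X := (sigma + 3 / 4 * e) * H.
have [j1 j2 j3 j4 j5] := sum_norm_ge k0 (d * C1 + Cd) A (ln BG + AG).
have {j1}k_le := le_trans j1 a2; have {j2}d_le := le_trans j2 a2.
have {j3}A_le := le_trans j3 a2; have {j4}g_le := le_trans j4 a2; have {j5}le2 := le_trans j5 a2.
have fin E w : E <= expR X -> w <= expR X -> k0 + E + w <= expR ((sigma + e) * H).
  exact: three_expR_le (room1 _ k_le) (room2 le2).
have yE : Phi (`|y| + 8) + `|y| + A * `|x| `^ p + B = Phi (`|y| + 8) + `|y| + B + A * `|x| `^ p by rewrite addrAC.
have dE : d * (sigma + e / 4) = e / 4 by rewrite /d divfK // gt_eqF.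
have [/andP[x1 Ky]|nc] := boolP ((1 <= `|x|) && (K * `|y| <= `|x| `^ (1 - p''))).
  have v0 := Hv x1 Ky.
  have [small|Ax] := far_dichotomy H1 (ltW d0) (HC1 _ (normr_ge0 x)) (HCd _ (normr_ge0 x)).
    rewrite -addrA -[k0 + _]addr0; apply: fin; last exact: expR_ge0.
    apply: le_trans (expR_ge0 X); rewrite subr_le0; apply: le_trans v0; rewrite ler_expR yE.
    by apply: le_trans small; rewrite lerD2r.
  apply: fin; last first.
    by apply: le_trans (expR_ge0 X); rewrite oppr_le0; apply: le_trans v0; exact: expR_ge0.
  rewrite ler_expR /X yE.
  apply: (@exponent_aux _ _ (d * C1 + Cd)) eH; first exact: le_trans H1_ge a1.
    apply: (le_trans Ax); rewrite mulrDr addrA lerD2r lerD2r.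
    by rewrite -dE -[leRHS]mulrA ler_pM2l.
  exact: d_le.
have Kh : 0 <= K * h by rewrite mulr_ge0 // ltW.
(* Outside the damped region: raising |x|^(1 - p'') < K h to the power m q gives |x|^q, because (1 -
   p'') m = 1. *)
have xq q : 0 < q -> `|x| `^ q <= 1 + (K * h) `^ (m * q).
  move=> q0; move: nc; rewrite negb_and -!ltNge => /orP[x1|xK].
    apply: (@le_trans _ _ 1); last by rewrite lerDl powR_ge0.
    have e1 : 1 `^ q = 1 :> R by rewrite powR1.
    by rewrite -[X in _ <= X]e1; apply: powR_le; [exact: normr_ge0|exact: ltW|exact: ltW].
  rewrite -(powR_m m1 q (normr_ge0 x)); apply: (@le_trans _ _ ((K * h) `^ (m * q))); last by rewrite lerDr.
  apply: powR_le; first exact: powR_ge0.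
    by apply: ltW; apply: (lt_le_trans xK); rewrite ler_wpM2l // ltW.
  by rewrite mulr_ge0 // ltW.
have hK q : (K * h) `^ q = K `^ q * h `^ q by rewrite powRM // ltW.
have Ax : A * `|x| `^ p <= A + e / 16 * H.
  apply: (le_trans (ler_wpM2l A0 (xq p p0))); rewrite hK.
  rewrite mulrDr mulr1 lerD2l mulrA; exact: a3.
apply: fin.
  rewrite ler_expR /X yE.
  apply: (@exponent_aux _ _ A) A_le eH; first exact: le_trans H1_ge a1.
  by apply: (le_trans Ax); rewrite addrC lerD2r.
have y0 := normr_ge0 y.
have Gx : AG * (`|x| + `|y|) `^ p'' <= AG + e / 8 * H.
  have b1 : (`|x| + `|y|) `^ p'' <= 1 + (K * h) `^ (m * p'') + h `^ p''.
    apply: (le_trans (powR_subadd (normr_ge0 x) y0 p''0 (ltW p''1))).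
    apply: lerD; first exact: xq.
    by apply: powR_le => //; exact: ltW.
  apply: (le_trans (ler_wpM2l AG0 b1)); rewrite hK.
  rewrite (_ : AG * _ = AG + (AG * K `^ (m * p'') * h `^ (m * p'') + AG * h `^ p'')); last by ring.
  rewrite (_ : e / 8 * H = e / 16 * H + e / 16 * H); last by field.
  by rewrite lerD2l; apply: lerD.
apply: (le_trans Hv'); rewrite -[X in X * _](@lnK R) ?posrE // -expRD ler_expR /X.
apply: (le_trans (lerD (lexx _) Gx)); rewrite addrA.
exact: le_trans (lerD g_le (lexx _)) eH8.
Qed.

End UpperBound.

(** * Lower bound near every point of the real line *)

Section RealLowerBound.
Variable R : realType.
Local Notation C := R[i].
Implicit Types (L : seq C) (x t u : R).

Lemma avoid_points (D : divisor R) x n :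
  (forall L, uniq L -> (forall a, a \in L -> inbox x 2 1 a) -> (\sum_(a <- L) D a <= n)%N) ->
  exists t, `|x - t| <= 1 /\
    forall a, D a != 0%N -> nearp t%:C a -> n.+1%:R^-1 <= cmod (t%:C - a).
Proof.
move=> H; pose d : R := n.+1%:R^-1.
have n0 : 0 < n.+1%:R :> R by rewrite ltr0n.
have d0 : 0 < d by rewrite invr_gt0.
pose t_ (k : 'I_n.+1) := x - 1 + (2 * k%:R + 1) * d.
have tk k : `|x - t_ k| <= 1.
  have k1 : 2 * k%:R + 2 <= 2 * n.+1%:R :> R.
    by rewrite -[leLHS](_ : 2 * (k%:R + 1) = _) ?ler_pM2l ?natr1 ?ler_nat //; ring.
  have k0 : 0 <= k%:R :> R by [].
  have k2 : (2 * k%:R + 1) * d <= 2.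
    by rewrite ler_pdivrMr //; lra.
  have k3 : 0 <= (2 * k%:R + 1) * d by rewrite mulr_ge0 ?addr_ge0 ?mulr_ge0 // ltW.
  by rewrite /t_ ler_norml; apply/andP; split; lra.
apply: contrapT => /forallNP no.
have /choice[a Ha] : forall k, exists a : C,
    [/\ D a != 0%N, nearp (t_ k)%:C a & `|t_ k - complex.Re a| < d].
  move=> k; apply: contrapT => /forallNP nok; apply: (no (t_ k)); split=> // a Da na.
  rewrite leNgt; apply/negP => lt; apply: (nok a); split=> //.
  by apply: le_lt_trans lt; have := normRe_le ((t_ k)%:C - a); rewrite cReD cReN cReC.
have ainj : injective a.
  move=> k l akl; have [_ _ h1] := Ha k; have [_ _ h2] := Ha l.
  rewrite akl in h1; apply/eqP; rewrite -val_eqE /= eqn_leq.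
  have key (i j : 'I_n.+1) : `|t_ i - complex.Re (a l)| < d -> `|t_ j - complex.Re (a l)| < d -> (i <= j)%N.
    move=> g1 g2; rewrite leqNgt; apply/negP => ji.
    have : t_ i - t_ j < 2 * d.
      by move: g1 g2; rewrite !ltr_norml => /andP[? ?] /andP[? ?]; lra.
    have -> : t_ i - t_ j = 2 * ((i%:R - j%:R) * d) by rewrite /t_; ring.
    rewrite ltr_pM2l // gtr_pMl // => lt1.
    have : j.+1%:R <= i%:R :> R by rewrite ler_nat.
    by rewrite -natr1; lra.
  by rewrite !key.
pose L := [seq a k | k <- enum 'I_n.+1].
have uL : uniq L by rewrite map_inj_uniq // enum_uniq.
have := H L uL; apply/not_implyP; split.
  move=> _ /mapP[k _ ->]; have [_ /andP[]] := Ha k.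
  rewrite cReD cReN cReC cImD cImN cImC add0r normrN => h1 /ltW h2 _; split=> //.
  have h3 := tk k; have := ler_distD (t_ k) (complex.Re (a k)) x.
  by rewrite [X in _ <= X + _]distrC [X in _ <= _ + X]distrC; lra.
apply/negP; rewrite -ltnNge big_map.
apply: (@leq_trans (\sum_(k <- enum 'I_n.+1) 1)%N); first by rewrite sum1_size size_enum_ord.
by apply: leq_sum => k _; rewrite lt0n; have [] := Ha k.
Qed.

Lemma powR_near (p q x t : R) : 0 < p -> p <= q -> q <= 1 -> `|x - t| <= 1 ->
  `|t| `^ p <= `|x| `^ q + 2.
Proof.
move=> p0 pq q1 xt; have p1 := le_trans pq q1.
have one r : 1 `^ r = 1 :> R by rewrite powR1.
have tx : `|t| <= `|x| + 1 by have := ler_distD x t 0; rewrite !subr0 distrC; lra.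
have h1 : `|t| `^ p <= `|x| `^ p + 1.
  apply: (le_trans (powR_le (normr_ge0 t) tx (ltW p0))).
  by apply: (le_trans (powR_subadd (normr_ge0 x) ler01 p0 p1)); rewrite one.
suff : `|x| `^ p <= `|x| `^ q + 1 by lra.
have [x1|x1] := leP 1 `|x|.
  by apply: (le_trans (ler_powR x1 pq)); rewrite lerDl.
apply: (@le_trans _ _ 1); last by rewrite lerDr powR_ge0.
by rewrite -[X in _ <= X](one p); apply: powR_le; [exact: normr_ge0|exact: ltW|exact: ltW].
Qed.

(** At most M = exp (e0 + c |x|^p) points lie near x, and t keeps distance 1 / (n + 1) from them.
    The loss (n + 1)^(-n) >= e^(-n^2) >= e^(-M^2) is of the admissible form, with doubled
    constants. *)
Lemma product_lower (D : divisor R) (P : C -> C) (E : C -> R) (p q c e0 A Bq : R) :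
  0 < p -> p <= q -> q <= 1 -> 0 <= c -> 0 <= e0 -> 0 <= A -> 0 <= Bq ->
  (forall x L, uniq L -> (forall a, a \in L -> inbox x 2 1 a) ->
     (\sum_(a <- L) D a)%N%:R <= expR (e0 + c * `|x| `^ p)) ->
  (forall t, E t%:C <= expR (Bq + A * `|t| `^ p)) ->
  (forall z (del : R) (n : nat), 0 < del <= 1 ->
        (forall a, D a != 0%N -> nearp z a -> del <= cmod (z - a)) ->
        (forall L, uniq L -> (forall a, a \in L -> D a != 0%N /\ nearp z a) ->
           (\sum_(a <- L) D a <= n)%N) ->
        expR (- E z) * del ^+ n <= cmod (P z)) ->
  exists b1 b2 : R, [/\ 0 <= b1, 0 <= b2 & forall x, exists2 t, `|x - t| <= 1 &
    expR (- (2 * expR (b1 + b2 * `|x| `^ q))) <= cmod (P t%:C)].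
Proof.
move=> p0 pq q1 c0 e00 A0 Bq0 Hcnt HE HP.
exists (Bq + 2 * A + 2 * e0 + 4 * c), (A + 2 * c); split=> [||x]; first by lra.
  by lra.
set b1 := Bq + _ + _ + _; set b2 := A + _.
set u := `|x| `^ q; have u0 : 0 <= u := powR_ge0 _ _.
pose M := expR (e0 + c * `|x| `^ p); pose n := Num.truncn M.
have cnt L : uniq L -> (forall a, a \in L -> inbox x 2 1 a) -> (\sum_(a <- L) D a <= n)%N.
  by move=> uL HL; rewrite truncn_ge_nat ?Hcnt // expR_ge0.
have [t [xt ta]] := avoid_points cnt.
exists t => //.
have del01 : 0 < (n.+1%:R^-1 : R) <= 1.
  by rewrite invr_gt0 ltr0n /= invf_le1 ?ltr0n // ler1n.
have near_cnt L : uniq L -> (forall a, a \in L -> D a != 0%N /\ nearp t%:C a) ->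
    (\sum_(a <- L) D a <= n)%N.
  move=> uL HL; apply: cnt => // a /HL[_ /andP[]].
  rewrite cReD cReN cReC cImD cImN cImC add0r normrN => h1 /ltW h2; split=> //.
  have := ler_distD t (complex.Re a) x; rewrite [X in _ <= X + _]distrC [X in _ <= _ + X]distrC; lra.
apply: le_trans (HP t%:C _ n del01 ta near_cnt).
have nM : n%:R <= M by have /andP[] := truncn_itv (expR_ge0 (e0 + c * `|x| `^ p)).
have dn : expR (- (n%:R * n%:R)) <= n.+1%:R^-1 ^+ n :> R.
  rewrite -mulrN expRM_natl; apply: lerXn2r; rewrite ?nnegrE ?expR_ge0 ?invr_ge0 //.
  rewrite expRN lef_pV2 ?posrE ?expR_gt0 ?ltr0n // -natr1 addrC.
  exact: expR_ge1Dx.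
apply: (@le_trans _ _ (expR (- E t%:C) * expR (- (n%:R * n%:R)))); last first.
  by rewrite ler_pM2l ?expR_gt0.
rewrite -expRD ler_expR -opprD lerN2.
rewrite (_ : 2 * _ = expR (b1 + b2 * u) + expR (b1 + b2 * u)); last by ring.
have Au : 0 <= A * u by rewrite mulr_ge0.
have cu : 0 <= c * u by rewrite mulr_ge0.
apply: lerD.
  apply: (le_trans (HE t)); rewrite ler_expR /b1 /b2.
  apply: (le_trans (lerD (lexx Bq) (ler_wpM2l A0 (powR_near p0 pq q1 xt)))); rewrite -/u -subr_ge0.
  rewrite (_ : _ - _ = 2 * e0 + 4 * c + 2 * (c * u)); last by ring.
  by rewrite !addr_ge0 // mulr_ge0.
apply: (@le_trans _ _ (M * M)); first exact: ler_pM.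
rewrite -expRD ler_expR /b1 /b2.
have xx : `|x - x| <= 1 by rewrite subrr normr0.
have K := lerD (lexx e0) (ler_wpM2l c0 (powR_near p0 pq q1 xx)).
apply: (le_trans (lerD K K)); rewrite -/u -subr_ge0.
rewrite (_ : _ - _ = Bq + 2 * A + A * u); last by ring.
by rewrite !addr_ge0 // mulr_ge0.
Qed.

(** For e^u >= K3 the factor is absorbed by raising the rate by 1; for smaller u the left side is at
    most k0. The lower bound that defines the class admits no factor in front of its exponential, so
    K3 has to go. *)
Lemma absorb_exponent (K3 b2 : R) : 0 < K3 -> 0 <= b2 -> exists2 k0 : R, 0 <= k0 &
  forall u, 0 <= u -> K3 * expR (b2 * u) <= k0 + expR ((b2 + 1) * u).
Proof.
move=> K30 b20; exists (K3 * expR (b2 * ln K3)); first by rewrite mulr_ge0 ?expR_ge0 ?ltW.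
move=> u u0; have [big|small] := leP K3 (expR u).
  rewrite mulrDl mul1r expRD [leRHS]addrC -[leLHS]addr0; apply: lerD.
    by rewrite mulrC ler_wpM2l ?expR_ge0.
  by rewrite mulr_ge0 ?expR_ge0 ?ltW.
have ul : u <= ln K3 by rewrite -[u]expRK ler_ln ?posrE ?expR_gt0 ?ltW.
rewrite -[leLHS]addr0; apply: lerD; last exact: expR_ge0.
by apply: ler_wpM2l; [exact: ltW|rewrite ler_expR; exact: ler_wpM2l].
Qed.

End RealLowerBound.

(** * The entire function with the given divisor *)

Section Sufficiency.
Variable R : realType.
Local Notation C := R[i].

Lemma lne_mono (x y : \bar R) : (x <= y)%E -> (lne x <= lne y)%E.
Proof.
move=> xy; have [x0|x0] := leP x 0%E; first by rewrite le0_lneNy ?leNye.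
by rewrite lee_lne // in_itv /= leey andbT ltW // (lt_le_trans x0).
Qed.

Lemma growth_class_intro (rho sigma : R) (f : C -> C) : entire f ->
  (forall e : R, 0 < e -> evt (fun h : R => forall z, `|complex.Im z| <= h ->
     cmod (f z) <= expR (expR ((sigma + e) * h `^ rho)))) ->
  growth_class rho sigma f.
Proof.
move=> fE H; split; first exact fE.
  move=> h h0; have [h1 h10 H1] := H 1 ltr01.
  apply: (@le_lt_trans _ _ (expR (expR ((sigma + 1) * (Num.max h h1) `^ rho)))%:E); last exact: ltry.
  apply: ge_ereal_sup => _ [z zh <-]; rewrite lee_fin; apply: H1; first by rewrite le_max lexx orbT.
  by rewrite le_max zh.
apply: evt_limf_esup => e e0; apply: evt_mono (H e e0) => h h0 Hh.
have MX : (M_ f h <= (expR (expR ((sigma + e) * h `^ rho)))%:E)%E.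
  by apply: ge_ereal_sup => _ [z zh <-]; rewrite lee_fin; exact: Hh.
have := lne_mono (lne_mono MX); rewrite lne_EFin ?expR_gt0 // expRK lne_EFin ?expR_gt0 // expRK => h1.
have hr : 0 < h `^ rho by rewrite powR_gt0.
have hi : (0 <= ((h `^ rho)^-1)%:E)%E by rewrite lee_fin invr_ge0 ltW.
apply: (le_trans (lee_wpmul2r hi h1)).
by rewrite -EFinM mulfK // gt_eqF.
Qed.

Lemma exponent_lt (rho a b : R) : 0 < a -> a < b -> b < rho ->
  (rho - b) / (1 + rho - b) < (rho - a) / (1 + rho - a).
Proof.
move=> a0 ab br; rewrite ltr_pdivrMr; last lra.
rewrite mulrAC ltr_pdivlMr; last lra.
nra.
Qed.

Lemma sufficiency (D : divisor R) (rho sigma : R) : 1 < rho -> 0 <= sigma ->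
  (exists (eps C : R) (s : R -> R),
     [/\ 0 < eps < rho, 0 < C, s t @[t --> +oo%R] --> sigma &
       forall x r h : R, 0 < r -> 0 < h ->
         (lne (n_ D x r h) <=
          (C + r + s h * h `^ rho
             + C * `|x| `^ ((rho - eps) / (1 + rho - eps)))%R%:E)%E]) ->
  exists f : C -> C, growth_class_star rho sigma f /\ zero_divisor f D.
Proof.
move=> r1 sig0 [eps [c [s [/andP[e0 er] c0 slim Hn]]]].
(* Halving eps increases the exponent, since t / (1 + t) increases with t. With m = 1 / (1 - p'')
   one has m p'' = rho - e2 < rho, and p' is taken midway. *)
set p := _ / _ in Hn; pose e2 := eps / 2; pose m := 1 + rho - e2.
pose p'' := (rho - e2) / m; pose p' := (p + p'') / 2.
have e20 : 0 < e2 by rewrite /e2; lra.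
have e2e : e2 < eps by rewrite /e2; lra.
have m0 : 0 < m by rewrite /m; lra.
have p0 : 0 < p by apply: divr_gt0; lra.
have pp : p < p'' := exponent_lt e20 e2e er.
have p''1 : p'' < 1 by rewrite /p'' ltr_pdivrMr // /m; lra.
have m1 : (1 - p'') * m = 1 by rewrite mulrBl mul1r divfK ?gt_eqF // /m; ring.
have mp : m * p'' < rho by rewrite mulrC divfK ?gt_eqF //; lra.
have pp' : p < p' by rewrite /p'; lra.
have pp'' : p' < p'' by rewrite /p'; lra.
have p'0 := lt_trans p0 pp'.
have [P [Phi [A [B HP]]]] := divisor_product r1 sig0 p0 (lt_trans pp p''1) (ltW c0) slim Hn.
case: HP => -[PE A0 B0 PD] [Phi_mono Phi0 Phi_evt Pub Plb].
pose E (z : C) := expR (Phi (`|complex.Im z| + 8) + `|complex.Im z| + A * `|complex.Re z| `^ p + B).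
have [G [AG [K [kap [BG [[GE AG0 K0 kap0 BG0] [Gub Glb]]]]]]] := dyadic_product p'0 pp'' p''1.
pose ec := `|c + 2 + s 1 * 1 `^ rho|.
have Hcnt x (L : seq C) : uniq L -> (forall a, a \in L -> inbox x 2 1 a) ->
    (\sum_(a <- L) D a)%N%:R <= expR (ec + c * `|x| `^ p).
  move=> uL HL; apply: le_trans (count_le (Hn x 2 1 (ltr0n R 2) ltr01) uL HL) _.
  by rewrite ler_expR lerD2r /ec ler_norm.
have n8 : 0 <= `|0 : R| + 8 by rewrite normr0 add0r.
have Bq0 : 0 <= Phi (`|0 : R| + 8) + B by rewrite addr_ge0 // Phi0.
have HE t : E t%:C <= expR (Phi (`|0 : R| + 8) + B + A * `|t| `^ p).
  by rewrite /E cImC cReC ler_expR normr0 addr0 addrAC.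
have [b1 [b2 [b10 b20 Hlow]]] := product_lower (E := E) p0 (ltW pp) (ltW p''1) (ltW c0) (normr_ge0 _) A0 Bq0 Hcnt HE Plb.
(* The two terms are the factors of exp ((b2 + AG) |x|^p'') in the loss of P and in the damping at a
   real point. *)
pose K3 := 2 * expR b1 + BG * expR (2 * AG).
have K30 : 0 < K3 by rewrite addr_gt0 // mulr_gt0 // expR_gt0.
have bA0 : 0 <= b2 + AG by rewrite addr_ge0.
have [k0 k00 Hk0] := absorb_exponent K30 bA0.
(* The constant e^k0 lifts f so that the lower bound on the real line holds without additive
   constant. *)
pose f z := P z * cexp (k0%:C - BG%:C * G z).
have hE : entire (fun z => cexp (k0%:C - BG%:C * G z)).
  exact (entire_comp (@entire_cexp R) (entireB (@entire_cst R k0%:C) (@entireZ R BG%:C _ GE))).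
have fE : entire f by exact (entireM PE hE).
have fmod z : cmod (f z) = cmod (P z) * expR (k0 - BG * complex.Re (G z)).
  by rewrite /f cmodM cmod_cexp cReD cReN cReC cReM cReC cImC mul0r subr0.
have low x : exists2 t : R, `|x - t| <= 1 & expR (- expR ((b2 + AG + 1) * `|x| `^ p'')) <= cmod (f t%:C).
  have [t xt Ht] := Hlow x; exists t => //; rewrite fmod.
  apply: (@le_trans _ _ (expR (- (2 * expR (b1 + b2 * `|x| `^ p''))) * expR (k0 - BG * complex.Re (G t%:C)))).
    rewrite -expRD ler_expR; set u := `|x| `^ p''.
    have u0 : 0 <= u := powR_ge0 _ _.
    have Gt : complex.Re (G t%:C) <= expR (2 * AG + AG * u).
      apply: (le_trans (Re_le_cmod _)); apply: (le_trans (Gub _)); rewrite ler_expR cmodR.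
      rewrite (_ : 2 * AG + AG * u = AG * (u + 2)); last by ring.
      exact: ler_wpM2l (powR_near (lt_trans p'0 pp'') (lexx _) (ltW p''1) xt).
    have h3 : 2 * expR (b1 + b2 * u) <= 2 * expR b1 * expR ((b2 + AG) * u).
      by rewrite expRD -mulrA ler_pM2l // ler_pM2l ?expR_gt0 // ler_expR ler_wpM2r // lerDl.
    have h4 : BG * complex.Re (G t%:C) <= BG * expR (2 * AG) * expR ((b2 + AG) * u).
      apply: (le_trans (ler_wpM2l (ltW BG0) Gt)).
      by rewrite expRD -mulrA ler_pM2l // ler_pM2l ?expR_gt0 // ler_expR ler_wpM2r // lerDr.
    rewrite -subr_ge0 (_ : _ - _ = k0 + expR ((b2 + AG + 1) * u) -
      (2 * expR (b1 + b2 * u) + BG * complex.Re (G t%:C))); last by ring.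
    by rewrite subr_ge0; apply: (le_trans (lerD h3 h4)); rewrite -mulrDl; exact: Hk0.
  by rewrite ler_wpM2r ?expR_ge0.
have f_growth : growth_class rho sigma f.
  apply: growth_class_intro fE _ => e e_gt0.
  have := growth_real r1 sig0 p0 pp' pp'' p''1 m0 m1 mp K0 kap0 BG0 AG0 A0 B0 k00 Phi_mono Phi0 Phi_evt e_gt0.
  apply: evt_mono => h h0 Hh z zh; rewrite fmod.
  apply: (@le_trans _ _ (expR (E z) * expR (k0 - BG * complex.Re (G z)))).
    by rewrite ler_wpM2r ?expR_ge0 //; exact: Pub.
  rewrite -expRD ler_expR.
  have := Hh (complex.Re z) (complex.Im z) (BG * complex.Re (G z)) zh (Glb z).
  rewrite (_ : k0 + _ - _ = E z + (k0 - BG * complex.Re (G z))); last by rewrite /E; ring.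
  apply; rewrite -mulrN ler_pM2l //.
  have h5 : - complex.Re (G z) <= cmod (G z) by rewrite -cReN -cmodN Re_le_cmod.
  apply: (le_trans h5); apply: (le_trans (Gub z)); rewrite ler_expR ler_wpM2l // powR_le ?cmod_ge0 ?cmod_leD //.
  by rewrite ltW // (lt_trans p'0).
exists f; split; last first.
  split.
    (* The lower bound on the real line also shows that f is not identically zero. *)
    have [t _ Ht] := low 0; exists t%:C; rewrite -cmod_gt0; apply: lt_le_trans Ht; exact: expR_gt0.
  move=> z; have [g [gE gz Hg]] := PD z.
  exists (fun w => g w * cexp (k0%:C - BG%:C * G w)); split.
  - exact (entireM gE hE).
  - by rewrite mulf_neq0 // cexp_neq0.
  - by move=> w; rewrite /f Hg mulrA.
split; first exact f_growth.
exists e2, 1, (b2 + AG + 1); split; rewrite ?ltr01 ?ltr_wpDl //.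
  by rewrite e20 (lt_trans e2e).
move=> x; rewrite -/m -/p''; have [t xt Ht] := low x.
apply: (@le_trans _ _ (lne (cmod (f t%:C))%:E)); last first.
  by apply: ereal_sup_ubound; exists t.
apply: le_trans (lne_mono (_ : ((expR (- expR ((b2 + AG + 1) * `|x| `^ p'')))%:E <= _)%E)); last by rewrite lee_fin; exact: Ht.
by rewrite lne_EFin ?expR_gt0 // expRK.
Qed.

End Sufficiency.

Unset Implicit Arguments.
Local Close Scope complex_scope.

Theorem theorem3 (R : realType) (D : divisor R) (rho sigma : R)
    (hrho : 1 < rho) (hsigma : 0 <= sigma) :
  (exists f : R[i] -> R[i],
     growth_class_star rho sigma f /\ zero_divisor f D) <->
  (exists (eps C : R) (s : R -> R),
     [/\ 0 < eps < rho, 0 < C, s t @[t --> +oo%R] --> sigma &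
       forall x r h : R, 0 < r -> 0 < h ->
         (lne (n_ D x r h) <=
          (C + r + s h * h `^ rho
             + C * `|x| `^ ((rho - eps) / (1 + rho - eps)))%R%:E)%E]).
Proof.
split; last exact (sufficiency hrho hsigma).
by move=> [f [fg fD]]; exact: (necessity hrho hsigma fg fD).
Qed.
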